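(* Let $X=(X_t)_{t\in[0,T]}$ be a centred Gaussian process. Assume that $$\max_{1\le j\le N(\pi_n)-1}\sum_{k=1}^{N(\pi_n)-1}\frac{1}{\sqrt{\phi(\Delta t_k)\phi(\Delta t_j)}}\left|\mathbb{E}[(X_{t_k}-X_{t_{k-1}})(X_{t_j}-X_{t_{j-1}})]\right|\le H(|\pi_n|)$$ for some function $H(|\pi_n|)$. 1. If $H(|\pi_n|)\to0$ as $|\pi_n|$ tends to zero, then the convergence $$\left|\sum_{k=1}^{N(\pi_n)-1}\frac{(X_{t_k}-X_{t_{k-1}})^2}{\phi(t_k-t_{k-1})}-\sum_{k=1}^{N(\pi_n)-1}\frac{\mathbb{E}(X_{t_k}-X_{t_{k-1}})^2}{\phi(t_k-t_{k-1})}\right|\to0$$ holds in probability. If $H(|\pi_n|)=o\left(\frac1{\log n}\right)$, then this convergence holds almost surely. In these cases the convergence holds also in $L^p$ for any $p\ge1$ provided that $$\lim_{|\pi_n|\to0}\sum_{k=1}^{N(\pi_n)-1}\frac{\mathbb{E}(X_{t_k}-X_{t_{k-1}})^2}{\phi(t_k-t_{k-1})}=K<\infty .$$ 2. Furthermore, assume that $$\lim_{|\pi_n|\to0}\sum_{k=1}^{N(\pi_n)-1}\frac{\mathbb{E}(X_{t_k}-X_{t_{k-1}})^2}{\phi(t_k-t_{k-1})}=K>0 .$$ Then there exists a constant $C>0$ such that $$\sup_{x\in\mathbb{R}}\left|\mathbb{P}\left(\frac{\tilde V_1(\pi_n,\phi)}{\sqrt{\mathrm{Var}(\tilde V_1(\pi_n,\phi))}}<x\right)-\mathbb{P}(Z<x)\right|\le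 C\sqrt{N(\pi_n)}\,H(|\pi_n|),$$ where $Z$ is a standard normal random variable. In particular, if $H(|\pi_n|)=o\left(N(\pi_n)^{-\frac12}\right)$, then $$\frac{\tilde V_1(\pi_n,\phi)}{\sqrt{\mathrm{Var}(\tilde V_1(\pi_n,\phi))}}\to\mathcal{N}(0,1)$$ in law.
   Context: $(\pi_n)$ is a sequence of partitions $\pi_n=\{0=t^n_0<t^n_1<\dots<t^n_{N(\pi_n)-1}=T\}$ of $[0,T]$, where $N(\pi_n)$ is the number of points; the superscript $n$ is dropped. $\Delta t_k=t_k-t_{k-1}$, $|\pi_n|=\max_k\Delta t_k$ is the mesh, $m(\pi_n)=\min_k\Delta t_k$, and it is assumed throughout that $|\pi_n|/m(\pi_n)\le k(|\pi_n|)$, $n\ge1$, for some function $k(\cdot)$. $\phi$ is a given function (positive on the increments $\Delta t_k$, so that the expressions make sense). $V_1(\pi_n,\phi)=\sum_{k=1}^{N(\pi_n)-1}\frac{(X_{t_k}-X_{t_{k-1}})^2}{\phi(t_k-t_{k-1})}$ is the first order $\phi$-quadratic variation sum along $\pi_n$, and $\tilde V_1(\pi_n,\phi)=V_1(\pi_n,\phi)-\mathbb{E}V_1(\pi_n,\phi)$.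
   Formalization: In item 1, convergence in probability and almost surely are stated under the added assumption that the sums of E(X_{t_k}-X_{t_{k-1}})^2/φ(Δt_k) are bounded in n; without it they fail (Brownian motion, uniform partitions, φ(x)=√x, H(x)=√x). *)

(* Defs.v *)
From HB Require Import structures.
From mathcomp Require Export all_boot all_order all_algebra.
From mathcomp Require Export all_classical all_reals all_analysis.

Set Implicit Arguments.
Unset Strict Implicit.
Unset Printing Implicit Defensive.

Export Order.TTheory GRing.Theory Num.Theory.
Export numFieldNormedType.Exports.

Local Open Scope classical_set_scope.
Local Open Scope ereal_scope.
Local Open Scope ring_scope.

(* A partition 0 = t_0 < t_1 < ... < t_(N-1) = T is represented, as in
   [itv_partition 0 T s], by the sequence s = [:: t_1; ...; t_(N-1)]: it has
   N = (size s).+1 points and size s increments. The increment written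
   t_(k+1) - t_k below is indexed by k : 'I_(size s). *)
Section partitions.
Context {R : realType}.
Implicit Types (s : seq R) (k : nat).

Definition grid s k : R := nth 0 (0 :: s) k.

Definition num_points s : nat := (size s).+1.

Definition step s k : R := grid s k.+1 - grid s k.

(* the steps of a partition are positive, so the default 0 is harmless *)
Definition mesh s : R := \big[Num.max/0]_(k < size s) step s k.

(* no step exceeds the mesh, so this default is harmless *)
Definition min_step s : R := \big[Num.min/mesh s]_(k < size s) step s k.

End partitions.

Section gaussian.
Context {d : measure_display} {Om : measurableType d} {R : realType}.
Variable P : probability Om R.

(* Constants count as Gaussian. They need their own case: in the library
   [normal_prob m 0] is not the Dirac mass at m. *)
Definition gaussian_rv (Y : Om -> R) : Prop :=
  exists m sigma : R, 0 <= sigma /\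
    forall A : set R, measurable A ->
      P (Y @^-1` A) = if sigma == 0 then \d_m A else normal_prob m sigma A.

Definition gaussian_process (I : set R) (X : R -> {RV P >-> R}) : Prop :=
  forall (n : nat) (t a : 'I_n -> R), (forall i, I (t i)) ->
    gaussian_rv (fun w => \sum_(i < n) a i * X (t i) w).

Definition centred_process (I : set R) (X : R -> {RV P >-> R}) : Prop :=
  forall t, I t -> 'E_P[X t] = 0%E.

End gaussian.

Section convergence.
Context {d : measure_display} {Om : measurableType d} {R : realType}.
Variable P : probability Om R.

Definition cvg_prob (Y : nat -> Om -> R) (l : R) : Prop :=
  forall e : R, 0 < e -> P [set w | e < `|Y n w - l|] @[n --> \oo] --> 0%E.

Definition cvg_as (Y : nat -> Om -> R) (l : R) : Prop :=
  {ae P, forall w, Y n w @[n --> \oo] --> l}.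

Definition cvg_Lp (p : R) (Y : nat -> Om -> R) (l : R) : Prop :=
  'E_P[fun w => `|Y n w - l| `^ p] @[n --> \oo] --> 0%E.

Definition cvg_law (Y : nat -> Om -> R) (mu : set R -> \bar R) : Prop :=
  forall x : R, {for x, continuous (fun y : R => mu `]-oo, y]%classic)} ->
    P [set w | Y n w <= x] @[n --> \oo] --> mu `]-oo, x]%classic.

End convergence.

Section quadratic_variation.
Context {d : measure_display} {Om : measurableType d} {R : realType}.
Variables (P : probability Om R) (X : R -> {RV P >-> R}) (phi : R -> R).
Implicit Types (s : seq R) (k : nat).

Definition incr s k : Om -> R :=
  fun w => X (grid s k.+1) w - X (grid s k) w.

Definition qv1 s : Om -> R :=
  fun w => \sum_(k < size s) (incr s k w) ^+ 2 / phi (step s k).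

Definition qv1_mean s : R :=
  \sum_(k < size s) fine 'E_P[fun w => (incr s k w) ^+ 2] / phi (step s k).

Definition qv1_centred s : Om -> R := fun w => qv1 s w - fine 'E_P[qv1 s].

Definition qv1_normalized s : Om -> R :=
  fun w => qv1_centred s w / Num.sqrt (fine 'V_P[qv1_centred s]).

Definition max_cov_sum s : R :=
  \big[Num.max/0]_(j < size s) \sum_(k < size s)
    1 / Num.sqrt (phi (step s k) * phi (step s j)) *
    `|fine 'E_P[fun w => incr s k w * incr s j w]|.

Definition kolmogorov_dist (Y : Om -> R) (mu : set R -> \bar R) : \bar R :=
  ereal_sup (range (fun x : R =>
    `|P [set w | (Y w < x)%R] - mu `]-oo, x[%classic|))%E.

End quadratic_variation.

(* Main.v *)
Require Import Defs.
From mathcomp Require Import all_boot all_order all_algebra.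
From mathcomp Require Import all_classical all_reals all_analysis.
From mathcomp Require Import measurable_realfun ring lra zify.
From mathcomp Require complex.
Import Order.TTheory GRing.Theory Num.Theory.
Import numFieldNormedType.Exports.
Local Open Scope classical_set_scope.
Local Open Scope ring_scope.

Set Implicit Arguments.
Unset Strict Implicit.
Unset Printing Implicit Defensive.

(* Diagonalising the covariance matrix of the normalised increments writes
   V_1 = sum_i Z_i^2 with uncorrelated jointly Gaussian Z_i, whose variances lam_i
   are at most the largest row sum of the matrix, hence at most H.

   The exponential moments of V_1 - E V_1 are those of a variable with variance
   proxy sum_i lam_i^2 <= H * E V_1; Chernoff's bound and Borel-Cantelli give the
   convergences in probability, in L^p and almost surely.

   For the normal approximation, put m := E V_1, sigma^2 := Var V_1 =
   2 sum_i lam_i^2 and G := 2 sum_i lam_i Z_i^2. Gaussian integration by parts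
   reads E[(V_1 - m) f(V_1)] = E[G f'(V_1)]. Inserting the bounded solution of
   Stein's equation bounds the Kolmogorov distance by 2 E|1 - G / sigma^2|, and
   the variance of G is O(H^2 sigma^2). This leaves O(H / sigma), and
   sigma^2 >= 2 m^2 / N by Cauchy-Schwarz. *)

(** * Real-valued integrals *)

(** The definition of a Gaussian process gives only the one-dimensional laws of linear combinations;
    neither a joint density nor the independence of the Z_i is ever established. What is recorded
    about the Z_i is therefore the mean of the cosine and of the exponential of their linear forms.
    Squares are reached from linear forms by an auxiliary normal variable and an exchange of
    integrals, which produces the product formulas for Laplace transforms of quadratic forms.
    Exponential moments, the variance and the integration by parts for f(v) = exp(-kv) are
    consequences of these formulas.

    Exponentials suffice for the integration by parts because, in the variable x = exp(-ev), they
    are the powers of x: Weierstrass' theorem gives the other test functions.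

    Stein's equation is solved for continuous h with values in [0,1], so that f' is continuous and
    the integration by parts applies. The resulting bound uses only that f' is at most 2 in absolute
    value and ignores the modulus of continuity of h; indicators of half-lines are then limits of
    such h, with the same constant and no loss in the rate. *)

Section real_integrals.
Context {d : measure_display} {T : measurableType d} {R : realType}.
Variable mu : {measure set T -> \bar R}.
Implicit Types f g : T -> R.
Local Notation intble f := (mu.-integrable setT (EFin \o f)).

Lemma integrable_measurable f : intble f -> measurable_fun setT f.
Proof. by move=> /integrableP[/measurable_EFinP]. Qed.

Lemma Rintegral_EFin f : intble f ->
  (\int[mu]_x f x)%:E = (\int[mu]_x (f x)%:E)%E.
Proof. by move=> fi; rewrite /Rintegral fineK//; exact: integrable_fin_num. Qed.

Lemma integrable_dominated f g : measurable_fun setT f ->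
  (forall x, `|f x| <= g x) -> intble g -> intble f.
Proof.
move=> mf fg; apply: le_integrable => //; first exact/measurable_EFinP.
by move=> x _; rewrite /= lee_fin (le_trans (fg x))// ler_norm.
Qed.

Lemma integrable_add f g : intble f -> intble g ->
  intble (fun x => f x + g x).
Proof. by move=> fi gi; exact: (integrableD measurableT fi gi). Qed.

Lemma integrable_sub f g : intble f -> intble g ->
  intble (fun x => f x - g x).
Proof. by move=> fi gi; exact: (integrableB measurableT fi gi). Qed.

Lemma integrable_scale (k : R) f : intble f -> intble (fun x => k * f x).
Proof. by move=> fi; exact: (integrableZl measurableT k fi). Qed.

Lemma integrable_sumr (I : finType) (F : I -> T -> R) :
  (forall i, intble (F i)) -> intble (fun x => \sum_i F i x).
Proof.
move=> Fi; rewrite (_ : _ \o _ = fun x => (\sum_i (F i x)%:E)%E); last first.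
  by apply/funext => x; rewrite /= sumEFin.
by apply: integrable_sum => // i _; exact: Fi.
Qed.

Lemma Rintegral_sum (I : finType) (F : I -> T -> R) :
  (forall i, intble (F i)) ->
  \int[mu]_x (\sum_i F i x) = \sum_i \int[mu]_x F i x.
Proof.
move=> Fi; apply: EFin_inj; rewrite Rintegral_EFin; last exact: integrable_sumr.
rewrite -sumEFin; under [RHS]eq_bigr do rewrite Rintegral_EFin//.
by rewrite -integral_sum//; apply: eq_integral => x _; rewrite sumEFin.
Qed.

Lemma integrable_bounded_mul f g (C : R) : measurable_fun setT f ->
  (forall x, `|f x| <= C) -> intble g -> intble (fun x => f x * g x).
Proof.
move=> mf fC gi; apply: (@integrable_dominated _ (fun x => C * `|g x|)).
- by apply: measurable_funM => //; exact: integrable_measurable.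
- by move=> x; rewrite normrM ler_wpM2r.
- by apply: integrable_scale; exact: integrable_norm.
Qed.

Lemma Rintegral_norm_le f g : measurable_fun setT f ->
  (forall x, `|f x| <= g x) -> intble g -> `|\int[mu]_x f x| <= \int[mu]_x g x.
Proof.
move=> mf fg gi; have fi := integrable_dominated mf fg gi.
apply: (le_trans (le_normr_Rintegral measurableT fi)).
by apply: le_Rintegral => //; exact: integrable_norm.
Qed.

Lemma Rintegral_dominated_cvg (f_ : nat -> T -> R) f g :
  (forall n, measurable_fun setT (f_ n)) ->
  (forall x, f_ n x @[n --> \oo] --> f x) ->
  (forall n x, `|f_ n x| <= g x) -> intble g ->
  \int[mu]_x f_ n x @[n --> \oo] --> \int[mu]_x f x.
Proof.
move=> mf_ f_f f_g gi.
have mf : measurable_fun setT f by apply: (measurable_fun_cvg mf_) => x _; exact: f_f.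
have fg x : `|f x| <= g x.
  by apply: (cvgr_to_le (cvg_norm (f_f x))); apply: nearW => n; exact: f_g.
apply: fine_cvg; rewrite -/(Rintegral mu setT f) Rintegral_EFin; last first.
  exact: integrable_dominated gi.
apply: (@dominated_cvg _ _ _ mu _ measurableT (fun n => EFin \o f_ n)
  (EFin \o f) (EFin \o g)) => //.
- by move=> n; exact/measurable_EFinP.
- by move=> x _; apply: cvg_EFin; [exact: nearW|exact: f_f].
- by move=> n x _; rewrite /= lee_fin.
Qed.

End real_integrals.

Section probability_integrals.
Context {d : measure_display} {T : measurableType d} {R : realType}.
Variable P : probability T R.
Implicit Types f g : T -> R.
Local Notation intble f := (P.-integrable setT (EFin \o f)).

Lemma integrable_cstP (k : R) : intble (fun=> k).
Proof. exact: finite_measure_integrable_cst. Qed.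

Lemma integrable_bounded f (C : R) : measurable_fun setT f ->
  (forall x, `|f x| <= C) -> intble f.
Proof. by move=> mf fC; apply: (integrable_dominated mf fC); exact: integrable_cstP. Qed.

Lemma Rintegral_cstP (k : R) : \int[P]_x k = k.
Proof.
rewrite Rintegral_cst//.
have -> : fine (P setT) = 1 by rewrite probability_setT.
by rewrite mulr1.
Qed.

End probability_integrals.

Lemma cvg_le_harmonic {R : realType} (u : nat -> R) (K : R) :
  (forall n, `|u n| <= K / n.+1%:R) -> u n @[n --> \oo] --> 0.
Proof.
move=> uK; apply: norm_cvg0.
apply: (@squeeze_cvgr _ _ _ _ (fun=> 0) (fun n => K / n.+1%:R)).
- by apply: nearW => n; rewrite normr_ge0 uK.
- exact: cvg_cst.
- rewrite -(mulr0 K); apply: cvgM; first exact: cvg_cst.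
  exact: cvg_harmonic.
Qed.

(** * The standard normal law *)

Section normal_law.
Context {R : realType}.
Local Notation mu := (@lebesgue_measure R).

(** The Radon-Nikodym derivative of [normal_prob m s] and the function [normal_pdf m s] have the
    same integral over every measurable set, hence agree almost everywhere. *)
Lemma ge0_integral_normal_prob (m s : R) (f : R -> \bar R) :
  (forall x, (0 <= f x)%E) -> measurable_fun setT f ->
  (\int[normal_prob m s]_x f x = \int[mu]_x (f x * (normal_pdf m s x)%:E))%E.
Proof.
move=> f0 mf.
have dom := @normal_prob_dominates R m s.
rewrite -(Radon_Nikodym_SigmaFinite.change_of_variables dom)//.
apply: ae_eq_integral => //.
- apply: emeasurable_funM => //; apply: (measurable_int mu).
  exact: Radon_Nikodym_SigmaFinite.f_integrable.
- apply: emeasurable_funM => //; apply/measurable_EFinP.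
  exact: measurable_normal_pdf.
- apply: ae_eqe_mul2l => /=.
  apply: integral_ae_eq => //.
  + exact: Radon_Nikodym_SigmaFinite.f_integrable.
  + by apply/measurable_EFinP; exact: measurable_normal_pdf.
  + by move=> E _ mE; rewrite -Radon_Nikodym_SigmaFinite.f_integral.
Qed.

Definition std_normal : probability (measurableTypeR R) R := normal_prob 0 1.

Lemma ge0_integral_normal_affine (m s : R) (f : R -> R) : 0 < s ->
  continuous f -> (forall x, 0 <= f x) ->
  (\int[normal_prob m s]_x (f x)%:E = \int[std_normal]_x (f (m + s * x))%:E)%E.
Proof.
move=> s0 cf f0.
have mf : measurable_fun setT f by exact: continuous_measurable_fun.
have caff : continuous (fun x : R => m + s * x).
  move=> x; apply: cvgD; first exact: cvg_cst.
  by apply: cvgM; [exact: cvg_cst|exact: cvg_id].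
have mfa : measurable_fun setT (fun x : R => f (m + s * x)).
  apply: continuous_measurable_fun => x.
  by apply: (continuous_comp (caff x)); exact: cf.
rewrite !ge0_integral_normal_prob; last 4 first.
- by move=> x; rewrite lee_fin.
- exact/measurable_EFinP.
- by move=> x; rewrite lee_fin.
- by apply/measurable_EFinP.
under eq_integral do rewrite -EFinM.
under [RHS]eq_integral do rewrite -EFinM.
have d1 (x : R) : is_derive x 1 (fun x : R => m + s * x) s.
  by apply: is_derive_eq; rewrite add0r mul1r [_%:A]mulr1.
have dE : (fun x : R => m + s * x)^`()%classic = cst s.
  by apply/funext => x; rewrite derive1E; case: (d1 x).
rewrite (@increasing_ge0_integration_by_substitutionT _ (fun x : R => m + s * x)
   (fun x => f x * normal_pdf m s x)); last first.
- by move=> x; rewrite mulr_ge0// normal_pdf_ge0.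
- move=> x; apply: cvgM; [exact: cf|].
  by apply: continuous_normal_pdf; rewrite gt_eqF.
- apply/cvgryPge => A; near=> x.
  rewrite -lerBlDl mulrC -ler_pdivrMr//; near: x; exact: nbhs_pinfty_ge.
- apply/cvgrNyPle => A; near=> x.
  rewrite -lerBrDl mulrC -ler_pdivlMr//; near: x; exact: nbhs_ninfty_le.
- by move=> x; case: (d1 x).
- by rewrite dE; exact: is_cvg_cst.
- by rewrite dE; exact: is_cvg_cst.
- by rewrite dE => x; exact: cvg_cst.
- by move=> x y xy; rewrite ltrD2l ltr_pM2l.
apply: eq_integral => x _; rewrite dE/= !fctE/=; congr (_%:E).
rewrite -mulrA; congr (_ * _).
rewrite !normal_pdfE ?gt_eqF//= /normal_peak /normal_fun.
rewrite expr1n mul1r -mulrnAr sqrtrM ?sqr_ge0// sqrtr_sqr gtr0_norm//.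
rewrite (addrC m) addrK subr0 exprMn invfM.
have -> : - (s ^+ 2 * x ^+ 2) / (s ^+ 2 *+ 2) = - x ^+ 2 / 2.
  by field; rewrite gt_eqF.
by rewrite mulrC !mulrA mulfV ?mul1r// gt_eqF.
Unshelve. all: by end_near. Qed.

End normal_law.

Section gauss_calculus.
Context {R : realType}.
Local Notation mu := (@lebesgue_measure R).

(** The fundamental theorem of calculus on [-n, n], then dominated convergence. This is the
    boundary-free form of integration by parts on the line. *)
Lemma Rintegral_derive_eq0 (F f : R -> R) :
  (forall x : R, is_derive x (1 : R) F (f x)) -> continuous f ->
  mu.-integrable setT (EFin \o f) ->
  F n%:R @[n --> \oo] --> 0 -> F (- n%:R) @[n --> \oo] --> 0 ->
  \int[mu]_x f x = 0.
Proof.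
move=> dF cf intf Fy FNy.
pose f_ n : R -> R := f \_ `[- n%:R, n%:R].
have mf : measurable_fun setT f by exact: continuous_measurable_fun.
have H : \int[mu]_x f_ n x @[n --> \oo] --> \int[mu]_x f x.
  apply: (@Rintegral_dominated_cvg _ _ _ mu f_ f (fun x => `|f x|)).
  - by move=> n; apply/measurable_restrict => //; exact: measurable_funS mf.
  - move=> x; apply: cvg_near_cst; near=> n.
    rewrite /f_/= patchE mem_set//= in_itv/= -ler_norml.
    near: n; exact: nbhs_infty_ger.
  - by move=> n x; rewrite /f_ patchE; case: ifP; rewrite ?normr0.
  - exact: integrable_norm.
have cF : continuous F.
  by move=> x; apply/differentiable_continuous/derivable1_diffP; case: (dF x).
(* The index is shifted because the fundamental theorem asks for an interval with distinct
   endpoints. *)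
have intn n : \int[mu]_x f_ n.+1 x = F n.+1%:R - F (- n.+1%:R).
  apply: (@EFin_inj R); rewrite Rintegral_EFin; last first.
    apply: (@integrable_dominated _ (measurableTypeR R) R mu (f_ n.+1) (fun x => `|f x|)).
    - by apply/measurable_restrict => //; exact: measurable_funS mf.
    - by move=> x; rewrite /f_ patchE; case: ifP; rewrite ?normr0.
    - exact: integrable_norm.
  rewrite /f_ EFinB -(@continuous_FTC2 _ f F).
  - rewrite [RHS]integral_mkcond; apply: eq_integral => x _.
    by rewrite restrict_EFin.
  - by rewrite (@lt_trans _ _ 0)// oppr_lt0 ltr0n.
  - exact: continuous_subspaceT.
  - split.
    + by move=> x _; case: (dF x).
    + by apply: cvg_at_right_filter; exact: cF.
    + by apply: cvg_at_left_filter; exact: cF.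
  - by move=> x _; rewrite derive1E; case: (dF x).
have H1 : \int[mu]_x f_ n.+1 x @[n --> \oo] --> (0 - 0 : R).
  under eq_fun do rewrite intn.
  by apply: cvgB; [move: Fy|move: FNy]; rewrite -cvg_shiftS.
rewrite subr0 in H1.
by move: H; rewrite -cvg_shiftS/= => H; exact: (cvg_unique _ H H1).
Unshelve. all: by end_near. Qed.

End gauss_calculus.

Section gauss_moments.
Context {R : realType}.
Local Notation mu := (@lebesgue_measure R).
Local Notation gamma := (@std_normal R).
Local Notation phi := (normal_pdf (0 : R) 1).

Lemma std_normal_pdfE (x : R) : phi x = normal_peak 1 * expR (- x ^+ 2 / 2).
Proof.
by rewrite normal_pdfE ?oner_neq0//= /normal_fun subr0 expr1n mulr2n.
Qed.

Lemma std_normal_integrableP (f : R -> R) : measurable_fun setT f ->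
  gamma.-integrable setT (EFin \o f) <->
  mu.-integrable setT (EFin \o (fun x => f x * phi x)).
Proof.
move=> mf.
have mp : measurable_fun setT phi by exact: measurable_normal_pdf.
have E : (\int[gamma]_x `|(f x)%:E| = \int[mu]_x `|(f x * phi x)%:E|)%E.
  rewrite ge0_integral_normal_prob//.
    by apply: eq_integral => x _; rewrite !abse_EFin -EFinM normrM (ger0_norm (normal_pdf_ge0 _ _ _)).
  by apply: measurableT_comp => //; exact/measurable_EFinP.
split=> /integrableP[_ fi]; apply/integrableP; split.
- by apply/measurable_EFinP; exact: measurable_funM.
- by rewrite -E.
- exact/measurable_EFinP.
- by rewrite E.
Qed.

Lemma Rintegral_std_normal (f : R -> R) :
  gamma.-integrable setT (EFin \o f) ->
  \int[gamma]_x f x = \int[mu]_x (f x * phi x).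
Proof.
move=> fi; have mf := integrable_measurable fi.
have mp : measurable_fun setT phi by exact: measurable_normal_pdf.
have mfE : measurable_fun setT (EFin \o f) by exact/measurable_EFinP.
rewrite /Rintegral; congr fine; rewrite integralE [RHS]integralE.
rewrite !ge0_integral_normal_prob//.
- congr (_ - _)%E; apply: eq_integral => x _.
  + rewrite !funeposE -EFin_max -EFinM -EFin_max maxr_pMl ?mul0r ?normal_pdf_ge0//.
  + rewrite !funenegE -!EFinN -EFin_max -EFinM -EFin_max maxr_pMl ?mul0r ?normal_pdf_ge0//.
    by rewrite mulNr.
- exact: measurable_funeneg.
- exact: measurable_funepos.
Qed.

Lemma normal_mgf (t : R) :
  (\int[gamma]_x (expR (t * x))%:E = (expR (t ^+ 2 / 2))%:E)%E.
Proof.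
have me : measurable_fun setT (fun x : R => expR (t * x)).
  by apply: measurableT_comp => //; exact: measurable_funM.
rewrite ge0_integral_normal_prob//; last exact/measurable_EFinP.
transitivity ((expR (t ^+ 2 / 2))%:E * \int[mu]_x (normal_pdf t 1 x)%:E)%E;
  last by rewrite integral_normal_pdf mule1.
rewrite -ge0_integralZl//; last 2 first.
- by apply/measurable_EFinP; exact: measurable_normal_pdf.
- by move=> x _; rewrite lee_fin normal_pdf_ge0.
apply: eq_integral => x _; rewrite -!EFinM; congr (_%:E).
rewrite !normal_pdfE ?oner_neq0//= /normal_fun mulrCA [RHS]mulrCA -!expRD.
by congr (_ * expR _); rewrite expr1n; field.
Qed.

(** Up to the factor s = (1 + 2c)^(-1/2), the integrand times the standard density is the density
    with standard deviation s. Negative c are included: they give the exponential moments of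
    squares. *)
Lemma normal_sq_mgf (c : R) : - (1 / 2) < c ->
  (\int[gamma]_x (expR (- c * x ^+ 2))%:E = ((Num.sqrt (1 + 2 * c))^-1)%:E)%E.
Proof.
move=> c0; have c1 : 0 < 1 + 2 * c by lra.
have me : measurable_fun setT (fun x : R => expR (- c * x ^+ 2)).
  by apply: measurableT_comp => //; apply: measurable_funM => //; exact: measurable_funX.
rewrite ge0_integral_normal_prob//; last exact/measurable_EFinP.
pose s := (Num.sqrt (1 + 2 * c))^-1.
have s0 : 0 < s by rewrite invr_gt0 sqrtr_gt0.
have s2 : s ^+ 2 = (1 + 2 * c)^-1 by rewrite exprVn sqr_sqrtr// ltW.
transitivity (s%:E * \int[mu]_x (normal_pdf 0 s x)%:E)%E;
  last by rewrite integral_normal_pdf mule1.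
rewrite -ge0_integralZl//; last 3 first.
- by apply/measurable_EFinP; exact: measurable_normal_pdf.
- by move=> x _; rewrite lee_fin normal_pdf_ge0.
- by rewrite lee_fin ltW.
apply: eq_integral => x _; rewrite -!EFinM; congr (_%:E).
rewrite !normal_pdfE ?oner_neq0 ?gt_eqF//= /normal_fun mulrCA -!expRD [RHS]mulrA.
congr (_ * expR _).
- rewrite /normal_peak expr1n mul1r -mulrnAr sqrtrM ?sqr_ge0// sqrtr_sqr gtr0_norm//.
  by rewrite invfM mulrA mulfV ?mul1r// gt_eqF.
- by rewrite s2 expr1n subr0; field; rewrite gt_eqF.
Qed.

(** The case c = -1/4 of [normal_sq_mgf]. This function dominates everything of at most quadratic
    growth. *)
Lemma std_normal_integrable_expR_sq4 :
  gamma.-integrable setT (EFin \o (fun x : R => expR (x ^+ 2 / 4))).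
Proof.
have me : measurable_fun setT (fun x : R => expR (x ^+ 2 / 4)).
  by apply: measurableT_comp => //; apply: measurable_funM => //; exact: measurable_funX.
apply/integrableP; split; first exact/measurable_EFinP.
have := @normal_sq_mgf (- (1 / 4)) _; rewrite (_ : - (1 / 2) < - (1 / 4)); last by lra.
move=> /(_ isT) H.
under eq_integral do rewrite /= ger0_norm ?expR_ge0//.
rewrite [X in (X < _)%E](_ : _ = ((Num.sqrt (1 + 2 * (- (1 / 4))))^-1)%:E)%E ?ltry//.
by rewrite -H; apply: eq_integral => x _; congr (expR _)%:E; field.
Qed.

Lemma ler_1D_sqr_expR (x : R) : 1 + x ^+ 2 <= 4 * expR (x ^+ 2 / 4).
Proof. by have := expR_ge1Dx (x ^+ 2 / 4); lra. Qed.

Lemma std_normal_integrable_quadratic (f : R -> R) (C : R) :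
  measurable_fun setT f -> (forall x, `|f x| <= C * (1 + x ^+ 2)) ->
  gamma.-integrable setT (EFin \o f).
Proof.
move=> mf fC; have C0 : 0 <= C.
  by have := le_trans (normr_ge0 _) (fC 0); rewrite expr0n/= addr0 mulr1.
apply: (@integrable_dominated _ (measurableTypeR R) R gamma f
  (fun x => C * 4 * expR (x ^+ 2 / 4))) => //.
  move=> x; rewrite (le_trans (fC x))// -mulrA ler_wpM2l//.
  exact: ler_1D_sqr_expR.
by apply: integrable_scale; exact: std_normal_integrable_expR_sq4.
Qed.

Lemma is_derive_phi (x : R) : is_derive x 1 phi (- x * phi x).
Proof.
rewrite (_ : phi = fun x => normal_peak 1 * expR (- x ^+ 2 / 2)); last first.
  by apply/funext => y; rewrite std_normal_pdfE.
apply: is_derive_eq.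
by rewrite /GRing.scale/=; field.
Qed.

(** Square 1 + x^2 <= 4 exp(x^2/4), whence 16. This polynomial decay disposes of the boundary terms
    in the integration by parts. *)
Lemma std_normal_pdf_le (x : R) : phi x <= 16 * normal_peak 1 / (1 + x ^+ 2) ^+ 2.
Proof.
have x1 : 0 < 1 + x ^+ 2 by rewrite ltr_pwDl// sqr_ge0.
rewrite std_normal_pdfE (mulrC 16) -mulrA ler_wpM2l ?normal_peak_ge0//.
rewrite ler_pdivlMr ?exprn_gt0//.
have -> : (16 : R) = 4 ^+ 2 by rewrite -natrX.
have -> : - x ^+ 2 / 2 = 2%:R * - (x ^+ 2 / 4) by field.
rewrite expRM_natl -exprMn ler_sqr ?nnegrE ?mulr_ge0 ?expR_ge0 ?(ltW x1)//.
have := ler_1D_sqr_expR x; rewrite -(ler_pM2l (expR_gt0 (- (x ^+ 2 / 4)))) => /le_trans; apply.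
by rewrite mulrCA [expR _ * _]mulrC expRxMexpNx_1 mulr1.
Qed.

(** Since phi' = -x phi, the function (x g - g') phi is the derivative of -g phi, which vanishes at
    infinity. *)
Lemma normal_integration_by_parts (g g' : R -> R) (C : R) :
  (forall x : R, is_derive x (1 : R) g (g' x)) -> continuous g' ->
  (forall x, `|g x| <= C * (1 + `|x|)) ->
  (forall x, `|g' x| <= C * (1 + `|x|)) ->
  \int[gamma]_x (x * g x) = \int[gamma]_x g' x.
Proof.
move=> dg cg' gC g'C.
have C0 : 0 <= C.
  by have := le_trans (normr_ge0 _) (gC 0); rewrite normr0 addr0 mulr1.
have cg : continuous g.
  by move=> x; apply/differentiable_continuous/derivable1_diffP; case: (dg x).
have cphi : continuous phi by apply: continuous_normal_pdf; exact: oner_neq0.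
have mg : measurable_fun setT g by exact: continuous_measurable_fun.
have mg' : measurable_fun setT g' by exact: continuous_measurable_fun.
have quad (x : R) : `|x| <= (1 + x ^+ 2) / 2 by rewrite -(real_normK (num_real x)); have := sqr_ge0 (`|x| - 1); nra.
have ixg : gamma.-integrable setT (EFin \o (fun x : R => x * g x)).
  apply: (@std_normal_integrable_quadratic _ (2 * C)).
    by apply: measurable_funM.
  move=> x; rewrite normrM (le_trans (ler_wpM2l (normr_ge0 _) (gC x)))//.
  by have := quad x; rewrite -(real_normK (num_real x)); nra.
have ig' : gamma.-integrable setT (EFin \o g').
  apply: (@std_normal_integrable_quadratic _ (2 * C)) => //.
  by move=> x; rewrite (le_trans (g'C x))//; have := quad x; nra.
apply/eqP; rewrite -subr_eq0 -RintegralB//; apply/eqP.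
rewrite Rintegral_std_normal; last exact: integrable_sub.
apply: (@Rintegral_derive_eq0 _ (fun x => - (g x * phi x))).
- move=> x.
  have d1 := dg x; have d2 := is_derive_phi x.
  by apply: is_derive_eq; rewrite /GRing.scale/=; ring.
- move=> x; apply: cvgM; last exact: cphi.
  by apply: cvgB; [apply: cvgM; [exact: cvg_id|exact: cg]|exact: cg'].
- apply/std_normal_integrableP; last exact: integrable_sub.
  by apply: measurable_funB => //; apply: measurable_funM.
(* At both ends, (1 + n) / (1 + n^2)^2 <= 2 / (n + 1), because (n + 1)^2 <= 2 (1 + n^2)^2. *)
all: apply: (@cvg_le_harmonic _ _ (C * (2 * (16 * normal_peak 1)))) => n.
all: rewrite normrN normrM (ger0_norm (normal_pdf_ge0 _ _ _)) -mulrA.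
all: rewrite (le_trans (ler_wpM2r (normal_pdf_ge0 _ _ _) (gC _)))//.
all: rewrite -mulrA ler_wpM2l//.
all: rewrite (le_trans (ler_wpM2l _ (std_normal_pdf_le _)))//.
all: try by rewrite addr_ge0.
all: set c := 16 * normal_peak 1.
all: have c0 : 0 <= c by rewrite mulr_ge0 ?normal_peak_ge0.
all: rewrite ?normrN ?sqrrN.
all: rewrite (ger0_norm (ler0n _ _)).
all: rewrite -natr1 addrC; set N : R := n%:R.
all: have N0 : 0 <= N by rewrite ler0n.
all: rewrite mulrA ler_pdivrMr ?exprn_gt0 ?ltr_pwDl ?sqr_ge0//.
all: rewrite mulrAC ler_pdivlMr ?ltr_wpDl//.
all: have E : (N + 1) ^+ 2 <= 2 * (1 + N ^+ 2) ^+ 2 by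
  have := sqr_ge0 (N - 1); have := sqr_ge0 N; nra.
all: have := ler_wpM2l c0 E; nra.
Qed.

(** The characteristic function through its differential equation: K' = -u K by Gaussian integration
    by parts, so K(u) exp(u^2/2) is constant. The phase [x] keeps the computation real and later
    absorbs a linear form in the Gaussian variables. *)
Lemma normal_cos (x t : R) :
  \int[gamma]_g cos (x + t * g) = cos x * expR (- t ^+ 2 / 2).
Proof.
have cm (h : R -> R) (a b : R) : continuous h -> continuous (fun g => h (a + b * g)).
  move=> ch y; apply: (@continuous_comp _ _ _ (fun g => a + b * g) h); last exact: ch.
  apply: cvgD; first exact: cvg_cst.
  by apply: cvgM; [exact: cvg_cst|exact: cvg_id].
have mcos a b : measurable_fun setT (fun g : R => cos (a + b * g)).
  by apply: continuous_measurable_fun; apply: cm; exact: continuous_cos.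
have msin a b : measurable_fun setT (fun g : R => sin (a + b * g)).
  by apply: continuous_measurable_fun; apply: cm; exact: continuous_sin.
pose K (u : R) := \int[gamma]_g cos (x + u * g).
have dc (u g : R) : is_derive u (1 : R) (fun u => cos (x + u * g)) (- (g * sin (x + u * g))).
  by apply: is_derive_eq; rewrite /GRing.scale/=; ring.
have iabs : gamma.-integrable setT (EFin \o (fun g : R => `|g|)).
  apply: (@std_normal_integrable_quadratic _ 1) => [|y].
    exact: measurableT_comp.
  by rewrite normr_id -(real_normK (num_real y)); have := sqr_ge0 (`|y| - 1); nra.
have icos u : gamma.-integrable setT (EFin \o (fun g : R => cos (x + u * g))).
  apply: (@integrable_bounded _ (measurableTypeR R) R gamma (fun g => cos (x + u * g)) 1).
    exact: mcos.
  by move=> g; exact: cos_max.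
have dK u : is_derive u (1 : R) K (- (u * K u)).
  (* Differentiation under the integral takes place on a neighbourhood of [u]; the partial
     derivative -g sin(x + v g) is dominated by |g| for every v. *)
  have uI : `]u - 1, u + 1[%classic u.
    by rewrite /= in_itv/=; lra.
  have icosI (v : R) : `]u - 1, u + 1[%classic v ->
    gamma.-integrable setT (EFin \o (fun g : R => cos (x + v * g))) by [].
  have ub (v g : R) : `]u - 1, u + 1[%classic v -> setT g ->
      `|partial1of2 (fun v g => cos (x + v * g)) v g| <= `|g|.
    move=> _ _; rewrite partial1of2E.
    have [_ ->] := dc v g.
    by rewrite normrN normrM ler_piMr// sin_max.
  have der (v g : R) : `]u - 1, u + 1[%classic v -> setT g ->
      derivable (fun v : R => cos (x + v * g)) v (1 : R).
    by move=> _ _; case: (dc v g).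
  apply: DeriveDef.
    exact: (derivable_under_integral measurableT uI icosI der _ iabs ub).
  rewrite -derive1E.
  rewrite (differentiation_under_integral measurableT uI icosI der _ iabs ub)//.
  under eq_Rintegral do rewrite partial1of2E.
  have -> : \int[gamma]_g ('D_1 (fun v : R => cos (x + v * g)) u) =
      - \int[gamma]_g (g * sin (x + u * g)).
    rewrite -mulN1r -RintegralZl//; last first.
      apply: (@integrable_dominated _ (measurableTypeR R) R gamma
        (fun g => g * sin (x + u * g)) _ _ _ iabs); first by apply: measurable_funM => //; exact: msin.
      by move=> g; rewrite normrM ler_piMr// sin_max.
    by apply: eq_Rintegral => g _; case: (dc u g) => _ ->; rewrite mulN1r.
  have ds (g : R) : is_derive g (1 : R) (fun g => sin (x + u * g)) (u * cos (x + u * g)).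
    by apply: is_derive_eq; rewrite /GRing.scale/=; ring.
  rewrite (@normal_integration_by_parts _ _ (1 + `|u|) ds).
  - by rewrite RintegralZl.
  - by move=> g; apply: cvgM; [exact: cvg_cst|apply: cm; exact: continuous_cos].
  - move=> g; rewrite (le_trans (sin_max _))//.
    by rewrite -[leLHS]mulr1 ler_pM// lerDl.
  - move=> g; rewrite normrM -[leLHS]/(_ * _).
    by rewrite ler_pM// ?lerDr ?(le_trans (cos_max _))// ?lerDl.
have dE u : is_derive u (1 : R) (fun u => K u * expR (u ^+ 2 / 2)) 0.
  have := dK u => ?.
  by apply: is_derive_eq; rewrite /GRing.scale/=; field.
have := is_derive_0_is_cst t 0 dE; rewrite expr0n/= mul0r expR0 mulr1 => E.
rewrite -/(K t); apply: (mulIf (lt0r_neq0 (expR_gt0 (t ^+ 2 / 2)))).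
rewrite E -mulrA mulNr -expRD addNr expR0 mulr1.
rewrite /K; under eq_Rintegral do rewrite mul0r addr0.
by rewrite Rintegral_cstP.
Qed.

Lemma normal_mean : \int[gamma]_g g = 0.
Proof.
transitivity (\int[gamma]_g (g * 1)).
  by apply: eq_Rintegral => g _; rewrite mulr1.
have d1 (x : R) : is_derive x (1 : R) (fun=> 1 : R) 0 by exact: is_derive_cst.
rewrite (@normal_integration_by_parts _ _ 1 d1).
- by rewrite Rintegral_cstP.
- by move=> x; exact: cvg_cst.
- by move=> x; rewrite normr1 mul1r lerDl.
- by move=> x; rewrite normr0 mul1r addr_ge0.
Qed.

Lemma normal_second_moment : \int[gamma]_g g ^+ 2 = 1.
Proof.
under eq_Rintegral do rewrite expr2.
have d1 (x : R) : is_derive x (1 : R) id (1 : R) by exact: is_derive_id.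
rewrite (@normal_integration_by_parts _ _ 1 d1).
- by rewrite Rintegral_cstP.
- by move=> x; exact: cvg_cst.
- by move=> x; rewrite mul1r lerDr.
- by move=> x; rewrite normr1 mul1r lerDl.
Qed.

End gauss_moments.

(** * Integrals of functions of one Gaussian variable *)

Section gaussian_variables.
Context {d : measure_display} {Om : measurableType d} {R : realType}.
Variable P : probability Om R.
Local Notation gamma := (@std_normal R).

(** The pair m, s is chosen before f, so that all integrals refer to the same parameters. The Dirac
    case is the same formula with s = 0. *)
Lemma gaussian_rv_ge0_integral (Y : Om -> R) : measurable_fun setT Y ->
  gaussian_rv P Y -> exists m s : R, forall f : R -> R, continuous f ->
    (forall x, 0 <= f x) ->
    (\int[P]_w (f (Y w))%:E = \int[gamma]_x (f (m + s * x))%:E)%E.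
Proof.
move=> mY [m [s [s0 HY]]]; exists m, s => f cf f0.
have mf : measurable_fun setT f by exact: continuous_measurable_fun.
have mfE : measurable_fun setT (EFin \o f) by exact/measurable_EFinP.
transitivity (\int[pushforward P (Y : Om -> measurableTypeR R)]_x (f x)%:E)%E.
  by rewrite ge0_integral_pushforward// => x _; rewrite lee_fin.
have [s_eq0|s_neq0] := eqVneq s 0.
  transitivity (\int[@dirac _ (measurableTypeR R) m R]_x (f x)%:E)%E.
    apply: eq_measure_integral => A mA _.
    by transitivity (P (Y @^-1` A)) => //; rewrite HY// s_eq0 eqxx.
  rewrite integral_dirac// diracT mul1e.
  rewrite (eq_integral (cst (f m)%:E)); last first.
    by move=> x _; rewrite s_eq0 mul0r addr0.
  by rewrite integral_cst// [X in (_ * X)%E]probability_setT mule1.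
rewrite -ge0_integral_normal_affine//; last by rewrite lt_neqAle eq_sym s_neq0.
apply: eq_measure_integral => A mA _.
by transitivity (P (Y @^-1` A)) => //; rewrite HY// (negbTE s_neq0).
Qed.

Lemma gaussian_rv_integral (Y : Om -> R) : measurable_fun setT Y ->
  gaussian_rv P Y -> exists m s : R,
  (forall f : R -> R, continuous f -> (forall x, 0 <= f x) ->
    (\int[P]_w (f (Y w))%:E = \int[gamma]_x (f (m + s * x))%:E)%E) /\
  (forall f : R -> R, continuous f ->
    gamma.-integrable setT (EFin \o (fun x => f (m + s * x))) ->
    P.-integrable setT (EFin \o (fun w => f (Y w))) /\
    \int[P]_w (f (Y w)) = \int[gamma]_x (f (m + s * x))).
Proof.
move=> mY gY; have [m [s H]] := gaussian_rv_ge0_integral mY gY.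
exists m, s; split => // f cf fi.
have mf : measurable_fun setT f by exact: continuous_measurable_fun.
have caf : continuous (fun x => `|f x|) by move=> x; apply: cvg_norm; exact: cf.
have int_abs : P.-integrable setT (EFin \o (fun w => `|f (Y w)|)).
  apply/integrableP; split.
    by apply/measurable_EFinP; do 2 apply: measurableT_comp => //.
  under eq_integral do rewrite /= normr_id.
  rewrite (H (fun x => `|f x|))//.
  by have /integrableP[_] := fi.
have int_f : P.-integrable setT (EFin \o (fun w => f (Y w))).
  by apply: (integrable_dominated _ _ int_abs) => //; exact: measurableT_comp.
split => //.
have int_absg := integrable_norm fi.
have E1 : \int[P]_w `|f (Y w)| = \int[gamma]_x `|f (m + s * x)|.
  by rewrite /Rintegral (H (fun x => `|f x|)).
(* Signed f: both |f| and |f| + f are continuous and nonnegative, and their integrals are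
   subtracted. *)
have E2 : \int[P]_w (`|f (Y w)| + f (Y w)) =
    \int[gamma]_x (`|f (m + s * x)| + f (m + s * x)).
  rewrite /Rintegral (H (fun x => `|f x| + f x))//.
    by move=> x; apply: cvgD; [exact: caf|exact: cf].
  by move=> x; rewrite -lerBlDr sub0r ler_normr lexx orbT.
by move: E2; rewrite !RintegralD// E1 => /addrI.
Qed.

(** Mean zero forces m = 0, and the second moment is then s^2: both transforms depend on this moment
    alone, and the parameters of the law disappear. *)
Lemma centred_gaussian_integrals (Y : Om -> R) : measurable_fun setT Y ->
  gaussian_rv P Y -> \int[P]_w Y w = 0 ->
  [/\ P.-integrable setT (EFin \o (fun w => Y w ^+ 2)),
      forall b, \int[P]_w cos (Y w + b) =
        cos b * expR (- (\int[P]_w (Y w ^+ 2)) / 2) &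
      (\int[P]_w (expR (Y w))%:E = (expR ((\int[P]_w (Y w ^+ 2)) / 2))%:E)%E].
Proof.
move=> mY gY EY0; have [m [s [H1 H2]]] := gaussian_rv_integral mY gY.
have [iid E] : P.-integrable setT (EFin \o (fun w => Y w)) /\
    \int[P]_w Y w = \int[gamma]_x (m + s * x).
  apply: (H2 id) => [x|]; first exact: cvg_id.
  apply: integrable_add; first exact: (integrable_cstP gamma).
  apply: integrable_scale.
  apply: (@std_normal_integrable_quadratic _ _ 1) => // x.
  by rewrite mul1r -(real_normK (num_real x)); have := sqr_ge0 (`|x| - 1); nra.
have ix : gamma.-integrable setT (EFin \o (fun x : R => x)).
  apply: (@std_normal_integrable_quadratic _ _ 1) => // x.
  by rewrite mul1r -(real_normK (num_real x)); have := sqr_ge0 (`|x| - 1); nra.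
have ix2 : gamma.-integrable setT (EFin \o (fun x : R => x ^+ 2)).
  apply: (@std_normal_integrable_quadratic _ _ 1) => [|x].
    exact: measurable_funX.
  by rewrite mul1r ger0_norm ?sqr_ge0// lerDr.
have m0 : m = 0.
  move: E; rewrite EY0 RintegralD//; last 2 first.
  - exact: (integrable_cstP gamma).
  - exact: integrable_scale.
  by rewrite Rintegral_cstP RintegralZl// normal_mean mulr0 addr0 => <-.
subst m.
have [i2 E2] : P.-integrable setT (EFin \o (fun w => Y w ^+ 2)) /\
    \int[P]_w (Y w ^+ 2) = \int[gamma]_x ((0 + s * x) ^+ 2).
  apply: (H2 (fun x => x ^+ 2)) => [x|]; first exact: sqr_continuous.
  rewrite (_ : _ \o _ = EFin \o (fun x => s ^+ 2 * x ^+ 2)); last first.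
    by apply/funext => x; rewrite /= add0r exprMn.
  exact: integrable_scale.
have Es : \int[P]_w (Y w ^+ 2) = s ^+ 2.
  rewrite E2; under eq_Rintegral do rewrite add0r exprMn.
  by rewrite RintegralZl// normal_second_moment mulr1.
split => //.
- move=> b; rewrite Es.
  have cc : continuous (fun x : R => cos (x + b)).
    move=> x; apply: (@continuous_comp _ _ _ (fun x : R => x + b) cos); last exact: continuous_cos.
    by apply: cvgD; [exact: cvg_id|exact: cvg_cst].
  have ic : gamma.-integrable setT (EFin \o (fun x : R => cos (0 + s * x + b))).
    apply: (@integrable_bounded _ (measurableTypeR R) R gamma _ 1); last first.
      by move=> x; exact: cos_max.
    apply: continuous_measurable_fun => x.
    apply: (@continuous_comp _ _ _ (fun x : R => 0 + s * x)
      (fun x : R => cos (x + b))); last exact: cc.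
    apply: cvgD; first exact: cvg_cst.
    by apply: cvgM; [exact: cvg_cst|exact: cvg_id].
  have [_ ->] := H2 (fun x => cos (x + b)) cc ic.
  under eq_Rintegral do rewrite add0r addrC.
  exact: normal_cos.
- rewrite Es (H1 expR); last 2 first.
  + exact: continuous_expR.
  + by move=> x; exact: expR_ge0.
  under eq_integral do rewrite add0r.
  exact: normal_mgf.
Qed.

End gaussian_variables.

(** * Quadratic forms in Gaussian variables *)

Section bounded_fubini.
Context {d1 d2 : measure_display} {T1 : measurableType d1} {T2 : measurableType d2}.
Context {R : realType}.
Variables (P : probability T1 R) (Q : probability T2 R).

Lemma bounded_Fubini (f : T1 * T2 -> R) (C : R) : measurable_fun setT f ->
  (forall z, `|f z| <= C) ->
  \int[P]_x \int[Q]_y f (x, y) = \int[Q]_y \int[P]_x f (x, y).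
Proof.
move=> mf fC.
have mfE : measurable_fun setT (EFin \o f) by exact/measurable_EFinP.
have iP y : P.-integrable setT (EFin \o (fun x => f (x, y))).
  apply: (@integrable_bounded _ _ _ P _ C) => // x.
  exact: measurableT_comp.
have iQ x : Q.-integrable setT (EFin \o (fun y => f (x, y))).
  apply: (@integrable_bounded _ _ _ Q _ C) => // y.
  exact: measurableT_comp.
have i2 : (P \x Q)%E.-integrable setT (EFin \o f).
  apply: measurable_bounded_integrable => //.
    have := @product_measure1E _ _ _ _ R P Q setT setT measurableT measurableT.
    rewrite setXTT => E; apply: (@le_lt_trans _ _ (1 * 1)%E).
      by rewrite [leLHS]E; apply: lee_pmul => //; exact: probability_le1.
    by rewrite mule1 ltry.
  exists C; split; [exact: num_real|move=> M CM z _].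
  by apply: (le_trans (fC z)); exact: ltW.
transitivity (fine (\int[P]_x \int[Q]_y (f (x, y))%:E)%E).
  by congr fine; apply: eq_integral => x _; exact: Rintegral_EFin.
transitivity (fine (\int[Q]_y \int[P]_x (f (x, y))%:E)%E).
  by congr fine; exact: (Fubini i2).
by congr fine; apply: eq_integral => y _; rewrite Rintegral_EFin.
Qed.

End bounded_fubini.

(* Uncorrelated jointly Gaussian variables, through the only consequences of
   their joint law that are used. *)
Record gaussian_coordinates {d : measure_display} {Om : measurableType d}
    {R : realType} (P : probability Om R) {I : finType} (Z : I -> Om -> R)
    (lam : I -> R) : Prop := GaussianCoordinates {
  gc_measurable : forall i, measurable_fun setT (Z i) ;
  gc_integrable_sqr : forall i, P.-integrable setT (EFin \o (fun w => Z i w ^+ 2)) ;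
  gc_variance : forall i, \int[P]_w (Z i w ^+ 2) = lam i ;
  gc_cos : forall (a : I -> R) (b : R),
    \int[P]_w cos (\sum_i a i * Z i w + b) =
    cos b * expR (- (\sum_i a i ^+ 2 * lam i) / 2) ;
  gc_expR : forall a : I -> R,
    (\int[P]_w (expR (\sum_i a i * Z i w))%:E =
     (expR ((\sum_i a i ^+ 2 * lam i) / 2))%:E)%E }.

Lemma gc_variance_ge0 {d : measure_display} {Om : measurableType d}
    {R : realType} (P : probability Om R) {I : finType} (Z : I -> Om -> R)
    (lam : I -> R) : gaussian_coordinates P Z lam -> forall i, 0 <= lam i.
Proof.
by move=> hZ i; rewrite -(gc_variance hZ); apply: Rintegral_ge0 => w _; exact: sqr_ge0.
Qed.

Section gaussian_quadratic_forms.
Context {d : measure_display} {Om : measurableType d} {R : realType}.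
Variable P : probability Om R.
Variables (I : finType) (Z : I -> Om -> R) (lam : I -> R).
Hypothesis hZ : gaussian_coordinates P Z lam.
Let mZ := gc_measurable hZ.
Let lam0 := gc_variance_ge0 hZ.
Let cosZ := gc_cos hZ.
Let expZ := gc_expR hZ.
Local Notation gamma := (@std_normal R).

Let shift (a : I -> R) (j : I) (c : R) : I -> R :=
  fun i => if i == j then c else a i.

Let sum_shift a j c w : a j = 0 ->
  \sum_i shift a j c i * Z i w = \sum_i a i * Z i w + c * Z j w.
Proof.
move=> aj0; rewrite (bigD1 j)//= [in RHS](bigD1 j)//= aj0 mul0r add0r addrC.
rewrite /shift eqxx; congr (_ + _); apply: eq_bigr => i /negbTE ij.
by rewrite ij.
Qed.

Let sum_shift_sqr a j c : a j = 0 ->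
  \sum_i shift a j c i ^+ 2 * lam i = \sum_i a i ^+ 2 * lam i + c ^+ 2 * lam j.
Proof.
move=> aj0; rewrite (bigD1 j)//= [in RHS](bigD1 j)//= aj0 expr0n/= mul0r add0r addrC.
rewrite /shift eqxx; congr (_ + _); apply: eq_bigr => i /negbTE ij.
by rewrite ij.
Qed.

Let mlin (a : I -> R) : measurable_fun setT (fun w => \sum_i a i * Z i w).
Proof. by apply: measurable_sum => i; apply: measurable_funM. Qed.

Let mquad (r : seq I) (u : I -> R) :
  measurable_fun setT (fun w => \sum_(i <- r) u i * Z i w ^+ 2).
Proof. by apply: measurable_sum => i; apply: measurable_funM => //; exact: measurable_funX. Qed.

Let mexpsq (c : R) : measurable_fun setT (fun g : R => expR (c * g ^+ 2)).
Proof.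
by apply: measurableT_comp => //; apply: measurable_funM => //; exact: measurable_funX.
Qed.

Let mexplin (c : R) : measurable_fun setT (fun g : R => expR (c * g)).
Proof. by apply: measurableT_comp => //; apply: measurable_funM. Qed.

(* Linearisation: exp(- u z^2) is the mean of cos(sqrt(2 u) z g) for a standard
   normal [g], so that the squares can be traded one by one for linear terms. *)
Lemma cos_quadratic_form (u : I -> R) (r : seq I) (a : I -> R) (b : R) :
  (forall i, 0 <= u i) -> uniq r -> (forall i, i \in r -> a i = 0) ->
  \int[P]_w (cos (\sum_i a i * Z i w + b) *
             expR (- \sum_(i <- r) u i * Z i w ^+ 2)) =
  cos b * expR (- (\sum_i a i ^+ 2 * lam i) / 2) *
  \prod_(i <- r) (Num.sqrt (1 + 2 * (u i * lam i)))^-1.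
Proof.
move=> u0; elim: r a b => [|j r IH] a b /=.
  move=> _ _; rewrite big_nil mulr1 -cosZ; apply: eq_Rintegral => w _.
  by rewrite big_nil oppr0 expR0 mulr1.
move=> /andP[jr ur] ar.
have aj0 : a j = 0 by apply: ar; rewrite mem_head.
(* With this s, the mean over g of cos(y + s z g) is cos(y) exp(-(s z)^2/2) = cos(y) exp(-u z^2). *)
pose s := Num.sqrt (2 * u j).
have s2 : s ^+ 2 = 2 * u j by rewrite sqr_sqrtr// mulr_ge0.
pose f (z : Om * R) := cos (\sum_i a i * Z i z.1 + b + s * Z j z.1 * z.2) *
  expR (- \sum_(i <- r) u i * Z i z.1 ^+ 2).
have mf : measurable_fun setT f.
  apply: measurable_funM.
    apply: (@measurableT_comp _ _ _ _ _ _ (@cos R)).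
      by apply: continuous_measurable_fun; exact: continuous_cos.
    apply: measurable_funD.
      apply: measurable_funD => //.
      by apply: (measurableT_comp (mlin a)).
    apply: measurable_funM => //; apply: measurable_funM => //.
    by apply: (measurableT_comp (mZ j)).
  apply: measurableT_comp => //; apply: measurableT_comp => //.
  by apply: (measurableT_comp (mquad r u)).
have fC z : `|f z| <= 1.
  rewrite normrM mulr_ile1// ?cos_max// ger0_norm ?expR_ge0//.
  rewrite -expR0 ler_expR oppr_le0 sumr_ge0// => i _.
  by rewrite mulr_ge0// sqr_ge0.
transitivity (\int[P]_w \int[gamma]_g f (w, g)).
  apply: eq_Rintegral => w _.
  transitivity (\int[gamma]_g (expR (- \sum_(i <- r) u i * Z i w ^+ 2) *
     cos (\sum_i a i * Z i w + b + s * Z j w * g))); last first.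
    by apply: eq_Rintegral => g _; rewrite /f/= mulrC.
  rewrite RintegralZl//; last first.
    apply: (@integrable_bounded _ (measurableTypeR R) R gamma _ 1); last first.
      by move=> x; exact: cos_max.
    apply: (@measurableT_comp _ _ _ _ _ _ (@cos R)).
      by apply: continuous_measurable_fun; exact: continuous_cos.
    by apply: measurable_funD => //; apply: measurable_funM.
  rewrite normal_cos big_cons opprD expRD.
  rewrite (_ : - (s * Z j w) ^+ 2 / 2 = - (u j * Z j w ^+ 2)); first by ring.
  by rewrite exprMn s2; field.
rewrite (bounded_Fubini P gamma mf fC).
transitivity (\int[gamma]_g (cos b * expR (- (\sum_i a i ^+ 2 * lam i) / 2) *
    (\prod_(i <- r) (Num.sqrt (1 + 2 * (u i * lam i)))^-1) *
    expR (- (u j * lam j) * g ^+ 2))).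
  apply: eq_Rintegral => g _.
  (* Once g is fixed, s Z_j g is a linear term. The induction hypothesis applies because j is not in
     r, so that the new coefficient at j is harmless. *)
  transitivity (\int[P]_w (cos (\sum_i shift a j (s * g) i * Z i w + b) *
      expR (- \sum_(i <- r) u i * Z i w ^+ 2))).
    apply: eq_Rintegral => w _; rewrite /f/= sum_shift//.
    by congr (cos _ * _); ring.
  rewrite IH//; last first.
    move=> i ir; rewrite /shift; case: eqP => [ij|_].
      by rewrite -ij ir in jr.
    by apply: ar; rewrite inE ir orbT.
  rewrite sum_shift_sqr//; set S := \sum_i _.
  rewrite (_ : - (S + (s * g) ^+ 2 * lam j) / 2 = - S / 2 + - (u j * lam j) * g ^+ 2).
    by rewrite expRD; ring.
  by rewrite exprMn s2; field.
have c0 : - (1 / 2) < u j * lam j by rewrite (@lt_le_trans _ _ 0)// ?mulr_ge0//; lra.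
rewrite RintegralZl//; last first.
  apply: (@integrable_bounded _ (measurableTypeR R) R gamma _ 1).
    exact: mexpsq.
  move=> g; rewrite ger0_norm ?expR_ge0// -expR0 ler_expR mulNr oppr_le0.
  by apply: mulr_ge0; [exact: mulr_ge0|exact: sqr_ge0].
rewrite /Rintegral normal_sq_mgf//= big_cons.
by ring.
Qed.

(** The same linearisation with exp(u z^2) as the mean of exp(sqrt(2u) z g). The integrand is
    unbounded but nonnegative, so Tonelli replaces Fubini; the condition on 2 u lam keeps the
    integral over g finite. *)
Lemma expR_quadratic_form (u : I -> R) (r : seq I) (a : I -> R) :
  (forall i, 0 <= u i) -> (forall i, 2 * (u i * lam i) < 1) ->
  uniq r -> (forall i, i \in r -> a i = 0) ->
  (\int[P]_w (expR (\sum_i a i * Z i w) *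
              expR (\sum_(i <- r) u i * Z i w ^+ 2))%:E =
  (expR ((\sum_i a i ^+ 2 * lam i) / 2) *
  \prod_(i <- r) (Num.sqrt (1 - 2 * (u i * lam i)))^-1)%:E)%E.
Proof.
move=> u0 ul1; elim: r a => [|j r IH] a /=.
  move=> _ _; rewrite big_nil mulr1 -expZ; apply: eq_integral => w _.
  by rewrite big_nil expR0 mulr1.
move=> /andP[jr ur] ar.
have aj0 : a j = 0 by apply: ar; rewrite mem_head.
pose s := Num.sqrt (2 * u j).
have s2 : s ^+ 2 = 2 * u j by rewrite sqr_sqrtr// mulr_ge0.
pose f (z : Om * R) := expR (\sum_i a i * Z i z.1 + s * Z j z.1 * z.2) *
  expR (\sum_(i <- r) u i * Z i z.1 ^+ 2).
have mf : measurable_fun setT f.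
  apply: measurable_funM.
    apply: measurableT_comp => //.
    apply: measurable_funD.
      by apply: (measurableT_comp (mlin a)).
    apply: measurable_funM => //; apply: measurable_funM => //.
    by apply: (measurableT_comp (mZ j)).
  apply: measurableT_comp => //.
  by apply: (measurableT_comp (mquad r u)).
have f0 z : 0 <= f z by rewrite mulr_ge0 ?expR_ge0.
transitivity (\int[P]_w \int[gamma]_g (f (w, g))%:E)%E.
  apply: eq_integral => w _.
  transitivity (\int[gamma]_g ((expR (\sum_i a i * Z i w) *
     expR (\sum_(i <- r) u i * Z i w ^+ 2))%:E *
     (expR (s * Z j w * g))%:E))%E; last first.
    apply: eq_integral => g _; rewrite /f/= -EFinM expRD; congr (_%:E); ring.
  rewrite ge0_integralZl//; last first.
    by apply/measurable_EFinP; exact: mexplin.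
  rewrite normal_mgf big_cons expRD -EFinM; congr (_%:E).
  rewrite (_ : (s * Z j w) ^+ 2 / 2 = u j * Z j w ^+ 2); first by ring.
  by rewrite exprMn s2; field.
rewrite (fubini_tonelli (m1 := P) (m2 := gamma) (EFin \o f))/=; last 2 first.
- exact/measurable_EFinP.
- by move=> z; rewrite lee_fin.
transitivity (\int[gamma]_g ((expR ((\sum_i a i ^+ 2 * lam i) / 2) *
    (\prod_(i <- r) (Num.sqrt (1 - 2 * (u i * lam i)))^-1))%:E *
    (expR (- (- (u j * lam j)) * g ^+ 2))%:E))%E.
  apply: eq_integral => g _.
  transitivity (\int[P]_w (expR (\sum_i shift a j (s * g) i * Z i w) *
      expR (\sum_(i <- r) u i * Z i w ^+ 2))%:E)%E.
    apply: eq_integral => w _; rewrite /f/= sum_shift//.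
    by congr (expR _ * _)%:E; ring.
  rewrite IH//; last first.
    move=> i ir; rewrite /shift; case: eqP => [ij|_].
      by rewrite -ij ir in jr.
    by apply: ar; rewrite inE ir orbT.
  rewrite sum_shift_sqr// -EFinM; congr (_%:E); set S := \sum_i _.
  rewrite (_ : (S + (s * g) ^+ 2 * lam j) / 2 = S / 2 + - - (u j * lam j) * g ^+ 2).
    by rewrite expRD; ring.
  by rewrite exprMn s2; field.
have c0 : - (1 / 2) < - (u j * lam j) by have := ul1 j; lra.
rewrite ge0_integralZl//; last 2 first.
- by apply/measurable_EFinP; exact: mexpsq.
- rewrite lee_fin mulr_ge0 ?expR_ge0//; apply: prodr_ge0 => i _.
  by rewrite invr_ge0 sqrtr_ge0.
rewrite normal_sq_mgf// big_cons -EFinM mulrN; congr (_%:E).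
by ring.
Qed.

End gaussian_quadratic_forms.

(** From 1/(1-x) = 1 + x/(1-x) <= exp(x/(1-x)) and x/(1-x) <= x + 2x^2, then a square root. Negative
    x are allowed, which serves both signs of the exponent in [gaussian_quadratic_mgf_le]. *)
Lemma invr_sqrtr_onem_le {R : realType} (x : R) : x <= 1 / 2 ->
  (Num.sqrt (1 - x))^-1 <= expR (x / 2 + x ^+ 2).
Proof.
move=> x2; have x1 : 0 < 1 - x by lra.
rewrite -[leRHS]gtr0_norm ?expR_gt0// -sqrtr_sqr -(sqrtrV (ltW x1)) ler_sqrt ?exprn_gt0 ?expR_gt0//.
rewrite -expRM_natl; apply: (@le_trans _ _ (expR (x / (1 - x)))).
  rewrite [leLHS](_ : _ = 1 + x / (1 - x)) ?expR_ge1Dx//.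
  by field; rewrite gt_eqF.
rewrite ler_expR ler_pdivrMr//.
have : 0 <= x ^+ 2 * (1 - 2 * x) by rewrite mulr_ge0 ?sqr_ge0//; lra.
by nra.
Qed.

Lemma sqr_le_expRD {R : realType} (x : R) : x ^+ 2 / 2 <= expR x + expR (- x).
Proof.
wlog x0 : x / 0 <= x => [H|].
  have [/H//|x0] := leP 0 x.
  have := H (- x) _; rewrite opprK sqrrN addrC; apply.
  by rewrite oppr_ge0 ltW.
have := expR_ge1Dxn 1 x0; rewrite (_ : 2`!%:R = 2 :> R)//.
by have := expR_gt0 (- x); lra.
Qed.

Lemma cvg_difference_quotient_expR {R : realType} (y : R) :
  (1 - expR (- (n.+1%:R^-1 * y))) / n.+1%:R^-1 @[n --> \oo] --> y.
Proof.
have d : is_derive (0 : R) (1 : R) (fun t => - expR (- (t * y))) y.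
  apply: is_derive_eq; rewrite /GRing.scale/= mul0r oppr0 expR0; ring.
have [dl dE] := d.
have {}dl : h^-1 *: ((fun t => - expR (- (t * y))) (h *: (1 : R) + 0) -
    (fun t => - expR (- (t * y))) 0) @[h --> 0^'] -->
    'D_(1 : R) (fun t : R => - expR (- (t * y))) (0 : R).
  exact: dl.
rewrite dE in dl.
have hne (n : nat) : n.+1%:R^-1 != 0 :> R by rewrite invr_eq0 pnatr_eq0.
have := (cvgr_dnbhsP _ _ _).1 dl (fun n => n.+1%:R^-1) (conj hne (@cvg_harmonic R)).
apply: cvg_trans; apply: near_eq_cvg; apply: nearW => n /=.
by rewrite mul0r oppr0 expR0 addr0 [_%:A]mulr1 opprK /GRing.scale/= [LHS]mulrC addrC.
Qed.

(** * Exponential moments and variance of Gaussian quadratic forms *)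

Section gaussian_quadratic_moments.
Context {d : measure_display} {Om : measurableType d} {R : realType}.
Variable P : probability Om R.

(** E[Y W] is minus the derivative at t = 0 of E[W exp(-tY)], taken along t = 1/(n+1). Dominated
    convergence applies since 1 - exp(-a) <= a for a >= 0. Moments are thus read off from Laplace
    transforms. *)
Lemma Rintegral_difference_quotient (Y W : Om -> R) (q : nat -> R) (l : R) :
  measurable_fun setT Y -> (forall w, 0 <= Y w) ->
  P.-integrable setT (EFin \o W) ->
  P.-integrable setT (EFin \o (fun w => Y w * W w)) ->
  (forall n, \int[P]_w W w - \int[P]_w (W w * expR (- (n.+1%:R^-1 * Y w))) =
     n.+1%:R^-1 * q n) ->
  q n @[n --> \oo] --> l ->
  \int[P]_w (Y w * W w) = l.
Proof.
move=> mY Y0 iW iYW Hq ql.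
have mW := integrable_measurable iW.
have me (c : R) : measurable_fun setT (fun w => expR (- (c * Y w))).
  by do 2 (apply: measurableT_comp => //); apply: measurable_funM.
have bnd (c : R) (w : Om) : 0 <= c -> `|expR (- (c * Y w))| <= 1.
  by move=> c0; rewrite ger0_norm ?expR_ge0// expR_le1 oppr_le0 mulr_ge0.
have ie (n : nat) : P.-integrable setT (EFin \o (fun w => W w * expR (- (n.+1%:R^-1 * Y w)))).
  rewrite (_ : _ \o _ = EFin \o (fun w => expR (- (n.+1%:R^-1 * Y w)) * W w)); last first.
    by apply/funext => w /=; rewrite mulrC.
  apply: (@integrable_bounded_mul _ _ _ _ _ _ 1) => // w.
  by apply: bnd; rewrite invr_ge0.
pose f n w := (1 - expR (- (n.+1%:R^-1 * Y w))) / n.+1%:R^-1 * W w.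
have fq n : \int[P]_w f n w = q n.
  have -> : q n = n.+1%:R * (n.+1%:R^-1 * q n).
    by rewrite mulrA divff ?mul1r// pnatr_eq0.
  rewrite -Hq -RintegralB// -RintegralZl//; last exact: integrable_sub.
  by apply: eq_Rintegral => w _; rewrite /f invrK; ring.
have Hl : \int[P]_w f n w @[n --> \oo] --> l by under eq_fun do rewrite fq.
suff H : \int[P]_w f n w @[n --> \oo] --> \int[P]_w (Y w * W w).
  exact: (cvg_unique _ H Hl).
apply: (@Rintegral_dominated_cvg _ _ _ P f _ (fun w => `|Y w * W w|)).
- move=> n; apply: measurable_funM => //; apply: measurable_funM => //.
  exact: measurable_funB.
- move=> w; apply: cvgM; last exact: cvg_cst.
  exact: cvg_difference_quotient_expR.
- move=> n w; rewrite /f !normrM ler_wpM2r// invrK.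
  have n0 : 0 < n.+1%:R^-1 :> R by rewrite invr_gt0 ltr0n.
  rewrite (ger0_norm (Y0 w)) -ler_pdivlMr; last by rewrite normr_gt0 pnatr_eq0.
  rewrite ger0_norm; last by rewrite subr_ge0 expR_le1 oppr_le0 mulr_ge0// ltW.
  rewrite gtr0_norm ?ltr0n// [leRHS]mulrC.
  by rewrite lerBlDr addrC -lerBlDr; exact: expR_ge1Dx.
- exact: integrable_norm.
Qed.

Variables (I : finType) (Z : I -> Om -> R) (lam : I -> R).
Hypothesis hZ : gaussian_coordinates P Z lam.
Let mZ := gc_measurable hZ.
Let lam0 := gc_variance_ge0 hZ.

Let mquad (u : I -> R) : measurable_fun setT (fun w => \sum_i u i * Z i w ^+ 2).
Proof. by apply: measurable_sum => i; apply: measurable_funM => //; exact: measurable_funX. Qed.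

Lemma gaussian_laplace (u : I -> R) : (forall i, 0 <= u i) ->
  \int[P]_w expR (- \sum_i u i * Z i w ^+ 2) =
  \prod_i (Num.sqrt (1 + 2 * (u i * lam i)))^-1.
Proof.
move=> u0.
have := @cos_quadratic_form _ _ _ P _ Z lam hZ u (index_enum I) (fun=> 0) 0 u0
  (index_enum_uniq I) (fun _ _ => erefl).
have S0 (F : I -> R) : \sum_i 0 * F i = 0 by apply: big1 => i _; rewrite mul0r.
have -> : \sum_(i : I) 0 ^+ 2 * lam i = 0.
  by apply: big1 => i _; rewrite expr0n/= mul0r.
rewrite oppr0 mul0r expR0 cos0 !mul1r => <-.
by apply: eq_Rintegral => w _; rewrite S0 addr0 cos0 mul1r.
Qed.

Lemma gaussian_mgf (u : I -> R) : (forall i, 0 <= u i) ->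
  (forall i, 2 * (u i * lam i) < 1) ->
  (\int[P]_w (expR (\sum_i u i * Z i w ^+ 2))%:E =
  (\prod_i (Num.sqrt (1 - 2 * (u i * lam i)))^-1)%:E)%E.
Proof.
move=> u0 u1.
have := @expR_quadratic_form _ _ _ P _ Z lam hZ u (index_enum I) (fun=> 0) u0 u1
  (index_enum_uniq I) (fun _ _ => erefl).
have S0 (F : I -> R) : \sum_i 0 * F i = 0 by apply: big1 => i _; rewrite mul0r.
have -> : \sum_(i : I) 0 ^+ 2 * lam i = 0.
  by apply: big1 => i _; rewrite expr0n/= mul0r.
rewrite mul0r expR0 mul1r => <-.
by apply: eq_integral => w _; rewrite S0 expR0 mul1r.
Qed.

(** Each factor of the product formula is bounded by [invr_sqrtr_onem_le] at x = 2 t wt lam. The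
    terms x/2 cancel against the centring; the terms x^2 give the exponent. *)
Lemma gaussian_quadratic_mgf_le (wt : I -> R) (t : R) :
  (forall i, 0 <= wt i) -> (forall i, t * (wt i * lam i) <= 1 / 4) ->
  (\int[P]_w (expR (t * (\sum_i wt i * Z i w ^+ 2 - \sum_i wt i * lam i)))%:E
    <= (expR (4 * t ^+ 2 * \sum_i (wt i * lam i) ^+ 2))%:E)%E.
Proof.
move=> wt0 tw.
have E : (\int[P]_w (expR (\sum_i (t * wt i) * Z i w ^+ 2))%:E =
  (\prod_i (Num.sqrt (1 - 2 * (t * wt i * lam i)))^-1)%:E)%E.
  (* For t >= 0 the smallness of t wt lam is needed for finiteness; for t < 0 the integrand is
     bounded and the Laplace transform applies. *)
  have [t0|t0] := leP 0 t.
    apply: gaussian_mgf => i; first exact: mulr_ge0.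
    by have := tw i; rewrite mulrA; lra.
  transitivity ((\int[P]_w expR (- \sum_i (- t * wt i) * Z i w ^+ 2))%:E).
    rewrite Rintegral_EFin; last first.
      apply: (@integrable_bounded _ _ _ P _ 1).
        by do 2 (apply: measurableT_comp => //); exact: mquad.
      move=> w; rewrite ger0_norm ?expR_ge0// expR_le1 oppr_le0 sumr_ge0// => i _.
      by rewrite mulr_ge0 ?sqr_ge0// mulr_ge0// oppr_ge0 ltW.
    apply: eq_integral => w _; rewrite -sumrN; congr (expR _)%:E.
    by apply: eq_bigr => i _; rewrite !mulNr opprK.
  rewrite gaussian_laplace; last by move=> i; rewrite mulr_ge0// oppr_ge0 ltW.
  congr (_%:E); apply: eq_bigr => i _.
  by rewrite !mulNr mulrN.
rewrite [leLHS](_ : _ = (expR (- (t * \sum_i wt i * lam i)))%:E *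
    \int[P]_w (expR (\sum_i (t * wt i) * Z i w ^+ 2))%:E)%E.
  rewrite E -EFinM lee_fin.
  apply: (@le_trans _ _ (expR (- (t * \sum_i wt i * lam i)) *
    \prod_i expR (2 * (t * wt i * lam i) / 2 + (2 * (t * wt i * lam i)) ^+ 2))).
    rewrite ler_wpM2l ?expR_ge0// ler_prod// => i _.
    rewrite invr_ge0 sqrtr_ge0/= invr_sqrtr_onem_le//.
    by have := tw i; rewrite mulrA; lra.
  rewrite -expR_sum -expRD ler_expR big_split/= !mulr_sumr addrA.
  rewrite -sumrN -big_split/= big1 ?add0r => [|i _]; last by field.
  by apply: ler_sum => i _; rewrite !exprMn; nra.
rewrite -ge0_integralZl//.
- apply: eq_integral => w _; rewrite -EFinM -expRD; congr (expR _)%:E.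
  rewrite (_ : \sum_i t * wt i * Z i w ^+ 2 = t * \sum_i wt i * Z i w ^+ 2).
    by ring.
  by rewrite mulr_sumr; apply: eq_bigr => i _; rewrite mulrA.
- by apply/measurable_EFinP; apply: measurableT_comp => //; exact: mquad.
Qed.

Let mdev (wt : I -> R) : measurable_fun setT
  (fun w => \sum_i wt i * Z i w ^+ 2 - \sum_i wt i * lam i).
Proof. by apply: measurable_funB => //; exact: mquad. Qed.

Lemma gaussian_quadratic_mgf_norm_le (wt : I -> R) (t : R) :
  (forall i, 0 <= wt i) -> 0 <= t -> (forall i, t * (wt i * lam i) <= 1 / 4) ->
  (\int[P]_w (expR (t * `|\sum_i wt i * Z i w ^+ 2 - \sum_i wt i * lam i|))%:E
    <= (2 * expR (4 * t ^+ 2 * \sum_i (wt i * lam i) ^+ 2))%:E)%E.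
Proof.
move=> wt0 t0 tw.
have h1 := gaussian_quadratic_mgf_le wt0 tw.
have h2 : (\int[P]_w (expR (- t * (\sum_i wt i * Z i w ^+ 2 - \sum_i wt i * lam i)))%:E
    <= (expR (4 * t ^+ 2 * \sum_i (wt i * lam i) ^+ 2))%:E)%E.
  rewrite -(sqrrN t); apply: gaussian_quadratic_mgf_le => // i.
  by rewrite mulNr (@le_trans _ _ 0)// oppr_le0 !mulr_ge0.
have me (c : R) : measurable_fun setT (fun w =>
    expR (c * (\sum_i wt i * Z i w ^+ 2 - \sum_i wt i * lam i))).
  by apply: measurableT_comp => //; apply: measurable_funM => //; exact: mdev.
rewrite mulr_natl mulr2n EFinD; apply: le_trans (leeD h1 h2).
rewrite -ge0_integralD//; last 2 first.
- exact/measurable_EFinP.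
- exact/measurable_EFinP.
apply: ge0_le_integral => //.
- apply/measurable_EFinP; apply: measurableT_comp => //.
  apply: measurable_funM => //; apply: measurableT_comp => //; exact: mdev.
- by apply: emeasurable_funD; apply/measurable_EFinP; exact: me.
- move=> w _; rewrite -EFinD lee_fin; set x := _ - _.
  have [x0|x0] := leP 0 x; first by rewrite (ger0_norm x0) ler_wpDr ?expR_ge0.
  by rewrite (ltr0_norm x0) mulrN mulNr ler_wpDl ?expR_ge0.
Qed.

(** A square is at most a multiple of an exponential, so the exponential moment at one well chosen t
    suffices. A positive upper bound s replaces the sum itself, which may vanish. *)
Lemma gaussian_quadratic_variance_le (wt : I -> R) (s : R) :
  (forall i, 0 <= wt i) -> 0 < s -> \sum_i (wt i * lam i) ^+ 2 <= s ->
  (\int[P]_w ((\sum_i wt i * Z i w ^+ 2 - \sum_i wt i * lam i) ^+ 2)%:E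
    <= (256 * s)%:E)%E.
Proof.
move=> wt0 s0 Ss.
(* Each wt lam is at most sqrt s, so this t satisfies t wt lam <= 1/4. *)
pose t := (4 * Num.sqrt s)^-1.
have q0 : 0 < Num.sqrt s by rewrite sqrtr_gt0.
have t0 : 0 < t by rewrite invr_gt0 mulr_gt0.
have t2 : t ^+ 2 = (16 * s)^-1.
  by rewrite exprVn exprMn sqr_sqrtr ?ltW//; congr (_ * _)^-1; rewrite -natrX.
have tw i : t * (wt i * lam i) <= 1 / 4.
  rewrite mulrC ler_pdivrMr ?mulr_gt0// mulrA.
  have -> : 1 / 4 * 4 = 1 :> R by field.
  rewrite mul1r -[leLHS]ger0_norm ?mulr_ge0// -sqrtr_sqr ler_wsqrtr//.
  rewrite (le_trans _ Ss)// (bigD1 i)//= lerDl sumr_ge0// => j _.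
  exact: sqr_ge0.
have H := gaussian_quadratic_mgf_norm_le wt0 (ltW t0) tw.
have md2 : measurable_fun setT (fun w => (\sum_i wt i * Z i w ^+ 2 - \sum_i wt i * lam i) ^+ 2).
  by apply: measurable_funX; exact: mdev.
apply: (@le_trans _ _ (\int[P]_w ((4 * t ^- 2)%:E *
   (expR (t * `|\sum_i wt i * Z i w ^+ 2 - \sum_i wt i * lam i|))%:E))%E).
  apply: ge0_le_integral => //.
  - by move=> w _; rewrite lee_fin sqr_ge0.
  - exact/measurable_EFinP.
  - apply: emeasurable_funM => //; apply/measurable_EFinP; apply: measurableT_comp => //.
    apply: measurable_funM => //; apply: measurableT_comp => //; exact: mdev.
  - move=> w _; rewrite -EFinM lee_fin; set x := _ - _.
    rewrite mulrAC ler_pdivlMr ?exprn_gt0//.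
    rewrite -(real_normK (num_real x)) (mulrC (_ ^+ 2)) -exprMn.
    have t_x : 0 <= t * `|x| by rewrite mulr_ge0// ltW.
    have := sqr_le_expRD (t * `|x|); have : expR (- (t * `|x|)) <= expR (t * `|x|).
      by rewrite ler_expR; lra.
    lra.
rewrite ge0_integralZl//; last 2 first.
- apply/measurable_EFinP; apply: measurableT_comp => //.
  apply: measurable_funM => //; apply: measurableT_comp => //; exact: mdev.
- by rewrite lee_fin mulr_ge0// invr_ge0 sqr_ge0.
apply: (@le_trans _ _ ((4 * t ^- 2)%:E * (2 * expR (4 * t ^+ 2 * \sum_i (wt i * lam i) ^+ 2))%:E)%E).
  by rewrite lee_wpmul2l// lee_fin mulr_ge0// invr_ge0 sqr_ge0.
(* Here 4 / t^2 = 64 s, and the exponential, whose exponent is at most 1/4, is crudely bounded by 2: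
   this gives 64 * 2 * 2 = 256. *)
rewrite -EFinM lee_fin t2 invrK.
have E2 : expR (4 * (16 * s)^-1 * \sum_i (wt i * lam i) ^+ 2) <= 2.
  apply: (@le_trans _ _ (expR (1 / 2))).
    rewrite ler_expR (@le_trans _ _ (4 * (16 * s)^-1 * s))//.
      by rewrite ler_wpM2l// mulr_ge0// invr_ge0 mulr_ge0// ltW.
    rewrite (_ : 4 * (16 * s)^-1 * s = 1 / 4); first by lra.
    by field; rewrite gt_eqF.
  have := expR_ge1Dx (- (1 / 2) : R); rewrite expRN => h.
  have e0 := expR_gt0 (1 / 2 : R).
  rewrite -(ler_pM2l (_ : 0 < (expR (1 / 2 : R))^-1)) ?invr_gt0// mulVf ?gt_eqF//.
  by lra.
by nra.
Qed.

End gaussian_quadratic_moments.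

(** * Integration by parts for the squared norm: the exponential case *)

Definition sqnorm {T : Type} {R : realType} {I : finType} (Z : I -> T -> R) : T -> R :=
  fun w => \sum_i Z i w ^+ 2.

(* Half the squared length of the gradient of [sqnorm Z] for the covariance
   structure of [Z], i.e., <DF, - D L^-1 F> for F := sqnorm Z - \sum_i lam i. *)
Definition sqnorm_gradient {T : Type} {R : realType} {I : finType}
    (Z : I -> T -> R) (lam : I -> R) : T -> R :=
  fun w => \sum_i (2 * lam i) * Z i w ^+ 2.

Section gaussian_stein.
Context {d : measure_display} {Om : measurableType d} {R : realType}.
Variable P : probability Om R.
Variables (I : finType) (Z : I -> Om -> R) (lam : I -> R).
Hypothesis hZ : gaussian_coordinates P Z lam.
Let mZ := gc_measurable hZ.
Let lam0 := gc_variance_ge0 hZ.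
Let sqZ := gc_variance hZ.
Let iZ2 := gc_integrable_sqr hZ.

Local Notation V := (sqnorm Z).
Local Notation m := (\sum_i lam i).
Local Notation G := (sqnorm_gradient Z lam).

Let mZ2 i : measurable_fun setT (fun w => Z i w ^+ 2).
Proof. exact: measurable_funX. Qed.

Lemma gaussian_sqnorm_measurable : measurable_fun setT V.
Proof. by apply: measurable_sum => i; exact: mZ2. Qed.
Let mV := gaussian_sqnorm_measurable.

Lemma sqnorm_ge0 w : 0 <= V w.
Proof. by apply: sumr_ge0 => i _; exact: sqr_ge0. Qed.
Let V_ge0 := sqnorm_ge0.

Let mexpV (c : R) : measurable_fun setT (fun w => expR (- (c * V w))).
Proof.
do 2 (apply: measurableT_comp => //); apply: measurable_funM => //.
Qed.

Let bexpV (c : R) w : 0 <= c -> `|expR (- (c * V w))| <= 1.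
Proof.
by move=> c0; rewrite ger0_norm ?expR_ge0// expR_le1 oppr_le0 mulr_ge0// sqnorm_ge0.
Qed.

Let iexpV (c : R) : 0 <= c -> P.-integrable setT (EFin \o (fun w => expR (- (c * V w)))).
Proof.
by move=> c0; apply: (@integrable_bounded _ _ _ P _ 1) => // w; exact: bexpV.
Qed.

Let iZ2exp i (c : R) : 0 <= c ->
  P.-integrable setT (EFin \o (fun w => Z i w ^+ 2 * expR (- (c * V w)))).
Proof.
move=> c0; rewrite (_ : _ \o _ = EFin \o (fun w => expR (- (c * V w)) * Z i w ^+ 2)); last first.
  by apply/funext => w; rewrite /= mulrC.
by apply: (@integrable_bounded_mul _ _ _ _ _ _ 1) => // w; exact: bexpV.
Qed.

(* Differentiate the Laplace transform of the squares in its [i]-th variable. *)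
Lemma gaussian_sqr_laplace (i : I) (u : R) : 0 <= u ->
  \int[P]_w (Z i w ^+ 2 * expR (- (u * V w))) =
  lam i / (1 + 2 * (u * lam i)) * \int[P]_w expR (- (u * V w)).
Proof.
move=> u0.
have LE (e : R) : 0 <= e -> \int[P]_w (expR (- (u * V w)) * expR (- (e * Z i w ^+ 2))) =
    (Num.sqrt (1 + 2 * ((u + e) * lam i)))^-1 *
    \prod_(j | j != i) (Num.sqrt (1 + 2 * (u * lam j)))^-1.
  move=> e0; pose v j := u + if j == i then e else 0.
  transitivity (\int[P]_w expR (- \sum_j v j * Z j w ^+ 2)).
    apply: eq_Rintegral => w _; rewrite -expRD -opprD; congr (expR (- _)).
    rewrite /sqnorm mulr_sumr (bigD1 i)//= [RHS](bigD1 i)//= addrAC -mulrDl {1}/v eqxx.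
    by congr (_ + _); apply: eq_bigr => j /negbTE ji; rewrite /v ji addr0.
  rewrite (gaussian_laplace hZ); last by move=> j; rewrite /v; case: ifP; rewrite ?addr0// => _; rewrite addr_ge0.
  rewrite (bigD1 i)//= {1}/v eqxx; congr (_ * _).
  by apply: eq_bigr => j /negbTE ji; rewrite /v ji addr0.
set L := \int[P]_w expR _.
set rest := \prod_(j | j != i) (Num.sqrt (1 + 2 * (u * lam j)))^-1 in LE.
pose A := 1 + 2 * (u * lam i).
pose B n := 1 + 2 * ((u + n.+1%:R^-1) * lam i).
have A1 : 1 <= A by rewrite lerDl !mulr_ge0.
have sA0 : 0 < Num.sqrt A by rewrite sqrtr_gt0 (lt_le_trans _ A1).
have n0 n : 0 <= n.+1%:R^-1 :> R by rewrite invr_ge0.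
have B1 n : 1 <= B n by rewrite lerDl !mulr_ge0// addr_ge0.
have sB0 n : 0 < Num.sqrt (B n) by rewrite sqrtr_gt0 (lt_le_trans _ (B1 n)).
have LA : L = (Num.sqrt A)^-1 * rest.
  have := LE 0 (lexx _); rewrite addr0 => <-.
  by apply: eq_Rintegral => w _; rewrite mul0r oppr0 expR0 mulr1.
(* The difference quotient of the i-th factor, rationalised: A^(-1/2) - B^(-1/2) = (B - A) / (sqrt A
   sqrt B (sqrt A + sqrt B)) with B - A = 2 lam / (n+1). The remaining sqrt A is part of L. *)
pose q n := L * (2 * lam i / (Num.sqrt (B n) * (Num.sqrt A + Num.sqrt (B n)))).
apply: (@Rintegral_difference_quotient _ _ _ P (fun w => Z i w ^+ 2)
  (fun w => expR (- (u * V w))) q) => //.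
- by move=> w; exact: sqr_ge0.
- exact: iexpV.
- exact: iZ2exp.
- move=> n; rewrite LE// -/L -/(B n) /q LA.
  have E : n.+1%:R^-1 * (2 * lam i) = Num.sqrt (B n) ^+ 2 - Num.sqrt A ^+ 2.
    by rewrite !sqr_sqrtr ?(le_trans ler01)// /A /B; ring.
  set a := Num.sqrt A in sA0 E *; set b := Num.sqrt (B n) in E *.
  have b0 : 0 < b by exact: sB0.
  rewrite [RHS](_ : _ = (n.+1%:R^-1 * (2 * lam i)) * (a^-1 * rest / (b * (a + b)))).
    rewrite E; field.
    by rewrite !gt_eqF// addr_gt0.
  by ring.
- have cB : B n @[n --> \oo] --> A.
    rewrite /B /A; apply: cvgD; first exact: cvg_cst.
    apply: cvgM; first exact: cvg_cst.
    apply: cvgM; last exact: cvg_cst.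
    rewrite -[X in _ --> X]addr0; apply: cvgD; first exact: cvg_cst.
    exact: cvg_harmonic.
  have csB : Num.sqrt (B n) @[n --> \oo] --> Num.sqrt A.
    by apply: continuous_cvg => //; exact: sqrt_continuous.
  rewrite (_ : _ * L = L * (2 * lam i / (Num.sqrt A * (Num.sqrt A + Num.sqrt A)))).
    apply: cvgM; first exact: cvg_cst.
    apply: cvgM; first exact: cvg_cst.
    apply: cvgV; first by rewrite gt_eqF// mulr_gt0// addr_gt0.
    apply: cvgM => //; apply: cvgD => //; exact: cvg_cst.
  rewrite mulrC; congr (_ * _); rewrite -/A.
  have EA : A = Num.sqrt A ^+ 2 by rewrite sqr_sqrtr// (le_trans ler01).
  move: EA sA0; set a := Num.sqrt A => -> a0.
  by field; rewrite !gt_eqF// addr_gt0.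
Qed.

(** Coordinate by coordinate, [gaussian_sqr_laplace] reduces this to lam/(1 + 2k lam) - lam = -k (2
    lam) lam/(1 + 2k lam). *)
Lemma gaussian_stein_expR (k : R) : 0 <= k ->
  \int[P]_w ((V w - m) * expR (- (k * V w))) =
  - k * \int[P]_w (G w * expR (- (k * V w))).
Proof.
move=> k0; set L := \int[P]_w expR (- (k * V w)).
transitivity (\sum_i (lam i / (1 + 2 * (k * lam i)) * L - lam i * L)).
  transitivity (\int[P]_w (\sum_i (Z i w ^+ 2 * expR (- (k * V w)) -
      lam i * expR (- (k * V w))))).
    apply: eq_Rintegral => w _; rewrite /sqnorm -sumrB mulr_suml.
    by apply: eq_bigr => i _; rewrite mulrBl.
  rewrite Rintegral_sum; last first.
    by move=> i; apply: integrable_sub; [exact: iZ2exp|apply: integrable_scale; exact: iexpV].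
  apply: eq_bigr => i _; rewrite RintegralB//; last 2 first.
  - exact: iZ2exp.
  - by apply: integrable_scale; exact: iexpV.
  by rewrite gaussian_sqr_laplace// RintegralZl//; exact: iexpV.
transitivity (- k * \sum_i (2 * lam i) * (lam i / (1 + 2 * (k * lam i)) * L)).
  rewrite mulr_sumr; apply: eq_bigr => i _; field.
  by rewrite gt_eqF// ltr_pwDl// mulr_ge0// mulr_ge0.
congr (_ * _).
transitivity (\int[P]_w (\sum_i (2 * lam i) * (Z i w ^+ 2 * expR (- (k * V w))))).
  rewrite Rintegral_sum; last by move=> i; apply: integrable_scale; exact: iZ2exp.
  apply: eq_bigr => i _; rewrite RintegralZl//; last exact: iZ2exp.
  by rewrite gaussian_sqr_laplace.
apply: eq_Rintegral => w _; rewrite /sqnorm_gradient mulr_suml.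
by apply: eq_bigr => i _; rewrite mulrA.
Qed.

Lemma gaussian_sqnorm_integrable : P.-integrable setT (EFin \o V).
Proof. exact: integrable_sumr. Qed.

Lemma gaussian_sqnorm_mean : \int[P]_w V w = m.
Proof. by rewrite Rintegral_sum//; apply: eq_bigr => i _; rewrite sqZ. Qed.

Lemma gaussian_weighted_deviation_integrable (wt : I -> R) : (forall i, 0 <= wt i) ->
  P.-integrable setT (EFin \o (fun w =>
    (\sum_i wt i * Z i w ^+ 2 - \sum_i wt i * lam i) ^+ 2)).
Proof.
move=> wt0; set S := \sum_i (wt i * lam i) ^+ 2.
have S0 : 0 <= S by apply: sumr_ge0 => i _; exact: sqr_ge0.
apply/integrableP; split.
  apply/measurable_EFinP; apply: measurable_funX; apply: measurable_funB => //.
  by apply: measurable_sum => i; exact: measurable_funM.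
under eq_integral do rewrite /= ger0_norm ?sqr_ge0//.
apply: (le_lt_trans (gaussian_quadratic_variance_le hZ wt0 (s := S + 1) _ _)).
- by rewrite ltr_wpDl.
- by rewrite lerDl.
- exact: ltry.
Qed.

Let iV := gaussian_sqnorm_integrable.

Lemma gaussian_sqnorm_sqdev_integrable : P.-integrable setT (EFin \o (fun w => (V w - m) ^+ 2)).
Proof.
have := @gaussian_weighted_deviation_integrable (fun=> 1) (fun=> ler01).
congr (integrable _ _ (_ \o _)); apply/funext => w.
by congr ((_ - _) ^+ 2); apply: eq_bigr => i _; rewrite mul1r.
Qed.
Let iVm2 := gaussian_sqnorm_sqdev_integrable.

Lemma gaussian_sqnorm_dev_integrable : P.-integrable setT (EFin \o (fun w => V w - m)).
Proof. by apply: integrable_sub => //; exact: integrable_cstP. Qed.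
Let iVm := gaussian_sqnorm_dev_integrable.

Let iVVm : P.-integrable setT (EFin \o (fun w => V w * (V w - m))).
Proof.
rewrite (_ : _ \o _ = EFin \o (fun w => (V w - m) ^+ 2 + m * (V w - m))); last first.
  by apply/funext => w /=; congr (_%:E); ring.
by apply: integrable_add => //; exact: integrable_scale.
Qed.

Lemma gaussian_sqnorm_dev_mean : \int[P]_w (V w - m) = 0.
Proof.
rewrite RintegralB//; last exact: integrable_cstP.
by rewrite gaussian_sqnorm_mean Rintegral_cstP subrr.
Qed.
Lemma gaussian_gradient_integrable : P.-integrable setT (EFin \o G).
Proof. by apply: integrable_sumr => i; exact: integrable_scale. Qed.
Let iG := gaussian_gradient_integrable.

Lemma gaussian_gradient_ge0 w : 0 <= G w.
Proof. by apply: sumr_ge0 => i _; rewrite mulr_ge0 ?sqr_ge0// mulr_ge0. Qed.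
Let G_ge0 := gaussian_gradient_ge0.

(** Divide [gaussian_stein_expR] by k and let k tend to 0: as V - m has mean zero, E[V (V - m)] =
    E[G]. No fourth moment of the Z_i is computed. *)
Lemma gaussian_sqnorm_variance :
  \int[P]_w ((V w - m) ^+ 2) = 2 * \sum_i lam i ^+ 2.
Proof.
have EG : \int[P]_w G w = 2 * \sum_i lam i ^+ 2.
  rewrite Rintegral_sum; last by move=> i; exact: integrable_scale.
  rewrite mulr_sumr; apply: eq_bigr => i _.
  by rewrite RintegralZl// sqZ -mulrA.
have mG := integrable_measurable gaussian_gradient_integrable.
have H : \int[P]_w (V w * (V w - m)) = \int[P]_w G w.
  apply: (@Rintegral_difference_quotient _ _ _ P V (fun w => V w - m)
    (fun n => \int[P]_w (G w * expR (- (n.+1%:R^-1 * V w))))) => //.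
    by move=> n; rewrite gaussian_sqnorm_dev_mean sub0r gaussian_stein_expR ?invr_ge0// mulNr opprK.
  apply: (@Rintegral_dominated_cvg _ _ _ P _ _ G) => //.
  - by move=> n; exact: measurable_funM.
  - move=> w.
    have : G w * expR (- (n.+1%:R^-1 * V w)) @[n --> \oo] -->
        G w * expR (- (0 * V w)).
      apply: cvgM; first exact: cvg_cst.
      apply: continuous_cvg; first exact: continuous_expR.
      apply: cvgN; apply: cvgM; [exact: (@cvg_harmonic R)|exact: cvg_cst].
    by rewrite mul0r oppr0 expR0 mulr1.
  - move=> n w; rewrite normrM (ger0_norm (gaussian_gradient_ge0 w)) ler_piMr//.
    by apply: bexpV; rewrite invr_ge0.
rewrite -EG -H.
transitivity (\int[P]_w (V w * (V w - m) - m * (V w - m))).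
  by apply: eq_Rintegral => w _; ring.
rewrite RintegralB//; last exact: integrable_scale.
by rewrite RintegralZl// gaussian_sqnorm_dev_mean mulr0 subr0.
Qed.

End gaussian_stein.

(** * Bernstein approximation *)

Section weierstrass.
Context {R : realType}.
Implicit Types (q g h : R -> R) (x : R) (n : nat).

(** Close points use continuity; for distant ones the quadratic term exceeds twice the maximum of
    |q|. A bound quadratic in y is wanted because the Bernstein operator evaluates it exactly. *)
Lemma continuous_sqr_modulus q (e : R) : continuous q -> 0 < e ->
  exists2 M, 0 <= M & forall x y, 0 <= x <= 1 -> 0 <= y <= 1 ->
    `|q y - q x| <= e + M * (y - x) ^+ 2.
Proof.
move=> cq e0.
have [B HB] : exists B, forall x, 0 <= x <= 1 -> `|q x| <= B.
  have cnq : {within `[(0 : R), 1], continuous (fun x => `|q x|)}.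
    by apply: continuous_subspaceT => x; apply: cvg_norm; exact: cq.
  have [c _ Hc] := EVT_max ler01 cnq.
  by exists `|q c| => x x01; apply: Hc; rewrite in_itv.
have B0 : 0 <= B by apply: le_trans (HB 0 _) => //; rewrite lexx ler01.
pose Q (k : nat) (x : R) := forall y, 0 <= y <= 1 ->
    `|q y - q x| <= e + k%:R * (y - x) ^+ 2.
(* Compactness in the form of near coverings: a k that is large enough near each point is large
   enough for the whole segment. *)
have : \forall k \near \oo, `[(0 : R), 1]%classic `<=` Q k.
  have /compact_near_coveringP/near_covering_withinP cov := @segment_compact R 0 1.
  apply: cov => x0 /= x01.
  have e2 : 0 < e / 2 by rewrite divr_gt0.
  have /cvgrPdist_le/(_ _ e2) := cq x0.
  move=> /nbhs_ballP[del /= del0 Hdel].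
  exists (ball x0 (del / 2), [set k | 2 * B <= k%:R * (del / 2) ^+ 2]) => /=.
    split; first by apply: nbhsx_ballx; rewrite divr_gt0.
    near=> k; rewrite /= -ler_pdivrMr ?exprn_gt0 ?divr_gt0//.
    by near: k; exact: nbhs_infty_ger.
  move=> [x' k] /= [xx' kB] x'01 y y01.
  rewrite in_itv/= in x'01.
  have [yx|yx] := ltP `|y - x'| (del / 2).
    have Hx' : `|q x0 - q x'| <= e / 2.
      apply: Hdel; apply: le_ball xx'; lra.
    have Hy : `|q x0 - q y| <= e / 2.
      apply: Hdel; rewrite /ball/=; rewrite /ball/= in xx'.
      rewrite (_ : x0 - y = (x0 - x') - (y - x')); last by ring.
      rewrite (le_lt_trans (ler_normB _ _))//.
      by rewrite (splitr del) ltrD.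
    apply: (@le_trans _ _ e); last by rewrite lerDl mulr_ge0// sqr_ge0.
    rewrite (_ : q y - q x' = (q x0 - q x') - (q x0 - q y)); last by ring.
    by rewrite (le_trans (ler_normB _ _))// [leRHS]splitr lerD.
  apply: (@le_trans _ _ (2 * B)).
    rewrite (le_trans (ler_normB _ _))// mulr_natl mulr2n lerD// HB//.
  apply: (le_trans kB); apply: ler_wpDl; first exact: ltW.
  rewrite ler_wpM2l// -(real_normK (num_real (y - x'))) ler_sqr ?nnegrE//.
  by rewrite ltW// divr_gt0.
move=> [k _ /(_ k (leqnn _)) Hk]; exists k%:R => // x y x01 y01.
by apply: Hk => //=; rewrite in_itv.
Unshelve. all: by end_near. Qed.

(* The Bernstein polynomial of [g], i.e., the mean of [g] at a binomial variable
   with parameters [n] and [x], by conditioning on the first trial. *)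
Fixpoint bernstein n x (g : nat -> R) : R :=
  if n is n'.+1 then
    (1 - x) * bernstein n' x g + x * bernstein n' x (fun k => g k.+1)
  else g 0%N.

Lemma le_bernstein n x (g h : nat -> R) : 0 <= x <= 1 ->
  (forall k, (k <= n)%N -> g k <= h k) -> bernstein n x g <= bernstein n x h.
Proof.
move=> x01; have /andP[x0 x1] := x01.
elim: n g h => [|n IH] g h gh /=; first exact: gh.
apply: lerD; apply: ler_wpM2l => //; first by rewrite subr_ge0.
- by apply: IH => k kn; apply: gh; exact: leqW.
- by apply: IH => k kn; exact: gh.
Qed.

(** The second moment of a binomial variable about -c: squared mean plus variance n x (1 - x). The
    shift c is general because conditioning on a successful first trial replaces it by 1 + c. *)
Lemma bernstein_sqr n x (a b c : R) :
  bernstein n x (fun k => a + b * (k%:R + c) ^+ 2) =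
  a + b * ((n%:R * x + c) ^+ 2 + n%:R * x * (1 - x)).
Proof.
elim: n c => [|n IH] c /=; first by rewrite !mul0r addr0 add0r.
rewrite IH.
have -> : bernstein n x (fun k => a + b * (k.+1%:R + c) ^+ 2) =
    bernstein n x (fun k => a + b * (k%:R + (1 + c)) ^+ 2).
  by congr bernstein; apply/funext => k; rewrite -natr1 addrA.
by rewrite IH -natr1; ring.
Qed.

Lemma bernstein_poly n (g : nat -> R) :
  exists p : {poly R}, forall x, bernstein n x g = p.[x].
Proof.
elim: n g => [|n IH] g /=; first by exists (g 0%N)%:P => x; rewrite hornerC.
have [p Hp] := IH g; have [r Hr] := IH (fun k => g k.+1).
exists ((1 - 'X) * p + 'X * r) => x.
by rewrite Hp Hr !hornerE.
Qed.

(** Chebyshev's argument: by monotonicity of the Bernstein operator, the error is at most e/2 plus M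
    times the variance x (1 - x) / n of the empirical frequency. *)
Lemma weierstrass q (e : R) : continuous q -> 0 < e ->
  exists p : {poly R}, forall x, 0 <= x <= 1 -> `|p.[x] - q x| <= e.
Proof.
move=> cq e0; have e2 : 0 < e / 2 by rewrite divr_gt0.
have [M M0 HM] := continuous_sqr_modulus cq e2.
have [N HN] : exists N : nat, M / (e / 2) <= N.+1%:R.
  have [N _ HN] := nbhs_infty_ger (M / (e / 2)).
  by exists N; apply: HN => /=.
have [p Hp] := bernstein_poly N.+1 (fun k => q (k%:R / N.+1%:R)).
exists p => x x01; rewrite -Hp; set n : R := N.+1%:R.
have n0 : 0 < n by rewrite ltr0n.
have [c Hc] : exists c, c = M / n ^+ 2 by exists (M / n ^+ 2).
pose t := c * ((n * x + - (n * x)) ^+ 2 + n * x * (1 - x)).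
have tail : t <= e / 2.
  have -> : t = M / n * (x * (1 - x)).
    by rewrite /t Hc subrr expr0n/= add0r; field; rewrite gt_eqF.
  have Mn : M / n <= e / 2 by rewrite ler_pdivrMr// mulrC -ler_pdivrMr.
  have Mn0 : 0 <= M / n by rewrite divr_ge0// ltW.
  have x1 : x * (1 - x) <= 1 by case/andP: x01; nra.
  by rewrite (le_trans _ Mn)// ler_piMr.
have kn (k : nat) : (k <= N.+1)%N -> 0 <= k%:R / n <= 1.
  by move=> kN; rewrite divr_ge0 ?ler0n ?(ltW n0)//= ler_pdivrMr// mul1r ler_nat.
have E (k : nat) : M * (k%:R / n - x) ^+ 2 = c * (k%:R + - (n * x)) ^+ 2.
  by rewrite Hc; field; rewrite gt_eqF.
rewrite ler_norml; apply/andP; split.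
- rewrite lerBrDl.
  apply: (@le_trans _ _ (bernstein N.+1 x
    (fun k => (q x - e / 2) + - c * (k%:R + - (n * x)) ^+ 2))).
    by rewrite bernstein_sqr -/n mulNr -/t; move: tail; lra.
  apply: le_bernstein => // k /kn kn01.
  have := HM _ _ x01 kn01; rewrite E ler_norml mulNr => /andP[+ _].
  by set y := c * _; lra.
- rewrite lerBlDl.
  apply: (@le_trans _ _ (bernstein N.+1 x
    (fun k => (q x + e / 2) + c * (k%:R + - (n * x)) ^+ 2))).
    apply: le_bernstein => // k /kn kn01.
    have := HM _ _ x01 kn01; rewrite E ler_norml => /andP[_ +].
    by set y := c * _; lra.
  by rewrite bernstein_sqr -/n -/t; move: tail; lra.
Qed.

End weierstrass.

(** * Stein's method *)

Section gaussian_stein_identity.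
Context {d : measure_display} {Om : measurableType d} {R : realType}.
Variable P : probability Om R.
Variables (I : finType) (Z : I -> Om -> R) (lam : I -> R).
Hypothesis hZ : gaussian_coordinates P Z lam.
Local Notation V := (sqnorm Z).
Local Notation m := (\sum_i lam i).
Local Notation G := (sqnorm_gradient Z lam).
Let mV := gaussian_sqnorm_measurable hZ.
Let V0 := sqnorm_ge0 Z.
Let iD := gaussian_sqnorm_dev_integrable hZ.
Let iG := gaussian_gradient_integrable hZ.
Let G0 := gaussian_gradient_ge0 hZ.

Let mcomp (h : R -> R) : continuous h -> measurable_fun setT (fun w => h (V w)).
Proof.
by move=> ch; apply: (measurableT_comp _ mV); exact: continuous_measurable_fun.
Qed.

Let iDmul (h : R -> R) (C : R) : continuous h -> (forall v, 0 <= v -> `|h v| <= C) ->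
  P.-integrable setT (EFin \o (fun w => (V w - m) * h (V w))).
Proof.
move=> ch hC.
rewrite (_ : _ \o _ = EFin \o (fun w => h (V w) * (V w - m))); last first.
  by apply/funext => w; rewrite /= mulrC.
apply: (@integrable_bounded_mul _ _ _ _ _ _ C) => //; first exact: mcomp.
by move=> w; exact/hC/V0.
Qed.

Let iGmul (h : R -> R) (C : R) : continuous h -> (forall v, 0 <= v -> `|h v| <= C) ->
  P.-integrable setT (EFin \o (fun w => G w * h (V w))).
Proof.
move=> ch hC.
rewrite (_ : _ \o _ = EFin \o (fun w => h (V w) * G w)); last first.
  by apply/funext => w; rewrite /= mulrC.
apply: (@integrable_bounded_mul _ _ _ _ _ _ C) => //; first exact: mcomp.
by move=> w; exact/hC/V0.
Qed.

(** Pairs (F, F') for which the integration by parts holds, with what is needed to add such pairs.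
    Boundedness is asked on v >= 0 only, where V takes its values: decaying exponentials are
    unbounded on the other side. *)
Let stein_pair (F g : R -> R) := [/\
  (forall v : R, is_derive v (1 : R) F (g v)), continuous g,
  (exists C : R, forall v, 0 <= v -> `|F v| <= C /\ `|g v| <= C) &
  \int[P]_w ((V w - m) * F (V w)) = \int[P]_w (G w * g (V w))].

Let derive_continuous (F g : R -> R) :
  (forall v : R, is_derive v (1 : R) F (g v)) -> continuous F.
Proof.
by move=> dF v; apply/differentiable_continuous/derivable1_diffP; case: (dF v).
Qed.

Let stein_pair_expR (c k : R) : 0 < k ->
  stein_pair (fun v => - (c / k) * expR (- (k * v))) (fun v => c * expR (- (k * v))).
Proof.
move=> k0.
have dF (v : R) : is_derive v (1 : R) (fun v => - (c / k) * expR (- (k * v)))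
    (c * expR (- (k * v))).
  by apply: is_derive_eq; rewrite /GRing.scale/=; field; rewrite gt_eqF.
have e1 (v : R) : 0 <= v -> `|expR (- (k * v))| <= 1.
  by move=> v0; rewrite ger0_norm ?expR_ge0// expR_le1 oppr_le0 mulr_ge0// ltW.
have ce : continuous (fun v : R => expR (- (k * v))).
  move=> v; apply: (@continuous_comp _ _ _ (fun v : R => - (k * v)) expR); last exact: continuous_expR.
  by apply: cvgN; apply: cvgM; [exact: cvg_cst|exact: cvg_id].
split => //.
- by move=> v; apply: cvgM; [exact: cvg_cst|exact: ce].
- exists (`|c / k| + `|c|) => v v0; split.
    by rewrite normrM normrN (le_trans (ler_piMr _ (e1 _ v0)))// lerDl.
  by rewrite normrM (le_trans (ler_piMr _ (e1 _ v0)))// lerDr.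
- transitivity (- (c / k) * \int[P]_w ((V w - m) * expR (- (k * V w)))).
    rewrite -RintegralZl//; last exact: (iDmul ce e1).
    by apply: eq_Rintegral => w _; ring.
  rewrite (gaussian_stein_expR hZ) ?ltW//.
  transitivity (c * \int[P]_w (G w * expR (- (k * V w)))).
    by field; rewrite gt_eqF.
  rewrite -RintegralZl//; last exact: (iGmul ce e1).
  by apply: eq_Rintegral => w _; ring.
Qed.

Let stein_pair_add (F g F' g' : R -> R) : stein_pair F g -> stein_pair F' g' ->
  stein_pair (fun v => F v + F' v) (fun v => g v + g' v).
Proof.
move=> [dF cg [C HC] E] [dF' cg' [C' HC'] E'].
have cF := derive_continuous dF; have cF' := derive_continuous dF'.
split.
- by move=> v; have := dF v; have := dF' v => ? ?; exact: is_deriveD.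
- by move=> v; apply: cvgD; [exact: cg|exact: cg'].
- exists (C + C') => v v0; have [a b] := HC _ v0; have [a' b'] := HC' _ v0.
  by split; rewrite (le_trans (ler_normD _ _))// lerD.
- transitivity (\int[P]_w ((V w - m) * F (V w)) + \int[P]_w ((V w - m) * F' (V w))).
    rewrite -RintegralD//.
    + by apply: eq_Rintegral => w _; rewrite mulrDr.
    + by apply: (iDmul (C := C)) => // v /HC[].
    + by apply: (iDmul (C := C')) => // v /HC'[].
  rewrite E E' -RintegralD//.
  + by apply: eq_Rintegral => w _; rewrite mulrDr.
  + by apply: (iGmul (C := C)) => // v /HC[].
  + by apply: (iGmul (C := C')) => // v /HC'[].
Qed.

(** Horner induction on p: multiplying p by the indeterminate raises the rate from j+1 to j+2, hence
    the general j. The rate stays positive, so that every term has a bounded exponential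
    primitive. *)
Let stein_pair_poly (e : R) (p : {poly R}) (j : nat) : 0 < e ->
  exists F, stein_pair F
    (fun v => expR (- (j.+1%:R * e * v)) * p.[expR (- (e * v))]).
Proof.
move=> e0; elim/poly_ind: p j => [|p c IH] j.
  (* Zero polynomial: an exponential pair with coefficient 0, at an arbitrary rate. *)
  have := @stein_pair_expR 0 1 ltr01; set F := (fun v => _ * _); move=> H.
  exists F; move: H; congr stein_pair.
  by apply/funext => v; rewrite horner0 mulr0 mul0r.
have [F HF] := IH j.+1.
have k0 : 0 < j.+1%:R * e by rewrite mulr_gt0.
have := stein_pair_add HF (stein_pair_expR c k0).
set F' := (fun v => F v + _) => H; exists F'; move: H; congr stein_pair.
apply/funext => v; rewrite !hornerE mulrDr; congr (_ + _); last by rewrite mulrC.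
rewrite (mulrC p.[_]) [RHS]mulrA; congr (_ * _); rewrite -expRD; congr expR.
by rewrite -[in LHS]natr1; ring.
Qed.

(* Integration by parts in Gauss space for functions of [sqnorm Z]: exact for
   exponentials, it extends by Weierstrass approximation in the variable
   [expR (- e * v)] after damping [f] by a factor [expR (- 2 * e * v)]. *)
Lemma gaussian_stein_identity (f f' : R -> R) (C : R) :
  (forall v : R, is_derive v (1 : R) f (f' v)) -> continuous f' ->
  (forall v, `|f v| <= C) -> (forall v, `|f' v| <= C) ->
  \int[P]_w ((V w - m) * f (V w)) = \int[P]_w (G w * f' (V w)).
Proof.
move=> df cf' fC f'C.
have cf := derive_continuous df.
have C0 : 0 <= C := le_trans (normr_ge0 _) (fC 0).
pose fe (e : R) v := f v * expR (- (2 * e * v)).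
pose fe' (e : R) v := (f' v - 2 * e * f v) * expR (- (2 * e * v)).
have cexp (k : R) : continuous (fun v : R => expR (- (k * v))).
  move=> v; apply: (@continuous_comp _ _ _ (fun v : R => - (k * v)) expR); last exact: continuous_expR.
  by apply: cvgN; apply: cvgM; [exact: cvg_cst|exact: cvg_id].
have cfe' (e : R) : continuous (fun v => f' v - 2 * e * f v).
  by move=> v; apply: cvgB; [exact: cf'|apply: cvgM; [exact: cvg_cst|exact: cf]].
have f'e_le (e v : R) : 0 < e -> `|f' v - 2 * e * f v| <= C + 2 * e * C.
  move=> e0; rewrite (le_trans (ler_normB _ _))// lerD// normrM.
  by rewrite (gtr0_norm (mulr_gt0 _ e0))// ler_wpM2l// mulr_ge0// ltW.
have ebnd (k v : R) : 0 <= k -> 0 <= v -> 0 <= expR (- (k * v)) <= 1.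
  by move=> k0 v0; rewrite expR_ge0 expR_le1 oppr_le0 mulr_ge0.
have cfe (e : R) : continuous (fe e).
  by move=> v; apply: cvgM; [exact: cf|exact: cexp].
have cfe'' (e : R) : continuous (fe' e).
  by move=> v; apply: cvgM; [exact: cfe'|exact: cexp].
have fe_le (e v : R) : 0 < e -> 0 <= v -> `|fe e v| <= C.
  move=> e0 v0; have /andP[x0 x1] := ebnd (2 * e) v (ltW (mulr_gt0 (ltr0Sn _ 1) e0)) v0.
  rewrite normrM (ger0_norm x0) (le_trans (ler_piMr _ x1))//.
have fe'_le (e v : R) : 0 < e -> 0 <= v -> `|fe' e v| <= C + 2 * e * C.
  move=> e0 v0; have /andP[x0 x1] := ebnd (2 * e) v (ltW (mulr_gt0 (ltr0Sn _ 1) e0)) v0.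
  by rewrite normrM (ger0_norm x0) (le_trans (ler_piMr _ x1))// f'e_le.
have iVD : P.-integrable setT (EFin \o (fun w => V w * `|V w - m|)).
  have iVD : P.-integrable setT (EFin \o (fun w => (V w - m) ^+ 2 + m * (V w - m))).
    apply: integrable_add; first exact: gaussian_sqnorm_sqdev_integrable.
    exact: integrable_scale.
  have := integrable_norm iVD; congr (integrable _ _ (_ \o _)).
  apply/funext => w; rewrite /= -[RHS](_ : `|V w * (V w - m)| = _); last first.
    by rewrite normrM (ger0_norm (V0 w)).
  by congr (`|_|); ring.
(* If two derivatives differ by at most eta on v >= 0, their primitives, equal at 0, differ by at
   most eta v; the two sides of the identity then move by at most eta K in total. *)
pose K := \int[P]_w (V w * `|V w - m|) + \int[P]_w G w.
have K0 : 0 <= K.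
  rewrite addr_ge0//; apply: Rintegral_ge0 => w _; last exact: G0.
  by rewrite mulr_ge0// V0.
have ED : \int[P]_w (V w - m) = 0 := gaussian_sqnorm_dev_mean hZ.
have damped (e : R) : 0 < e ->
    \int[P]_w ((V w - m) * fe e (V w)) = \int[P]_w (G w * fe' e (V w)).
  move=> e0.
  pose h v := f' v - 2 * e * f v.
  (* With x = exp(-ev), the damped derivative is q(x) x. Of the two damping factors, the one inside
     q makes q continuous at 0, as h is bounded; the other is the factor exp(-ev) that
     [stein_pair_poly] requires in front of the polynomial. *)
  pose q (x : R) := if 0 < x then x * h (- (ln x / e)) else 0.
  have qE v : 0 <= v -> q (expR (- (e * v))) * expR (- (e * v)) = fe' e v.
    move=> v0; rewrite /q expR_gt0 expRK.
    rewrite (_ : - (- (e * v) / e) = v); last by field; rewrite gt_eqF.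
    rewrite /fe' (_ : - (2 * e * v) = - (e * v) - e * v); last by ring.
    by rewrite expRD /h; ring.
  have cq : continuous q.
    move=> x; have [x0|x0|x0] := ltgtP 0 x.
    - apply: (@cvg_trans _ ((fun x => x * h (- (ln x / e))) y @[y --> x])).
        apply: near_eq_cvg; near=> y; rewrite /q ifT//.
        by near: y; exact: lt_nbhsr.
      have -> : q x = x * h (- (ln x / e)) by rewrite /q x0.
      have : y * h (- (ln y / e)) @[y --> x] --> x * h (- (ln x / e)); last exact.
      apply: cvgM; first exact: cvg_id.
      apply: continuous_cvg; first exact: cfe'.
      apply: cvgN; apply: cvgM; last exact: cvg_cst.
      exact: continuous_ln.
    - rewrite /continuous_at (_ : q x = 0); last by rewrite /q (lt_gtF x0).
      apply: cvg_near_cst; near=> y; rewrite /q ifF//.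
      by apply/negbTE; rewrite -leNgt ltW//; near: y; exact: lt_nbhsl.
    - rewrite /continuous_at (_ : q x = 0); last by rewrite /q -x0 ltxx.
      rewrite -x0; apply/cvgrPdist_le => t t0.
      have B0 : 0 < C + 2 * e * C + 1.
        by rewrite ltr_wpDl// addr_ge0// !mulr_ge0// ltW.
      near=> y; rewrite sub0r normrN /q; case: ifP => _; last by rewrite normr0 ltW.
      rewrite normrM (le_trans (ler_wpM2l (normr_ge0 _) (f'e_le _ _ e0)))//.
      have yt : `|y| <= t / (C + 2 * e * C + 1).
        near: y; apply/nbhs_ballP; exists (t / (C + 2 * e * C + 1)) => /=.
          exact: divr_gt0.
        by move=> z; rewrite /ball/= sub0r normrN => /ltW.
      rewrite (le_trans (ler_wpM2r _ yt))//.
        by rewrite addr_ge0// !mulr_ge0// ltW.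
      rewrite mulrAC ler_pdivrMr//; apply: ler_wpM2l; first exact: ltW.
      by rewrite lerDl.
  apply/eqP; rewrite -subr_eq0 -normr_le0; apply/ler_addgt0Pr => eta eta0.
  rewrite add0r.
  have K1 : 0 < K + 1 by rewrite ltr_wpDl.
  have eta'0 : 0 < eta / (K + 1) by exact: divr_gt0.
  have [p Hp] := weierstrass cq eta'0.
  have [F] := @stein_pair_poly e p 0 e0.
  set g := (fun v => _) => -[dF cg [B HB] E].
  have cF := derive_continuous dF.
  have gfe v : 0 <= v -> `|g v - fe' e v| <= eta / (K + 1).
    move=> v0; have x01 := ebnd e v (ltW e0) v0; have /andP[x0 x1] := x01.
    rewrite -qE// /g mul1r [q _ * _]mulrC -mulrBr normrM (ger0_norm x0).
    by rewrite (le_trans (ler_piMl _ x1))// Hp.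
  have dD (v : R) : is_derive v (1 : R) (fun v => F v - fe e v) (g v - fe' e v).
    have := dF v; have := df v => ? ?.
    by apply: is_derive_eq; rewrite /GRing.scale/= /fe'; ring.
  have cD := derive_continuous dD.
  (* The value at 0 is subtracted for the mean value theorem. This constant is harmless in the
     identity, because V - m has mean zero. *)
  have D_le v : 0 <= v -> `|F v - fe e v - (F 0 - fe e 0)| <= eta / (K + 1) * v.
    move=> v0.
    have [c cv ->] := MVT_segment v0 (fun x _ => dD x) (continuous_subspaceT cD).
    rewrite subr0 normrM (ger0_norm v0) ler_wpM2r// gfe//.
    by move: cv; rewrite in_itv/= => /andP[].
  have iDfe := iDmul (cfe e) (fun v v0 => fe_le e v e0 v0).
  have iGfe := iGmul (cfe'' e) (fun v v0 => fe'_le e v e0 v0).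
  have iDF := iDmul cF (fun v v0 => (HB v v0).1).
  have iGg := iGmul cg (fun v v0 => (HB v v0).2).
  have -> : \int[P]_w ((V w - m) * fe e (V w)) - \int[P]_w (G w * fe' e (V w)) =
     \int[P]_w (G w * (g (V w) - fe' e (V w))) -
     \int[P]_w ((V w - m) * (F (V w) - fe e (V w) - (F 0 - fe e 0))).
    have -> : \int[P]_w (G w * (g (V w) - fe' e (V w))) =
       \int[P]_w (G w * g (V w)) - \int[P]_w (G w * fe' e (V w)).
      by rewrite -RintegralB//; apply: eq_Rintegral => w _; rewrite mulrBr.
    have -> : \int[P]_w ((V w - m) * (F (V w) - fe e (V w) - (F 0 - fe e 0))) =
       \int[P]_w ((V w - m) * F (V w)) - \int[P]_w ((V w - m) * fe e (V w)) -
       (F 0 - fe e 0) * \int[P]_w (V w - m).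
      rewrite -RintegralB// -RintegralZl// -RintegralB//.
      - by apply: eq_Rintegral => w _; ring.
      - exact: integrable_sub.
      - exact: integrable_scale.
    by rewrite ED E; ring.
  rewrite (le_trans (ler_normB _ _))//.
  apply: (@le_trans _ _ (eta / (K + 1) * \int[P]_w G w +
    eta / (K + 1) * \int[P]_w (V w * `|V w - m|))).
    rewrite -!RintegralZl//; apply: lerD.
    - apply: Rintegral_norm_le.
      + apply: measurable_funM; first exact: integrable_measurable iG.
        by apply: (@mcomp (fun v => g v - fe' e v)) => v; apply: cvgB; [exact: cg|exact: cfe''].
      + by move=> w; rewrite normrM (ger0_norm (G0 w)) mulrC ler_wpM2r// gfe// V0.
      + exact: integrable_scale.
    - apply: Rintegral_norm_le.
      + apply: measurable_funM; first exact: integrable_measurable iD.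
        apply: (@mcomp (fun v => F v - fe e v - (F 0 - fe e 0))) => v.
        by apply: cvgB; [exact: cD|exact: cvg_cst].
      + move=> w; rewrite normrM [leLHS]mulrC mulrA ler_wpM2r// D_le// V0.
      + exact: integrable_scale.
  rewrite -mulrDr [\int[P]_w G w + _]addrC -/K mulrAC ler_pdivrMr//.
  by apply: ler_wpM2l; [exact: ltW|rewrite lerDl].
(* The damping is removed along e = 1/(n+1). As e <= 1, the damped derivatives are all bounded by C
   + 2C. *)
have n0 (n : nat) : 0 < n.+1%:R^-1 :> R by rewrite invr_gt0.
have cexp0 (v : R) : expR (- (2 * n.+1%:R^-1 * v)) @[n --> \oo] --> (1 : R).
  have : expR (- (2 * n.+1%:R^-1 * v)) @[n --> \oo] --> expR (- (2 * 0 * v)).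
    apply: continuous_cvg; first exact: continuous_expR.
    apply: cvgN; apply: cvgM; last exact: cvg_cst.
    by apply: cvgM; [exact: cvg_cst|exact: (@cvg_harmonic R)].
  by rewrite mulr0 mul0r oppr0 expR0.
have H1 : \int[P]_w ((V w - m) * fe n.+1%:R^-1 (V w)) @[n --> \oo] -->
    \int[P]_w ((V w - m) * f (V w)).
  apply: (@Rintegral_dominated_cvg _ _ _ P _ _ (fun w => C * `|V w - m|)).
  - move=> n; apply: measurable_funM; first exact: integrable_measurable iD.
    by apply: mcomp; exact: cfe.
  - move=> w; apply: cvgM; first exact: cvg_cst.
    rewrite -[X in _ --> X]mulr1; apply: cvgM; first exact: cvg_cst.
    exact: cexp0.
  - by move=> n w; rewrite normrM mulrC ler_wpM2r// fe_le// V0.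
  - by apply: integrable_scale; exact: integrable_norm.
have H2 : \int[P]_w (G w * fe' n.+1%:R^-1 (V w)) @[n --> \oo] -->
    \int[P]_w (G w * f' (V w)).
  apply: (@Rintegral_dominated_cvg _ _ _ P _ _ (fun w => (C + 2 * C) * G w)).
  - move=> n; apply: measurable_funM; first exact: integrable_measurable iG.
    by apply: mcomp; exact: cfe''.
  - move=> w; apply: cvgM; first exact: cvg_cst.
    rewrite -[X in _ --> X]mulr1; apply: cvgM; last exact: cexp0.
    have : f' (V w) - 2 * n.+1%:R^-1 * f (V w) @[n --> \oo] -->
        f' (V w) - 2 * 0 * f (V w).
      apply: cvgB; first exact: cvg_cst.
      apply: cvgM; last exact: cvg_cst.
      by apply: cvgM; [exact: cvg_cst|exact: (@cvg_harmonic R)].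
    by rewrite mulr0 mul0r subr0.
  - move=> n w; rewrite normrM (ger0_norm (G0 w)) mulrC ler_wpM2r//.
    rewrite (le_trans (fe'_le _ _ (n0 n) (V0 w)))// lerD2l ler_wpM2r//.
    by rewrite ler_piMr// invf_le1// ler1n.
  - exact: integrable_scale.
move: H1; under eq_fun do rewrite damped//; move=> H1.
exact: (cvg_unique _ H1 H2).
Unshelve. all: by end_near. Qed.

End gaussian_stein_identity.

(** * Normal tails and Stein's equation *)

Section gaussian_tail.
Context {R : realType}.
Local Notation mu := (@lebesgue_measure R).
Local Notation phi := (normal_pdf (0 : R) 1).

Lemma std_normal_pdf_gt0 (x : R) : 0 < phi x.
Proof. by rewrite std_normal_pdfE mulr_gt0 ?expR_gt0 ?normal_peak_gt0 ?oner_neq0. Qed.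

Lemma std_normal_pdfN (x : R) : phi (- x) = phi x.
Proof. by rewrite !std_normal_pdfE sqrrN. Qed.

Lemma cvgy_std_normal_pdf : phi x @[x --> +oo] --> 0.
Proof.
apply/cvgrPdist_le => e e0; near=> x.
rewrite sub0r normrN gtr0_norm ?std_normal_pdf_gt0//.
apply: (le_trans (std_normal_pdf_le x)).
have x1 : 1 <= x by near: x; apply: nbhs_pinfty_ge; exact: num_real.
have p0 : 0 < 1 + x ^+ 2 by rewrite ltr_pwDl// sqr_ge0.
rewrite ler_pdivrMr ?exprn_gt0// [leRHS]mulrC -ler_pdivrMr//.
apply: (@le_trans _ _ x).
  by near: x; apply: nbhs_pinfty_ge; exact: num_real.
by nra.
Unshelve. all: by end_near. Qed.

(** On [w, +oo[ one has 1 <= x/w, and x phi(x) has the primitive -phi. *)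
Lemma mills_ratio (w : R) : 0 < w ->
  (\int[mu]_(x in `[w, +oo[) (phi x)%:E <= (phi w / w)%:E)%E.
Proof.
move=> w0.
have cphi : continuous phi by apply: continuous_normal_pdf; exact: oner_neq0.
have cxphi : continuous (fun x : R => x / w * phi x).
  move=> x; apply: cvgM; last exact: cphi.
  by apply: cvgM; [exact: cvg_id|exact: cvg_cst].
have dF (x : R) : is_derive x (1 : R) (fun x => - (phi x / w)) (x / w * phi x).
  have := is_derive_phi x => ?.
  by apply: is_derive_eq; rewrite /GRing.scale/=; ring.
have -> : (phi w / w)%:E = (\int[mu]_(x in `[w, +oo[) (x / w * phi x)%:E)%E.
  rewrite (@ge0_continuous_FTC2y _ _ (fun x => - (phi x / w)) _ 0).
  - by rewrite sub0e -EFinN opprK.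
  - move=> x wx; rewrite mulr_ge0 ?normal_pdf_ge0// divr_ge0// ?ltW//.
    exact: lt_le_trans wx.
  - exact: continuous_subspaceT.
  - have : - (phi x / w) @[x --> +oo] --> - (0 / w).
      apply: cvgN; apply: cvgM; last exact: cvg_cst.
      exact: cvgy_std_normal_pdf.
    by rewrite mul0r oppr0.
  - by move=> x _; case: (dF x).
  - apply: cvg_at_right_filter; apply: cvgN; apply: cvgM; last exact: cvg_cst.
    exact: cphi.
  - by move=> x _; rewrite derive1E; case: (dF x).
apply: ge0_le_integral => //.
- by move=> x _; rewrite lee_fin normal_pdf_ge0.
- by apply/measurable_EFinP/measurable_funTS; exact: continuous_measurable_fun.
- by apply/measurable_EFinP/measurable_funTS; exact: continuous_measurable_fun.
- move=> x; rewrite /= in_itv/= andbT => wx; rewrite lee_fin.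
  by rewrite ler_peMl ?normal_pdf_ge0// ler_pdivlMr// mul1r.
Qed.

Lemma mills_ratioN (w : R) : w < 0 ->
  (\int[mu]_(x in `]-oo, w]) (phi x)%:E <= (phi w / - w)%:E)%E.
Proof.
move=> w0; have cphi : continuous phi by apply: continuous_normal_pdf; exact: oner_neq0.
rewrite -{1}(opprK w) ge0_integration_by_substitutionNy; last 2 first.
- exact: continuous_subspaceT.
- by move=> x _; exact: normal_pdf_ge0.
under eq_integral do rewrite /= std_normal_pdfN.
by rewrite -(std_normal_pdfN w) mills_ratio// oppr_gt0.
Qed.

End gaussian_tail.

Section stein_equation.
Context {R : realType}.
Local Notation mu := (@lebesgue_measure R).
Local Notation gamma := (@std_normal R).
Local Notation phi := (normal_pdf (0 : R) 1).
Variable h : R -> R.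
Hypothesis ch : continuous h.
Hypothesis h01 : forall x, 0 <= h x <= 1.

Let cphi : continuous phi.
Proof. by apply: continuous_normal_pdf; exact: oner_neq0. Qed.

Let mh : measurable_fun setT h.
Proof. exact: continuous_measurable_fun. Qed.

Let integrable_h : gamma.-integrable setT (EFin \o h).
Proof.
apply: (@integrable_bounded _ (measurableTypeR R) R gamma _ 1) => // x.
by have /andP[h0 h1] := h01 x; rewrite ger0_norm.
Qed.

Let c := \int[gamma]_x h x.

Let c01 : 0 <= c <= 1.
Proof.
apply/andP; split; first by apply: Rintegral_ge0 => x _; have /andP[] := h01 x.
rewrite -(Rintegral_cstP gamma 1); apply: le_Rintegral => //.
- exact: integrable_cstP.
- by move=> x _; have /andP[] := h01 x.
Qed.

Let hc x : `|h x - c| <= 1.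
Proof.
by rewrite ler_norml; have /andP[] := h01 x; have /andP[] := c01; lra.
Qed.

Let integrable_hc : gamma.-integrable setT (EFin \o (fun x => h x - c)).
Proof. by apply: integrable_sub => //; exact: integrable_cstP. Qed.

Let g x := (h x - c) * phi x.

Let cg : continuous g.
Proof.
move=> x; apply: cvgM; last exact: cphi.
by apply: cvgB; [exact: ch|exact: cvg_cst].
Qed.

Let ig : mu.-integrable setT (EFin \o g).
Proof.
apply/std_normal_integrableP => //.
by apply: measurable_funB.
Qed.

Let intg0 : \int[mu]_x g x = 0.
Proof.
rewrite /g -Rintegral_std_normal// RintegralB//; last exact: integrable_cstP.
by rewrite Rintegral_cstP subrr.
Qed.

Let igS (D : set R) : measurable D -> mu.-integrable D (EFin \o g).
Proof. by move=> mD; apply: integrableS ig. Qed.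

Let k w := \int[mu]_(x in `]-oo, w]) g x.

Let dk (w : R) : is_derive w (1 : R) k (g w).
Proof.
have [dk1 dk2] : derivable k w 1 /\ k^`()%classic w = g w.
  apply: (@continuous_FTC1 _ _ -oo%O w (w + 1)) => //.
  - by rewrite ltrDl.
  - by apply: igS.
  - by rewrite ltNyr.
  - exact: cg.
by apply: DeriveDef => //; rewrite -derive1E.
Qed.

(** The centring by c makes the total integral of g vanish. Thus [k] is a tail on either side, and
    Mills' ratio bounds it for both signs of w. *)
Let kE w : k w = - \int[mu]_(x in `]w, +oo[) g x.
Proof.
apply/eqP; rewrite -addr_eq0; apply/eqP; rewrite /k -Rintegral_setU//.
- rewrite -itv_bndbnd_setU// ?bnd_simp// set_itvNyy.
  exact: intg0.
- by apply: igS; exact: measurableU.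
- by apply/disj_setPS => x /= []; rewrite !in_itv/= andbT => xw /(le_lt_trans xw); rewrite ltxx.
Qed.

Let int_bound (D : set R) (r : R) : measurable D ->
  (\int[mu]_(x in D) (phi x)%:E <= r%:E)%E -> `|\int[mu]_(x in D) g x| <= r.
Proof.
move=> mD Hr; rewrite -lee_fin; apply: le_trans Hr.
rewrite EFin_normr_Rintegral//; last exact: igS.
apply: (le_trans (le_abse_integral _ _ _)) => //.
  by apply/measurable_EFinP/measurable_funTS; exact: continuous_measurable_fun.
apply: ge0_le_integral => //.
- by apply: measurableT_comp => //; apply/measurable_EFinP/measurable_funTS; exact: continuous_measurable_fun.
- by apply/measurable_EFinP/measurable_funTS; exact: continuous_measurable_fun.
- move=> x _; rewrite lee_fin normrM (ger0_norm (normal_pdf_ge0 _ _ _)).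
  by rewrite ler_piMl ?normal_pdf_ge0.
Qed.

Let k_le w : w != 0 -> `|k w| <= phi w / `|w|.
Proof.
rewrite neq_lt => /orP[w0|w0].
  rewrite (ltr0_norm w0); apply: int_bound => //.
  exact: mills_ratioN.
rewrite (gtr0_norm w0) kE normrN; apply: int_bound => //.
apply: le_trans (mills_ratio w0); apply: ge0_subset_integral => //.
- by apply/measurable_EFinP/measurable_funTS; exact: continuous_measurable_fun.
- by move=> x _; rewrite lee_fin normal_pdf_ge0.
- by apply: subset_itvr; rewrite bnd_simp.
Qed.

Let k_le1 w : `|k w| <= 1.
Proof.
apply: int_bound => //.
rewrite -(@integral_normal_pdf R 0 1); apply: ge0_subset_integral => //.
- by apply/measurable_EFinP; exact: continuous_measurable_fun.
- by move=> x _; rewrite lee_fin normal_pdf_ge0.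
Qed.

(** The solution k / phi, with phi as integrating factor. Mills' ratio gives |x f(x)| <= 1, and the
    equation itself then bounds f' by 2. The value of C is immaterial: it serves only the
    integrability conditions of the integration by parts. *)
Lemma stein_equation : exists (f f' : R -> R) (C : R), [/\
  forall x : R, is_derive x (1 : R) f (f' x), continuous f',
  forall x, `|f x| <= C, forall x, `|f' x| <= 2 &
  forall x, f' x - x * f x = h x - c].
Proof.
pose f w := k w / phi w.
pose f' w := w * f w + (h w - c).
have phi0 x : phi x != 0 by rewrite gt_eqF// std_normal_pdf_gt0.
have df (x : R) : is_derive x (1 : R) f (f' x).
  have := dk x; have := is_derive_phi x => ? ?.
  apply: is_derive_eq; rewrite /GRing.scale/= /f' /f /g; field.
  exact: phi0.
have cf : continuous f.
  by move=> x; apply/differentiable_continuous/derivable1_diffP; case: (df x).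
have wf w : `|w * f w| <= 1.
  have [->|w0] := eqVneq w 0; first by rewrite mul0r normr0.
  rewrite /f mulrA normrM normfV (gtr0_norm (std_normal_pdf_gt0 w)).
  rewrite ler_pdivrMr ?std_normal_pdf_gt0// mul1r normrM mulrC.
  by rewrite -ler_pdivlMr ?normr_gt0// k_le.
(* The term 1 covers |w| >= 1, through |w f(w)| <= 1; the term 1 / phi(1) covers |w| < 1, where |k|
   <= 1 and phi(w) >= phi(1). *)
exists f, f', (1 + (phi 1)^-1); split => //.
- move=> x; apply: cvgD; first by apply: cvgM; [exact: cvg_id|exact: cf].
  by apply: cvgB; [exact: ch|exact: cvg_cst].
- move=> w; have [w1|w1] := leP 1 `|w|.
    apply: (@le_trans _ _ 1); last by rewrite lerDl invr_ge0 normal_pdf_ge0.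
    have := wf w; rewrite normrM; have := normr_ge0 (f w); nra.
  apply: (@le_trans _ _ (phi 1)^-1); last by rewrite lerDr.
  rewrite /f normrM normfV (gtr0_norm (std_normal_pdf_gt0 w)).
  rewrite (le_trans (ler_piMl _ (k_le1 w))) ?invr_ge0 ?normal_pdf_ge0//.
  rewrite lef_pV2 ?posrE ?std_normal_pdf_gt0// !std_normal_pdfE.
  rewrite ler_pM2l ?normal_peak_gt0 ?oner_neq0// ler_expR.
  rewrite ler_pM2r ?invr_gt0// lerN2 -(real_normK (num_real w)) expr1n.
  by rewrite expr_le1// ltW.
- move=> w; rewrite /f' (le_trans (ler_normD _ _))//.
  by rewrite (_ : (2 : R) = 1 + 1)// lerD.
- by move=> w; rewrite /f'; ring.
Qed.

End stein_equation.

(** * Kolmogorov distance of a normalised squared norm *)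

Section gaussian_kolmogorov_bound.
Context {d : measure_display} {Om : measurableType d} {R : realType}.
Variable P : probability Om R.
Variables (I : finType) (Z : I -> Om -> R) (lam : I -> R).
Hypothesis hZ : gaussian_coordinates P Z lam.
Variable b : R.
Hypothesis lamb : forall i, lam i <= b.
Hypothesis S0 : 0 < \sum_i lam i ^+ 2.
Local Notation V := (sqnorm Z).
Local Notation m := (\sum_i lam i).
Local Notation G := (sqnorm_gradient Z lam).
Local Notation gamma := (@std_normal R).
Local Notation sigma := (Num.sqrt (2 * \sum_i lam i ^+ 2)).
Local Notation F := (fun w => (V w - m) / sigma).

Let lam0 := gc_variance_ge0 hZ.
Let mV := gaussian_sqnorm_measurable hZ.
Let iD := gaussian_sqnorm_dev_integrable hZ.
Let iG := gaussian_gradient_integrable hZ.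

Let sigma0 : 0 < sigma.
Proof. by rewrite sqrtr_gt0 mulr_gt0. Qed.

Let sigma2 : sigma ^+ 2 = 2 * \sum_i lam i ^+ 2.
Proof. by rewrite sqr_sqrtr// mulr_ge0// ltW. Qed.

Let b0 : 0 < b.
Proof.
rewrite ltNge; apply/negP => bN; move: S0; rewrite big1 ?ltxx// => i _.
have : lam i = 0; last by move=> ->; rewrite expr0n.
by apply/eqP; rewrite eq_le lam0 andbT (le_trans (lamb i)).
Qed.

Let mF : measurable_fun setT F.
Proof. by apply: measurable_funM => //; exact: measurable_funB. Qed.

(** G is itself a quadratic form, with weights 2 lam and mean sigma^2. Its variance is at most 256 *
    4 b^2 times the sum of the lam^2, which is half of sigma^2: hence 512. *)
Let gradient_deviation :
  \int[P]_w ((1 - G w / sigma ^+ 2) ^+ 2) <= 512 * (b / sigma) ^+ 2 /\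
  P.-integrable setT (EFin \o (fun w => (1 - G w / sigma ^+ 2) ^+ 2)).
Proof.
have wt0 i : 0 <= 2 * lam i by rewrite mulr_ge0.
have s0 : 0 < 4 * b ^+ 2 * \sum_i lam i ^+ 2 by rewrite !mulr_gt0// exprn_gt0.
have Ss : \sum_i (2 * lam i * lam i) ^+ 2 <= 4 * b ^+ 2 * \sum_i lam i ^+ 2.
  rewrite mulr_sumr; apply: ler_sum => i _.
  have : lam i ^+ 2 <= b ^+ 2 by rewrite ler_sqr ?nnegrE// ltW.
  by have := sqr_ge0 (lam i); nra.
have H := gaussian_quadratic_variance_le hZ wt0 s0 Ss.
have iQ := gaussian_weighted_deviation_integrable hZ wt0.
have EG : \sum_i 2 * lam i * lam i = sigma ^+ 2.
  by rewrite sigma2 mulr_sumr; apply: eq_bigr => i _; rewrite -mulrA.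
have E w : (1 - G w / sigma ^+ 2) ^+ 2 = sigma ^- 4 *
    (\sum_i 2 * lam i * Z i w ^+ 2 - \sum_i 2 * lam i * lam i) ^+ 2.
  by rewrite EG -/(sqnorm_gradient Z lam w); field; rewrite gt_eqF.
have -> : (fun w => (1 - G w / sigma ^+ 2) ^+ 2) = (fun w => sigma ^- 4 *
    (\sum_i 2 * lam i * Z i w ^+ 2 - \sum_i 2 * lam i * lam i) ^+ 2).
  by apply/funext => w.
split; last exact: integrable_scale.
rewrite RintegralZl//.
apply: (@le_trans _ _ (sigma ^- 4 * (256 * (4 * b ^+ 2 * \sum_i lam i ^+ 2)))).
  rewrite ler_wpM2l ?invr_ge0 ?exprn_ge0 ?(ltW sigma0)//.
  by rewrite -lee_fin Rintegral_EFin.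
rewrite [X in sigma ^- 4 * X](_ : _ = 512 * b ^+ 2 * sigma ^+ 2); last first.
  by rewrite sigma2; ring.
rewrite le_eqVlt; apply/orP; left; apply/eqP.
by field; rewrite gt_eqF.
Qed.

Let smooth_bound (h : R -> R) : continuous h -> (forall x, 0 <= h x <= 1) ->
  `|\int[P]_w h (F w) - \int[gamma]_x h x| <= 48 * (b / sigma).
Proof.
move=> ch h01; have [f [f' [C [df cf' fC f'2 Ef]]]] := stein_equation ch h01.
have cf : continuous f.
  by move=> x; apply/differentiable_continuous/derivable1_diffP; case: (df x).
have C0 : 0 <= C := le_trans (normr_ge0 _) (fC 0).
have mh : measurable_fun setT h by exact: continuous_measurable_fun.
have mf : measurable_fun setT f by exact: continuous_measurable_fun.
have mf' : measurable_fun setT f' by exact: continuous_measurable_fun.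
(* The integration by parts is applied to f composed with [aff], whose derivative carries one factor
   1/sigma; the other one in G / sigma^2 comes from F itself. *)
pose aff (v : R) := (v - m) / sigma.
have caff : continuous aff.
  move=> v; apply: cvgM; last exact: cvg_cst.
  by apply: cvgB; [exact: cvg_id|exact: cvg_cst].
have du (v : R) : is_derive v (1 : R) (fun v => f (aff v)) (f' (aff v) / sigma).
  have da : is_derive v (1 : R) aff sigma^-1.
    by apply: is_derive_eq; rewrite /GRing.scale/=; ring.
  exact: is_derive1_comp.
have cu' : continuous (fun v => f' (aff v) / sigma).
  move=> v; apply: cvgM; last exact: cvg_cst.
  by apply: continuous_cvg; [exact: cf'|exact: caff].
have SI := gaussian_stein_identity hZ (C := C + 2 / sigma) du cu' _ _.
have {}SI : \int[P]_w ((V w - m) * f (F w)) = \int[P]_w (G w * (f' (F w) / sigma)).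
  apply: SI => v.
    by rewrite (le_trans (fC _))// lerDl divr_ge0// ltW.
  rewrite normrM normfV (gtr0_norm sigma0) ler_wpDl//.
  by rewrite ler_wpM2r ?invr_ge0 ?(ltW sigma0).
have mfF : measurable_fun setT (fun w => f (F w)) by exact: measurableT_comp mF.
have mf'F : measurable_fun setT (fun w => f' (F w)) by exact: measurableT_comp mF.
have iF : P.-integrable setT (EFin \o (fun w => F w * f (F w))).
  rewrite (_ : _ \o _ = EFin \o (fun w => f (F w) * (sigma^-1 * (V w - m)))); last first.
    by apply/funext => w /=; congr (_%:E); ring.
  apply: (@integrable_bounded_mul _ _ _ _ _ _ C) => //.
  exact: integrable_scale.
have if' : P.-integrable setT (EFin \o (fun w => f' (F w))).
  exact: (@integrable_bounded _ _ _ P _ 2).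
have iGf' : P.-integrable setT (EFin \o (fun w => f' (F w) * (sigma ^- 2 * G w))).
  apply: (@integrable_bounded_mul _ _ _ _ _ _ 2) => //.
  exact: integrable_scale.
have ihF : P.-integrable setT (EFin \o (fun w => h (F w))).
  apply: (@integrable_bounded _ _ _ P _ 1); first exact: measurableT_comp mF.
  by move=> w; have /andP[? ?] := h01 (F w); rewrite ger0_norm.
have -> : \int[P]_w h (F w) - \int[gamma]_x h x =
    \int[P]_w (f' (F w) * (1 - G w / sigma ^+ 2)).
  transitivity (\int[P]_w (f' (F w)) - \int[P]_w (F w * f (F w))).
    rewrite -[X in _ - X](Rintegral_cstP P) -!RintegralB//; last exact: integrable_cstP.
    by apply: eq_Rintegral => w _; rewrite Ef.
  transitivity (\int[P]_w (f' (F w)) - \int[P]_w (f' (F w) * (sigma ^- 2 * G w))).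
    congr (_ - _).
    transitivity (\int[P]_w (sigma^-1 * ((V w - m) * f (F w)))).
      by apply: eq_Rintegral => w _; ring.
    rewrite RintegralZl//; last first.
      rewrite (_ : _ \o _ = EFin \o (fun w => f (F w) * (V w - m))); last first.
        by apply/funext => w /=; congr (_%:E); ring.
      exact: (@integrable_bounded_mul _ _ _ _ _ _ C).
    rewrite SI -RintegralZl//.
      by apply: eq_Rintegral => w _; field; rewrite gt_eqF.
    rewrite (_ : _ \o _ = EFin \o (fun w => sigma * (f' (F w) * (sigma ^- 2 * G w)))).
      exact: integrable_scale.
    by apply/funext => w /=; congr (_%:E); field; rewrite gt_eqF.
  rewrite -RintegralB//; apply: eq_Rintegral => w _; ring.
have [ED2 iD2] := gradient_deviation.
have t0 : 0 < b / sigma by exact: divr_gt0.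
(* A pointwise bound replaces the Cauchy-Schwarz inequality for integrals. With t = 32 b/sigma and a
   second moment at most 512 (b/sigma)^2, it yields 32 + 512/32 = 48. *)
apply: (@le_trans _ _ (\int[P]_w (32 * (b / sigma) +
    (32 * (b / sigma))^-1 * (1 - G w / sigma ^+ 2) ^+ 2))).
  apply: Rintegral_norm_le.
  - apply: measurable_funM => //; apply: measurable_funB => //.
    by apply: measurable_funM => //; exact: integrable_measurable iG.
  - move=> w; set D := 1 - _; rewrite normrM.
    apply: (@le_trans _ _ (2 * `|D|)); first by rewrite ler_wpM2r.
    (* AM-GM: [2 |D| <= t + D^2 / t] *)
    set t := 32 * (b / sigma); have t1 : 0 < t by rewrite mulr_gt0.
    rewrite -(ler_pM2l t1) mulrDr mulrA [X in _ + X]mulrA divff ?gt_eqF// mul1r.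
    by rewrite -(real_normK (num_real D)); have := sqr_ge0 (t - `|D|); nra.
  - by apply: integrable_add; [exact: integrable_cstP|exact: integrable_scale].
rewrite RintegralD//; [|exact: integrable_cstP|exact: integrable_scale].
rewrite Rintegral_cstP RintegralZl//.
have -> : 48 * (b / sigma) = 32 * (b / sigma) + (32 * (b / sigma))^-1 * (512 * (b / sigma) ^+ 2).
  by field; rewrite !gt_eqF.
by rewrite lerD2l ler_wpM2l// invr_ge0 mulr_ge0// ltW.
Qed.

Let Rintegral_indicator d' (T : measurableType d') (Q : probability T R) (A : set T) :
  measurable A -> (\int[Q]_x \1_A x)%:E = Q A.
Proof.
move=> mA; rewrite Rintegral_EFin; first by rewrite integral_indic// setIT.
apply: (@integrable_bounded _ _ _ Q _ 1) => // x.
by rewrite ger0_norm// indicE; case: (_ \in _).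
Qed.

(** The constant of [smooth_bound] is the same for all continuous functions with values in [0,1], so
    it survives a pointwise limit. *)
Let limit_bound (u : nat -> R -> R) (A : set R) : measurable A ->
  (forall n, continuous (u n)) -> (forall n x, 0 <= u n x <= 1) ->
  (forall x, u n x @[n --> \oo] --> (\1_A x : R)) ->
  (`|P [set w | A (F w)] - gamma A| <= (48 * (b / sigma))%:E)%E.
Proof.
move=> mA cu u01 uA.
have mAF : measurable [set w | A (F w)] by rewrite -[X in measurable X]setTI; exact: mF.
have un n x : `|u n x| <= 1 by have /andP[? ?] := u01 n x; rewrite ger0_norm.
have mu' n : measurable_fun setT (u n) by exact: continuous_measurable_fun.
have HP : \int[P]_w u n (F w) @[n --> \oo] --> \int[P]_w \1_[set w | A (F w)] w.
  apply: (@Rintegral_dominated_cvg _ _ _ P _ _ (fun=> 1)) => //.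
  - by move=> n; exact: measurableT_comp mF.
  - exact: integrable_cstP.
have HG : \int[gamma]_x u n x @[n --> \oo] --> \int[gamma]_x \1_A x.
  apply: (@Rintegral_dominated_cvg _ _ _ gamma _ _ (fun=> 1)) => //.
  exact: (integrable_cstP gamma).
rewrite -(Rintegral_indicator P mAF) -(Rintegral_indicator gamma mA).
rewrite -EFinB abse_EFin lee_fin.
apply: (cvgr_to_le (cvg_norm (cvgB HP HG))).
by apply: nearW => n; exact: smooth_bound.
Qed.

(** Its limit is the indicator of x > 0, with value 0 at 0. Hence [ramp n (z - x)] selects x < z and
    [1 - ramp n (x - z)] selects x <= z, and no argument about atoms is needed to pass between the
    two. *)
Let ramp (n : nat) (x : R) := Num.min 1 (Num.max 0 (n%:R * x)).

Let ramp01 n x : 0 <= ramp n x <= 1.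
Proof. by rewrite /ramp le_min ler01 le_max lexx/= ge_min lexx. Qed.

Let continuous_ramp n : continuous (ramp n).
Proof.
move=> x.
have := @continuous_min R R (fun=> 1) ((fun=> 0) \max (fun y => n%:R * y)) x; apply.
  exact: cvg_cst.
have := @continuous_max R R (fun=> 0) (fun y => n%:R * y) x; apply.
  exact: cvg_cst.
by apply: cvgM; [exact: cvg_cst|exact: cvg_id].
Qed.

Let cvg_ramp x : ramp n x @[n --> \oo] --> (\1_[set y | 0 < y] x : R).
Proof.
rewrite indicE; have [x0|x0] := ltP 0 x.
  rewrite mem_set//; apply: cvg_near_cst; near=> n.
  have nx : 1 <= n%:R * x.
    by rewrite -ler_pdivrMr//; near: n; exact: nbhs_infty_ger.
  by rewrite /ramp (max_idPr _) ?(le_trans ler01)//; apply/min_idPl.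
rewrite memNset; last by apply/negP; rewrite -leNgt.
apply: cvg_near_cst; apply: nearW => n.
rewrite /ramp (max_idPl _) ?mulr_ge0_le0//.
by apply/min_idPr; exact: ler01.
Unshelve. all: by end_near. Qed.

Lemma gaussian_kolmogorov_lt (z : R) :
  (`|P [set w | (F w < z)%R] - gamma `]-oo, z[%classic| <= (48 * (b / sigma))%:E)%E.
Proof.
have -> : [set w | (F w < z)%R] = [set w | `]-oo, z[%classic (F w)].
  by apply/seteqP; split => w /=; rewrite in_itv.
apply: (@limit_bound (fun n x => ramp n (z - x)) `]-oo, z[%classic) => // [n|x].
  move=> x; apply: continuous_cvg; first exact: continuous_ramp.
  by apply: cvgB; [exact: cvg_cst|exact: cvg_id].
have := @cvg_ramp (z - x); rewrite !indicE.
suff -> : (z - x \in [set y | 0 < y]) = (x \in `]-oo, z[%classic) by [].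
by apply/idP/idP; rewrite !inE/= in_itv/= subr_gt0.
Qed.

Lemma gaussian_kolmogorov_le (z : R) :
  (`|P [set w | (F w <= z)%R] - gamma `]-oo, z]%classic| <= (48 * (b / sigma))%:E)%E.
Proof.
have -> : [set w | (F w <= z)%R] = [set w | `]-oo, z]%classic (F w)].
  by apply/seteqP; split => w /=; rewrite in_itv.
apply: (@limit_bound (fun n x => 1 - ramp n (x - z)) `]-oo, z]%classic) => // [n|n x|x].
- move=> x; apply: cvgB; first exact: cvg_cst.
  apply: continuous_cvg; first exact: continuous_ramp.
  by apply: cvgB; [exact: cvg_id|exact: cvg_cst].
- by have := ramp01 n (x - z); lra.
- have H : 1 - ramp n (x - z) @[n --> \oo] --> (1 - \1_[set y | 0 < y] (x - z) : R).
    by apply: cvgB; [exact: cvg_cst|exact: cvg_ramp].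
  suff <- : 1 - \1_[set y | 0 < y] (x - z) = \1_`]-oo, z]%classic x :> R by [].
  rewrite !indicE; have [xz|xz] := leP x z.
    by rewrite memNset ?mem_set ?subr0//= ?in_itv//=; apply/negP; rewrite -leNgt subr_le0.
  rewrite mem_set/= ?subr_gt0// memNset ?subrr//= in_itv/=.
  by apply/negP; rewrite -ltNge.
Qed.

End gaussian_kolmogorov_bound.

(** * Diagonalisation of the covariance matrix *)

Section real_eigenvalue.
Import complex.
Context {R : realType}.

(** Over the complex numbers A is hermitian, hence diagonalisable with real eigenvalues. One of them
    is a root of the characteristic polynomial, whose coefficients are real, and the embedding of
    the reals reflects roots. *)
Lemma symmetric_eigenvalue n (A : 'M[R]_n.+1) : A^T = A -> exists a, eigenvalue A a.
Proof.
move=> symA.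
pose f : {rmorphism R -> complex.complex R} := complex.real_complex R.
pose A' := map_mx f A.
have hA' : A' \is hermsymmx.
  apply: realsym_hermsym.
    apply/is_hermitianmxP; rewrite expr0 scale1r; apply/matrixP => i j.
    by rewrite !mxE -[in LHS]symA mxE.
  apply/mxOverP => i j; rewrite mxE; apply/complex.complex_realP.
  by exists (A i j).
have /hermitian_normalmx/orthomx_spectralP := hA'.
set Q := spectralmx A'; set s := spectral_diag A' => A'E.
have Qu : Q \in unitmx := spectral_unit A'.
have QA' : Q *m A' = diag_mx s *m Q.
  by rewrite A'E !mulmxA mulmxV// mul1mx.
have ev : eigenvalue A' (s 0 0).
  apply/eigenvalueP; exists (row 0 Q).
    by rewrite -row_mul QA' row_mul row_diag_mx -scalemxAl -rowE.
  apply/eqP => rQ0; have := mulmxV Qu => /(congr1 (row 0)).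
  rewrite row_mul rQ0 mul0mx => /rowP/(_ 0)/eqP.
  by rewrite !mxE eqxx eq_sym oner_eq0.
have /mxOverP/(_ 0 0)/complex.complex_realP[r sr] := hermitian_spectral_diag_real hA'.
exists r; move: ev; rewrite -/s sr !eigenvalue_root_char.
by rewrite -map_char_poly fmorph_root.
Qed.

End real_eigenvalue.

Section real_spectral.
Context {R : realType}.

(* [Q] is the reflection exchanging the first basis vector and [v]. *)
Lemma orthogonal_completion n (v : 'rV[R]_(1 + n)) : v *m v^T = 1%:M ->
  exists Q : 'M[R]_(1 + n), [/\ Q^T = Q, Q *m Q = 1%:M &
    row_mx 1%:M 0 *m Q = v].
Proof.
move=> vv; pose e : 'rV[R]_(1 + n) := row_mx 1%:M 0.
have ee : e *m e^T = 1%:M by rewrite tr_row_mx mul_row_col trmx1 mul1mx trmx0 mulmx0 addr0.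
pose w := v - e.
have [w0|w0] := eqVneq w 0.
  exists 1%:M; split; rewrite ?trmx1 ?mulmx1//.
  by apply/esym/eqP; rewrite -subr_eq0; apply/eqP.
have [s Es] : exists s, e *m v^T = s%:M.
  by exists ((e *m v^T) 0 0); rewrite [LHS]mx11_scalar.
have Es' : v *m e^T = s%:M by rewrite -[LHS]trmxK trmx_mul trmxK Es tr_scalar_mx.
have ww : w *m w^T = (2 * (1 - s))%:M.
  rewrite /w linearB/= mulmxBr !mulmxBl vv ee Es Es' -!raddfB/=.
  by congr (_%:M); ring.
(* The squared length of w is 2(1 - s), which is nonzero because w is. *)
have s1 : 1 - s != 0.
  apply/eqP => s0; case/eqP: w0; apply/rowP => j; rewrite [RHS]mxE.
  have : \sum_k w 0 k ^+ 2 = 0.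
    transitivity ((w *m w^T) 0 0).
      by rewrite mxE; apply: eq_bigr => k _; rewrite !mxE expr2.
    by rewrite ww s0 mulr0 mxE mul0rn.
  move=> /eqP; rewrite psumr_eq0; last by move=> k _; exact: sqr_ge0.
  by move=> /allP/(_ j (mem_index_enum j))/=; rewrite sqrf_eq0 => /eqP.
(* Householder's matrix 1 - 2 w^T w / |w|^2, with |w|^2 = 2(1 - s). *)
pose Q : 'M[R]_(1 + n) := 1%:M - (1 - s)^-1 *: (w^T *m w).
exists Q; split.
- by rewrite /Q linearB/= linearZ/= trmx_mul trmxK trmx1.
- have WW : (w^T *m w) *m (w^T *m w) = (2 * (1 - s)) *: (w^T *m w).
    by rewrite mulmxA -(mulmxA w^T) ww mul_mx_scalar -scalemxAl.
  rewrite /Q; move: (w^T *m w) WW => W WW.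
  rewrite mulmxBl mul1mx mulmxBr mulmx1 -scalemxAl -scalemxAr WW !scalerA.
  rewrite (_ : (1 - s)^-1 / (1 - s) * (2 * (1 - s)) = (1 - s)^-1 + (1 - s)^-1).
    by rewrite scalerDl opprB addrA addrA subrK addrK.
  by field.
- rewrite -/e /Q mulmxBr mulmx1 -scalemxAr mulmxA.
  have -> : e *m w^T = (- (1 - s))%:M.
    by rewrite /w linearB/= mulmxBr Es ee -raddfB/= opprB.
  rewrite mul_scalar_mx scalerA mulrN mulVf// scaleN1r opprK /w.
  by rewrite addrCA subrr addr0.
Qed.

(** Induction on the dimension: conjugating by the reflection that takes the first basis vector to a
    unit eigenvector makes the first row of the matrix diagonal, and symmetry then clears the first
    column. *)
Lemma real_symmetric_spectral n (A : 'M[R]_n) : A^T = A ->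
  exists (U : 'M[R]_n) (s : 'rV[R]_n),
    U *m U^T = 1%:M /\ U *m A *m U^T = diag_mx s.
Proof.
elim: n A => [|n IH] A symA.
  by exists 1%:M, 0; split; apply/matrixP => -[].
have [a /eigenvalueP[u uA u0]] := symmetric_eigenvalue symA.
pose N := Num.sqrt (\sum_k u 0 k ^+ 2).
have S0 : 0 < \sum_k u 0 k ^+ 2.
  rewrite lt_neqAle sumr_ge0 ?andbT => [|k _]; last exact: sqr_ge0.
  rewrite eq_sym psumr_eq0 => [|k _]; last exact: sqr_ge0.
  apply: contra u0 => /allP H; apply/eqP/rowP => j; rewrite mxE.
  by have := H j (mem_index_enum j); rewrite /= sqrf_eq0 => /eqP.
have N0 : N != 0 by rewrite gt_eqF// sqrtr_gt0.
pose v : 'rV[R]_(1 + n) := N^-1 *: u.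
have vv : v *m v^T = 1%:M.
  rewrite /v linearZ/= -scalemxAl -scalemxAr scalerA [X in _ *: X]mx11_scalar.
  rewrite mxE -[X in X%:M](_ : N ^+ 2 = _); last first.
    rewrite sqr_sqrtr ?ltW//; apply: eq_bigr => k _; by rewrite mxE expr2.
  by rewrite scale_scalar_mx; congr (_%:M); field.
have vA : v *m A = a *: v by rewrite /v -scalemxAl uA scalerA mulrC -scalerA.
have [Q [QT QQ eQ]] := orthogonal_completion vv.
pose B : 'M[R]_(1 + n) := Q *m A *m Q.
have symB : B^T = B by rewrite /B !trmx_mul QT symA mulmxA.
have eB : row_mx 1%:M 0 *m B = row_mx a%:M 0.
  rewrite /B !mulmxA eQ vA -scalemxAl -eQ -mulmxA QQ mulmx1.
  by rewrite scale_row_mx scaler0 scale_scalar_mx mulr1.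
have BE : B = block_mx a%:M 0 0 (drsubmx B).
  have E1 : usubmx B = row_mx a%:M 0.
    by rewrite -eB -[in RHS](vsubmxK B) mul_row_col mul1mx mul0mx addr0.
  rewrite -[LHS]submxK /ulsubmx /ursubmx E1 row_mxKl row_mxKr; congr block_mx.
  by rewrite -[dlsubmx B]trmxK trmx_dlsub symB /ursubmx E1 row_mxKr trmx0.
have symB' : (drsubmx B)^T = drsubmx B by rewrite trmx_drsub symB.
have [U [s [UU Us]]] := IH _ symB'.
pose L : 'M[R]_(1 + n) := block_mx 1%:M 0 0 U.
have LT : L^T = block_mx 1%:M 0 0 U^T by rewrite tr_block_mx trmx1 !trmx0.
have LL : L *m L^T = 1%:M.
  rewrite LT mulmx_block !mul0mx !mulmx0 mulmx1 addr0 !add0r UU.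
  by rewrite -scalar_mx_block.
have LBL : L *m B *m L^T = diag_mx (row_mx a%:M s).
  rewrite BE LT !mulmx_block !(mul0mx, mulmx0, addr0, add0r) mul1mx mulmx1 Us.
  rewrite diag_mx_row; congr block_mx.
  by apply/matrixP => i j; rewrite !mxE !ord1 eqxx.
exists (L *m Q); exists (row_mx (a%:M : 'M[R]_1) s).
split; rewrite trmx_mul QT.
  by rewrite mulmxA -(mulmxA L Q Q) QQ mulmx1.
by rewrite mulmxA -(mulmxA L Q A) -(mulmxA L (Q *m A) Q).
Qed.

End real_spectral.

(** * Orthogonal change of coordinates in a Gaussian vector *)

Section gaussian_vectors.
Context {d : measure_display} {Om : measurableType d} {R : realType}.
Variable P : probability Om R.

Lemma gaussian_rv_integrable (Y : Om -> R) : measurable_fun setT Y ->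
  gaussian_rv P Y -> P.-integrable setT (EFin \o Y) /\
    P.-integrable setT (EFin \o (fun w => Y w ^+ 2)).
Proof.
move=> mY gY; have [m [s [_ H]]] := gaussian_rv_integral mY gY.
have aff (x : R) : `|m + s * x| <= (1 + `|m| + `|s|) * (1 + `|x|).
  rewrite (le_trans (ler_normD _ _))// normrM.
  by have := normr_ge0 m; have := normr_ge0 s; have := normr_ge0 x; nra.
have maff : measurable_fun setT (fun x : R => m + s * x).
  by apply: measurable_funD => //; apply: measurable_funM.
split.
- apply: (H id _ _).1 => [x|]; first exact: cvg_id.
  apply: (@std_normal_integrable_quadratic _ _ (2 * (1 + `|m| + `|s|))) => // x.
  rewrite (le_trans (aff x))// -[leRHS]mulrA (mulrCA 2) ler_wpM2l ?addr_ge0//.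
  by rewrite -(real_normK (num_real x)); have := sqr_ge0 (`|x| - 1); nra.
- apply: (H (fun y => y ^+ 2) _ _).1 => [x|]; first exact: sqr_continuous.
  apply: (@std_normal_integrable_quadratic _ _ (2 * (1 + `|m| + `|s|) ^+ 2)).
    exact: measurable_funX.
  move=> x; rewrite normrX; apply: (@le_trans _ _ (((1 + `|m| + `|s|) * (1 + `|x|)) ^+ 2)).
    by rewrite ler_sqr ?nnegrE ?mulr_ge0 ?addr_ge0.
  rewrite exprMn -[leRHS]mulrA [leRHS]mulrCA ler_wpM2l ?sqr_ge0//.
  by rewrite -(real_normK (num_real x)); have := sqr_ge0 (`|x| - 1); nra.
Qed.

(** Take Z = U Y with U orthogonal and diagonalising the covariance matrix. Linear forms in Z are
    linear forms in Y, hence centred Gaussian, and their transforms are determined by their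
    variances. *)
Lemma gaussian_vector_coordinates (N : nat) (Y : 'I_N -> Om -> R) :
  (forall k, measurable_fun setT (Y k)) ->
  (forall c : 'I_N -> R, gaussian_rv P (fun w => \sum_k c k * Y k w)) ->
  (forall k, \int[P]_w Y k w = 0) ->
  exists (Z : 'I_N -> Om -> R) (lam : 'I_N -> R), [/\
    gaussian_coordinates P Z lam,
    (forall w, \sum_k Y k w ^+ 2 = sqnorm Z w) &
    (forall B, (forall j, \sum_k `|\int[P]_w (Y k w * Y j w)| <= B) ->
      forall i, lam i <= B)].
Proof.
move=> mY gY EY.
have mlin (c : 'I_N -> R) : measurable_fun setT (fun w => \sum_k c k * Y k w).
  by apply: measurable_sum => k; exact: measurable_funM.
have YE k : Y k = (fun w => \sum_j (k == j)%:R * Y j w).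
  apply/funext => w; rewrite (bigD1 k)//= eqxx mul1r big1 ?addr0// => j.
  by rewrite eq_sym => /negbTE ->; rewrite mul0r.
have iY k : P.-integrable setT (EFin \o Y k).
  by rewrite YE; have [] := gaussian_rv_integrable (mlin _) (gY (fun j => (k == j)%:R)).
have iY2 k : P.-integrable setT (EFin \o (fun w => Y k w ^+ 2)).
  rewrite YE.
  by have [] := gaussian_rv_integrable (mlin _) (gY (fun j => (k == j)%:R)).
have iYY k j : P.-integrable setT (EFin \o (fun w => Y k w * Y j w)).
  apply: (@integrable_dominated _ _ _ P _ (fun w => Y k w ^+ 2 + Y j w ^+ 2)).
  - exact: measurable_funM.
  - move=> w; rewrite normrM -(real_normK (num_real (Y k w))) -(real_normK (num_real (Y j w))).
    have := sqr_ge0 (`|Y k w| - `|Y j w|); have := sqr_ge0 (`|Y k w|).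
    by have := sqr_ge0 (`|Y j w|); nra.
  - exact: integrable_add.
pose Gam : 'M[R]_N := \matrix_(k, j) \int[P]_w (Y k w * Y j w).
have symG : Gam^T = Gam.
  by apply/matrixP => k j; rewrite !mxE; apply: eq_Rintegral => w _; rewrite mulrC.
have [U [s [UU Us]]] := real_symmetric_spectral symG.
have UtU : U^T *m U = 1%:M by exact: mulmx1C.
pose Z i w := \sum_k U i k * Y k w.
pose lam i := s 0 i.
have ZE (a : 'I_N -> R) w : \sum_i a i * Z i w =
    \sum_k (\sum_i a i * U i k) * Y k w.
  under eq_bigr do rewrite /Z mulr_sumr.
  rewrite exchange_big/=; apply: eq_bigr => k _; rewrite mulr_suml.
  by apply: eq_bigr => i _; rewrite mulrA.
have sqE (c : 'I_N -> R) : \int[P]_w ((\sum_k c k * Y k w) ^+ 2) =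
    \sum_k \sum_j c k * Gam k j * c j.
  transitivity (\int[P]_w (\sum_k \sum_j (c k * c j) * (Y k w * Y j w))).
    apply: eq_Rintegral => w _; rewrite expr2 mulr_suml; apply: eq_bigr => k _.
    by rewrite mulr_sumr; apply: eq_bigr => j _; ring.
  rewrite Rintegral_sum; last first.
    by move=> k; apply: integrable_sumr => j; exact: integrable_scale.
  apply: eq_bigr => k _; rewrite Rintegral_sum; last first.
    by move=> j; exact: integrable_scale.
  by apply: eq_bigr => j _; rewrite RintegralZl// mxE mulrAC.
(* The variance of a linear form in Z is a quadratic form with matrix U Gam U^T, which is
   diagonal. *)
have varE (a : 'I_N -> R) : \int[P]_w ((\sum_i a i * Z i w) ^+ 2) =
    \sum_i a i ^+ 2 * lam i.
  under eq_Rintegral do rewrite ZE.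
  rewrite sqE.
  pose ar : 'rV[R]_N := \row_i a i.
  transitivity ((ar *m (U *m Gam *m U^T) *m ar^T) 0 0).
    rewrite !mulmxA -(mulmxA _ U^T) -trmx_mul mxE exchange_big/=.
    apply: eq_bigr => j _; rewrite !mxE mulr_suml; apply: eq_bigr => k _.
    rewrite !mxE; congr (_ * _ * _); apply: eq_bigr => i _; by rewrite mxE.
  rewrite Us mxE; apply: eq_bigr => i _.
  by rewrite mul_mx_diag !mxE /lam; ring.
have ElinY (c : 'I_N -> R) : \int[P]_w (\sum_k c k * Y k w) = 0.
  rewrite Rintegral_sum; last by move=> k; exact: integrable_scale.
  by apply: big1 => k _; rewrite RintegralZl// EY mulr0.
have H (a : 'I_N -> R) := centred_gaussian_integrals (mlin (fun k => \sum_i a i * U i k))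
  (gY _) (ElinY _).
have ZdE i w : \sum_j (i == j)%:R * Z j w = Z i w.
  rewrite (bigD1 i)//= eqxx mul1r big1 ?addr0// => j.
  by rewrite eq_sym => /negbTE ->; rewrite mul0r.
have SZ w : \sum_k Y k w ^+ 2 = sqnorm Z w.
  pose y : 'rV[R]_N := \row_k Y k w.
  transitivity ((y *m (U^T *m U) *m y^T) 0 0).
    by rewrite UtU mulmx1 mxE; apply: eq_bigr => k _; rewrite !mxE expr2.
  rewrite !mulmxA -(mulmxA _ U) -{2}(trmxK U) -trmx_mul mxE.
  rewrite /sqnorm; apply: eq_bigr => i _; rewrite !mxE expr2 /Z.
  by congr (_ * _); apply: eq_bigr => k _; rewrite !mxE mulrC.
exists Z, lam; split => //.
- split.
  + by move=> i; exact: mlin.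
  + move=> i; have [iH _ _] := H (fun j => (i == j)%:R).
    move: iH; congr (integrable _ _ (_ \o _)); apply/funext => w.
    by rewrite -ZE ZdE.
  + move=> i; transitivity (\int[P]_w ((\sum_j (i == j)%:R * Z j w) ^+ 2)).
      by apply: eq_Rintegral => w _; rewrite ZdE.
    rewrite varE (bigD1 i)//= eqxx expr1n mul1r big1 ?addr0// => j.
    by rewrite eq_sym => /negbTE ->; rewrite expr0n/= mul0r.
  + move=> a b; have [_ Hc _] := H a.
    under eq_Rintegral do rewrite ZE.
    rewrite Hc; under eq_Rintegral do rewrite -ZE.
    by rewrite varE.
  + move=> a; have [_ _ He] := H a.
    under eq_integral do rewrite ZE.
    rewrite He; under eq_Rintegral do rewrite -ZE.
    by rewrite varE.
- move=> B HB i.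
  have UG : U *m Gam = diag_mx s *m U.
    by rewrite -Us -!mulmxA UtU mulmx1.
  (* Gershgorin: compare the entries of [s U = U Gam] at the largest entry of
     the [i]-th row of [U]. *)
  have [j _ jmax] := @arg_maxP _ _ _ i xpredT (fun j => `|U i j|) isT.
  have jm k : `|U i k| <= `|U i j| by exact: jmax.
  have uj0 : 0 < `|U i j|.
    rewrite lt_neqAle normr_ge0 andbT eq_sym; apply/eqP => Uij0.
    have := congr1 (fun M : 'M[R]_N => M i i) UU; rewrite !mxE eqxx.
    rewrite big1; first by move=> /eqP; rewrite eq_sym oner_eq0.
    move=> k _; have := jm k; rewrite Uij0 normr_le0 => /eqP ->.
    by rewrite mul0r.
  have E : lam i * U i j = \sum_k U i k * Gam k j.
    have := congr1 (fun M : 'M[R]_N => M i j) UG; rewrite mul_diag_mx !mxE => <-.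
    by [].
  apply: (@le_trans _ _ `|lam i|); first exact: ler_norm.
  rewrite -(ler_pM2r uj0) -normrM E (le_trans (ler_norm_sum _ _ _))//.
  apply: (@le_trans _ _ (\sum_k `|Gam k j| * `|U i j|)).
    apply: ler_sum => k _; by rewrite normrM [leRHS]mulrC ler_wpM2r.
  rewrite -mulr_suml ler_wpM2r//; apply: le_trans (HB j).
  by apply: ler_sum => k _; rewrite mxE.
Qed.

End gaussian_vectors.

(** * Normalised increments along one partition *)

Section partition_coordinates.
Context {d : measure_display} {Om : measurableType d} {R : realType}.
Variables (P : probability Om R) (T : R) (X : R -> {RV P >-> R}).
Hypothesis hXgauss : gaussian_process `[0, T] X.
Hypothesis hXcentred : centred_process `[0, T] X.
Variables (phi : R -> R) (s : seq R).
Hypothesis hs : itv_partition 0 T s.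
Hypothesis hphi : forall k, (k < size s)%N -> 0 < phi (step s k).

Lemma grid_itv k : (k <= size s)%N -> `[0, T]%classic (grid s k).
Proof.
move=> ks; have E : grid s k = nth T (0 :: s) k by apply: set_nth_default.
rewrite /= in_itv/= E; apply/andP; split.
- by apply: itv_partition_nth_ge hs.
- by apply: itv_partition_nth_le hs.
Qed.

Lemma partition_gaussian_coordinates :
  exists (Z : 'I_(size s) -> Om -> R) (lam : 'I_(size s) -> R), [/\
    gaussian_coordinates P Z lam,
    qv1 X phi s = sqnorm Z,
    qv1_mean X phi s = \sum_i lam i &
    (forall i, lam i <= max_cov_sum X phi s)].
Proof.
pose r (k : 'I_(size s)) := (Num.sqrt (phi (step s k)))^-1.
have r2 k : r k ^+ 2 = (phi (step s k))^-1 by rewrite exprVn sqr_sqrtr// ltW// hphi.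
pose Y (k : 'I_(size s)) w := r k * incr X s k w.
have mX t : measurable_fun setT (X t) by exact: measurable_funP.
have mincr k : measurable_fun setT (incr X s k) by exact: measurable_funB.
have mY k : measurable_fun setT (Y k) by exact: measurable_funM.
have gY (c : 'I_(size s) -> R) : gaussian_rv P (fun w => \sum_k c k * Y k w).
  (* A combination of increments is a combination of twice as many values of the process: right
     endpoints with their coefficients, then left endpoints with the opposite ones. Repeated times
     are allowed. *)
  pose t (i : 'I_(size s + size s)) := match fintype.split i with
    | inl k => grid s k.+1 | inr k => grid s k end.
  pose a (i : 'I_(size s + size s)) := match fintype.split i with
    | inl k => c k * r k | inr k => - (c k * r k) end.
  have tI i : `[0, T]%classic (t i).
    by rewrite /t; case: fintype.split => k; apply: grid_itv => //; exact: ltnW.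
  have := hXgauss a tI; congr gaussian_rv; apply/funext => w.
  rewrite big_split_ord/= -big_split/=; apply: eq_bigr => k _.
  rewrite /t /a (unsplitK (inl k)) (unsplitK (inr k)) /Y /incr; ring.
have iX t0 : `[0, T]%classic t0 -> P.-integrable setT (EFin \o X t0).
  move=> It; have := hXgauss (fun=> 1 : R) (fun _ : 'I_1 => It) => gX.
  have gX0 : gaussian_rv P (X t0).
    by move: gX; congr gaussian_rv; apply/funext => w; rewrite big_ord1 mul1r.
  by have [] := gaussian_rv_integrable (mX t0) gX0.
have EX t0 : `[0, T]%classic t0 -> \int[P]_w X t0 w = 0.
  by move=> It; have := hXcentred It; rewrite unlock /Rintegral => ->.
have iincr (k : 'I_(size s)) : P.-integrable setT (EFin \o incr X s k).
  by apply: integrable_sub; apply: iX; apply: grid_itv => //; exact: ltnW.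
have EY k : \int[P]_w Y k w = 0.
  rewrite RintegralZl// RintegralB//; last 2 first.
  - by apply: iX; exact: grid_itv.
  - by apply: iX; apply: grid_itv; exact: ltnW.
  rewrite !EX ?subrr ?mulr0//; first by apply: grid_itv; exact: ltnW.
  exact: grid_itv.
have [Z [lam [hZ SZ lamB]]] := gaussian_vector_coordinates mY gY EY.
have ZZ w : \sum_(k < size s) (incr X s k w) ^+ 2 / phi (step s k) = sqnorm Z w.
  by rewrite -SZ; apply: eq_bigr => k _; rewrite /Y exprMn r2 mulrC.
have iYlin k : P.-integrable setT (EFin \o (fun w => Y k w ^+ 2)).
  have gYk : gaussian_rv P (Y k).
    have := gY (fun j => (k == j)%:R); congr gaussian_rv; apply/funext => w.
    rewrite (bigD1 k)//= eqxx mul1r big1 ?addr0// => j.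
    by rewrite eq_sym => /negbTE ->; rewrite mul0r.
  by have [] := gaussian_rv_integrable (mY k) gYk.
have iincr2 (k : 'I_(size s)) : P.-integrable setT (EFin \o (fun w => incr X s k w ^+ 2)).
  have := @integrable_scale _ _ _ P (phi (step s k)) _ (iYlin k).
  congr (integrable _ _ (_ \o _)); apply/funext => w.
  by rewrite /Y exprMn r2 mulrA divff ?mul1r// gt_eqF// hphi.
exists Z, lam; split => //.
- by apply/funext => w; exact: ZZ.
- rewrite -(gaussian_sqnorm_mean hZ).
  under [RHS]eq_Rintegral do rewrite -SZ.
  rewrite Rintegral_sum//; apply: eq_bigr => k _.
  rewrite unlock -/(Rintegral P setT (fun w => incr X s k w ^+ 2)) -RintegralZr//.
  by apply: eq_Rintegral => w _; rewrite /Y exprMn r2 mulrC.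
- apply: lamB => j.
  rewrite /max_cov_sum; apply: (@le_trans _ _ (\sum_(k < size s)
    1 / Num.sqrt (phi (step s k) * phi (step s j)) *
    `|fine 'E_P[fun w => incr X s k w * incr X s j w]|)); last first.
    exact: (le_bigmax _ (fun j : 'I_(size s) => \sum_(k < size s)
      1 / Num.sqrt (phi (step s k) * phi (step s j)) *
      `|fine 'E_P[fun w => incr X s k w * incr X s j w]|) j).
  apply: ler_sum => k _.
  have -> : 1 / Num.sqrt (phi (step s k) * phi (step s j)) = r k * r j.
    by rewrite sqrtrM ?ltW ?hphi// invfM mul1r.
  have rr0 : 0 <= r k * r j by rewrite mulr_ge0 ?invr_ge0 ?sqrtr_ge0.
  rewrite -{1}(ger0_norm rr0) -normrM unlock.
  rewrite -/(Rintegral P setT (fun w => incr X s k w * incr X s j w)).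
  rewrite -RintegralZl//.
    rewrite le_eqVlt; apply/orP; left; apply/eqP; congr (`|_|).
    by apply: eq_Rintegral => w _; rewrite /Y; ring.
  apply: (@integrable_dominated _ _ _ P _
    (fun w => incr X s k w ^+ 2 + incr X s j w ^+ 2)).
  - exact: measurable_funM.
  - move=> w; rewrite normrM -(real_normK (num_real (incr X s k w))).
    rewrite -(real_normK (num_real (incr X s j w))).
    have := sqr_ge0 (`|incr X s k w| - `|incr X s j w|).
    by have := sqr_ge0 `|incr X s k w|; have := sqr_ge0 `|incr X s j w|; nra.
  - exact: integrable_add.
Qed.

End partition_coordinates.

(** * Convergence from exponential moments *)

Section exponential_moments.
Context {d : measure_display} {Om : measurableType d} {R : realType}.
Variable P : probability Om R.

Lemma cvge0_le (u : nat -> \bar R) : (forall n, (0 <= u n)%E) ->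
  (forall e : R, 0 < e -> \forall n \near \oo, (u n <= e%:E)%E) ->
  u n @[n --> \oo] --> 0%E.
Proof.
move=> u0 ue; apply/fine_cvgP; split.
  have := ue _ ltr01; apply: filterS => n un.
  by rewrite ge0_fin_numE// (le_lt_trans un)// ltry.
apply/cvgr0Pnorm_le => e e0; have := ue _ e0; apply: filterS => n un.
have ufin : u n \is a fin_num by rewrite ge0_fin_numE// (le_lt_trans un)// ltry.
by rewrite /= ger0_norm ?fine_ge0// -lee_fin fineK.
Qed.

Lemma chernoff_tail (D : Om -> R) (t e B : R) : measurable_fun setT D ->
  0 <= t -> (\int[P]_w (expR (t * D w))%:E <= B%:E)%E ->
  (P [set w | (e < D w)%R] <= (expR (- (t * e)) * B)%:E)%E.
Proof.
move=> mD t0 HB.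
have mA : measurable [set w | (e < D w)%R].
  rewrite -[X in measurable X]setTI (_ : [set w | _] = D @^-1` `]e, +oo[%classic).
    exact: mD.
  by apply/seteqP; split => w /=; rewrite in_itv/= andbT.
have me : measurable_fun setT (fun w => (expR (t * D w))%:E).
  by apply/measurable_EFinP; apply: measurableT_comp => //; exact: measurable_funM.
apply: (@le_trans _ _ ((expR (- (t * e)))%:E * \int[P]_w (expR (t * D w))%:E)%E); last first.
  by rewrite EFinM lee_wpmul2l// lee_fin expR_ge0.
rewrite -ge0_integralZl//.
rewrite (_ : P _ = (\int[P]_w (\1_[set w | (e < D w)%R] w)%:E)%E); last first.
  by rewrite integral_indic// setIT.
apply: ge0_le_integral => //.
- by apply/measurable_EFinP; exact: measurable_indic.
- exact: emeasurable_funM.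
- move=> w _; rewrite -EFinM lee_fin -expRD indicE.
  have [eD|_] := boolP (w \in _); last exact: expR_ge0.
  rewrite -expR0 ler_expR addrC -mulrBr mulr_ge0// subr_ge0 ltW//.
  by move: eD; rewrite inE.
Qed.

(** Bound (t x)^p by the exponential series, then divide by t^p >= t. The factor 1/t is what turns
    bounded exponential moments into L^p convergence. *)
Lemma powR_le_expR (p : R) (N : nat) (t x : R) : 1 <= p -> p <= N%:R -> 1 <= t -> 0 <= x ->
  x `^ p <= (1 + N`!%:R) / t * expR (t * x).
Proof.
move=> p1 pN t1 x0; have t0 : 0 < t by apply: lt_le_trans t1.
have p0 : 0 < p by apply: lt_le_trans p1.
have tx0 : 0 <= t * x by rewrite mulr_ge0// ltW.
have N0 : 0 <= N`!%:R :> R by [].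
have e1 : 1 <= expR (t * x) by rewrite -expR0 ler_expR.
have key : (t * x) `^ p <= (1 + N`!%:R) * expR (t * x).
  have [tx1|tx1] := leP (t * x) 1.
    apply: (@le_trans _ _ 1).
      have := @ge0_ler_powR R p (ltW p0) (t * x) 1; rewrite powR1.
      by apply; rewrite ?nnegrE.
    by rewrite -[leLHS]mulr1 ler_pM// lerDl.
  apply: (@le_trans _ _ ((t * x) ^+ N)).
    by rewrite -powR_mulrn// ler_powR// ltW.
  case: N N0 {pN} => [|N] N0; first by rewrite expr0 fact0 -[leLHS]mulr1 ler_pM// lerDl.
  have := expR_ge1Dxn N tx0.
  have f0 : 0 < N.+1`!%:R :> R by rewrite ltr0n fact_gt0.
  rewrite -lerBrDl ler_pdivrMr// => H; apply: (le_trans H).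
  rewrite mulrC; apply: ler_pM => //; rewrite ?lerDr ?subr_ge0//.
  by rewrite gerBl.
have tp : t <= t `^ p by rewrite -{1}(powRr1 (ltW t0)) ler_powR.
rewrite powRM// in key; last exact: ltW.
rewrite mulrAC ler_pdivlMr// mulrC; apply: le_trans key.
by rewrite ler_wpM2r// powR_ge0.
Qed.

Variables (D : nat -> Om -> R) (h M : nat -> R).
Hypothesis mD : forall n, measurable_fun setT (D n).
Hypothesis D0 : forall n w, 0 <= D n w.
Hypothesis h0 : forall n, 0 <= h n.
Hypothesis M0 : forall n, 0 <= M n.
Hypothesis expD : forall n (t : R), 0 <= t -> t * h n <= 1 / 4 ->
  (\int[P]_w (expR (t * D n w))%:E <= (2 * expR (4 * t ^+ 2 * (h n * M n)))%:E)%E.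

(** For fixed t, both t h and the exponent 4 t^2 h M become small with h, so every exponential
    moment is eventually below one universal constant. *)
Let near_exp (B t : R) : h n @[n --> \oo] --> 0 -> (\forall n \near \oo, M n <= B) -> 0 <= t ->
  \forall n \near \oo, (\int[P]_w (expR (t * D n w))%:E <= (2 * expR 1)%:E)%E.
Proof.
move=> hto0 MB t0.
(* The first summand will give t h <= 1/4, the second 4 t^2 h M <= 1. *)
have c0 : 0 < (4 * (t + 1) + 4 * t ^+ 2 * (`|B| + 1))^-1.
  rewrite invr_gt0 ltr_pwDl ?mulr_gt0 ?ltr_wpDl//.
  by rewrite mulr_ge0 ?mulr_ge0 ?sqr_ge0 ?addr_ge0.
have hs : \forall n \near \oo, `|h n| <= (4 * (t + 1) + 4 * t ^+ 2 * (`|B| + 1))^-1.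
  exact: (cvgr0Pnorm_le h).1.
near=> n.
have hn : h n * (4 * (t + 1) + 4 * t ^+ 2 * (`|B| + 1)) <= 1.
  rewrite -ler_pdivlMr; last by rewrite -invr_gt0.
  rewrite mul1r -[leLHS]ger0_norm//.  by near: n.
have Mn : M n <= `|B| + 1.
  apply: (@le_trans _ _ B); first by near: n.
  by rewrite (le_trans (ler_norm _))// lerDl.
have hn0 := h0 n; have Mn0 := M0 n.
have q0 : 0 <= h n * (4 * t ^+ 2 * (`|B| + 1)).
  by rewrite mulr_ge0// mulr_ge0 ?mulr_ge0 ?sqr_ge0 ?addr_ge0.
have r0 : 0 <= h n * (4 * (t + 1)) by rewrite mulr_ge0// mulr_ge0// addr_ge0.
apply: (le_trans (expD t0 _)).
  have ht : 0 <= h n * t by rewrite mulr_ge0.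
  by nra.
rewrite lee_fin ler_wpM2l// ler_expR.
apply: (@le_trans _ _ (h n * (4 * t ^+ 2 * (`|B| + 1)))); last by lra.
have t2 := sqr_ge0 t.
rewrite (_ : 4 * t ^+ 2 * (h n * M n) = (h n * (4 * t ^+ 2)) * M n); last by ring.
rewrite [leRHS]mulrA ler_wpM2l// mulr_ge0// mulr_ge0//.
Unshelve. all: by end_near. Qed.

Lemma cvg_Lp_exp (B p : R) : h n @[n --> \oo] --> 0 ->
  (\forall n \near \oo, M n <= B) -> 1 <= p -> cvg_Lp P p D 0.
Proof.
move=> hto0 MB p1; rewrite /cvg_Lp; apply: cvge0_le => [n|e e0].
  by rewrite expectation_ge0// => w; exact: powR_ge0.
have [N pN] : exists N : nat, p <= N%:R.
  by have [N _ HN] := nbhs_infty_ger p; exists N; exact: (HN N (leqnn N)).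
pose c := (1 + N`!%:R) * (2 * expR 1) : R.
have c0 : 0 < c by rewrite mulr_gt0 ?mulr_gt0 ?expR_gt0// ltr_pwDl.
(* Chosen so that t >= 1 and c / t <= e. *)
pose t := 1 + c / e.
have ce0 : 0 < c / e by exact: divr_gt0.
have t1 : 1 <= t by rewrite lerDl ltW.
have t0 : 0 < t by apply: lt_le_trans t1.
have := near_exp hto0 MB (ltW t0); apply: filterS => n Hn.
rewrite unlock.
apply: (@le_trans _ _ (\int[P]_w (((1 + N`!%:R) / t)%:E * (expR (t * D n w))%:E))%E).
  apply: ge0_le_integral => //.
  - apply/measurable_EFinP; apply: (measurableT_comp (measurable_powR _)).
    by apply: measurableT_comp => //; exact: measurable_funB.
  - apply: emeasurable_funM => //; apply/measurable_EFinP.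
    by apply: measurableT_comp => //; exact: measurable_funM.
  - move=> w _; rewrite -EFinM lee_fin subr0 ger0_norm//.
    exact: powR_le_expR.
have k0 : 0 <= (1 + N`!%:R) / t by rewrite divr_ge0// ?addr_ge0// ltW.
have mE : measurable_fun setT (fun w => (expR (t * D n w))%:E).
  by apply/measurable_EFinP; apply: measurableT_comp => //; exact: measurable_funM.
rewrite ge0_integralZl//.
apply: (@le_trans _ _ (((1 + N`!%:R) / t)%:E * (2 * expR 1)%:E)%E).
  by rewrite lee_wpmul2l.
rewrite -EFinM lee_fin mulrAC -/c ler_pdivrMr//.
by rewrite /t mulrDr mulr1 mulrCA divff ?gt_eqF// mulr1 lerDr ltW.
Qed.

Lemma cvg_prob_exp (B : R) : h n @[n --> \oo] --> 0 ->
  (\forall n \near \oo, M n <= B) -> cvg_prob P D 0.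
Proof.
move=> hto0 MB e e0; apply: cvge0_le => // del del0.
pose c : R := 2 * expR 1.
have c0 : 0 < c by rewrite mulr_gt0 ?expR_gt0.
(* As exp(-te) <= 1/(te), Chernoff's bound becomes c / (te) = del. *)
pose t := c / (del * e).
have t0 : 0 < t by rewrite divr_gt0 ?mulr_gt0.
have := near_exp hto0 MB (ltW t0); apply: filterS => n Hn.
rewrite (_ : [set w | (e < `|D n w - 0|)%R] = [set w | (e < D n w)%R]); last first.
  by apply/seteqP; split => w /=; rewrite subr0 ger0_norm.
apply: (le_trans (chernoff_tail e (mD n) (ltW t0) Hn)); rewrite lee_fin -/c.
have te0 : 0 < t * e by rewrite mulr_gt0.
apply: (@le_trans _ _ ((t * e)^-1 * c)).
  rewrite ler_wpM2r ?(ltW c0)// expRN lef_pV2 ?posrE ?expR_gt0//.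
  by have := expR_ge1Dx (t * e); lra.
rewrite le_eqVlt; apply/orP; left; apply/eqP.
by rewrite /t; field; rewrite !gt_eqF.
Qed.

(** Telescoping: 1/(k+N+2)^2 <= 1/(k+1) - 1/(k+2). *)
Let sum_invr_sqr (N : nat) :
  (\sum_(0 <= k <oo) (((k + N.+2)%:R ^+ 2)^-1 : R)%:E <= 1%:E)%E.
Proof.
apply: lime_le.
  by apply: is_cvg_nneseries => n _ _; rewrite lee_fin invr_ge0 sqr_ge0.
apply: nearW => K.
apply: (@le_trans _ _ (1 - K.+1%:R^-1 : R)%:E); last by rewrite lee_fin gerBl.
rewrite sumEFin lee_fin; elim: K => [|K IH].
  by rewrite big_geq// invr1 subrr.
rewrite big_nat_recr//=.
have K1 : 0 < K.+1%:R :> R by [].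
have K2 : 0 < K.+2%:R :> R by [].
have H : ((K + N.+2)%:R ^+ 2)^-1 <= (K.+1%:R * K.+2%:R)^-1 :> R.
  rewrite lef_pV2 ?posrE ?mulr_gt0 ?exprn_gt0 ?ltr0n ?addnS// expr2.
  by rewrite ler_pM// ler_nat; lia.
have E : K.+1%:R^-1 - K.+2%:R^-1 = (K.+1%:R * K.+2%:R)^-1 :> R.
  have E2 : K.+2%:R = K.+1%:R + 1 :> R by rewrite natr1.
  rewrite E2 in K2 *; move: (K.+1%:R : R) K1 K2 => x x0 x1.
  by field; rewrite !gt_eqF.
by rewrite (le_trans (lerD IH H))// -E addrA subrK.
Qed.

Let limsup_negligible (B e : R) :
  (forall e : R, 0 < e -> \forall n \near \oo, h n * ln n%:R <= e) ->
  (\forall n \near \oo, M n <= B) -> 0 < e ->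
  P.-negligible (lim_sup_set (fun n => [set w | (e < D n w)%R])).
Proof.
(* Chernoff's bound with exponent [a * ln n] makes the tails O(n^-2). *)
move=> hln MB e0; pose a := 3 / e.
have a0 : 0 < a by exact: divr_gt0.
pose c := 4 * a + 4 * a ^+ 2 * (`|B| + 1).
have b1 : 0 < `|B| + 1 by rewrite ltr_wpDl.
have a2 : 0 < a ^+ 2 by rewrite exprn_gt0.
have c0 : 0 < c by rewrite addr_gt0// mulr_gt0// mulr_gt0.
have ci0 : 0 < c^-1 by rewrite invr_gt0.
(* Chernoff's factor is then n^-3, while c is chosen so that the exponential moment contributes at
   most 2n. *)
have ea : a * e = 3 by rewrite /a divfK// gt_eqF.
have [N _ HN] : \forall n \near \oo,
    (P [set w | (e < D n w)%R] <= 2%:E * ((n%:R ^+ 2)^-1 : R)%:E)%E.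
  have H1 := hln _ ci0.
  near=> n.
  have hn : h n * ln n%:R * c <= 1.
    by rewrite -ler_pdivlMr// mul1r; near: n.
  have Mn : M n <= `|B| + 1.
    apply: (@le_trans _ _ B); first by near: n.
    by rewrite (le_trans (ler_norm _))// lerDl.
  have n1 : 1 <= n%:R :> R by rewrite ler1n; near: n; exact: nbhs_infty_ge.
  have l0 : 0 <= ln (n%:R : R) by exact: ln_ge0.
  have hn0 := h0 n; have Mn0 := M0 n.
  have hl0 : 0 <= h n * ln n%:R by rewrite mulr_ge0.
  have q0 : 0 <= h n * ln n%:R * (4 * a ^+ 2 * (`|B| + 1)).
    by rewrite mulr_ge0// ltW// mulr_gt0// mulr_gt0.
  have r0 : 0 <= h n * ln n%:R * (4 * a) by rewrite mulr_ge0// mulr_ge0// ltW.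
  have t0 : 0 <= a * ln n%:R by rewrite mulr_ge0// ltW.
  have th : a * ln n%:R * h n <= 1 / 4 by rewrite /c in hn; nra.
  apply: (le_trans (chernoff_tail e (mD n) t0 (expD t0 th))).
  rewrite -EFinM lee_fin mulrCA ler_wpM2l// -expRD.
  have np : (0 : R) < n%:R by apply: lt_le_trans n1.
  have -> : (n%:R ^+ 2)^-1 = expR (- (2 * ln n%:R)) :> R.
    by rewrite expRN expRM_natl lnK ?posrE.
  rewrite ler_expR mulrAC ea.
  suff : 4 * (a * ln n%:R) ^+ 2 * (h n * M n) <= ln n%:R by lra.
  apply: (@le_trans _ _ (ln n%:R * (h n * ln n%:R * (4 * a ^+ 2 * (`|B| + 1))))).
    rewrite (_ : 4 * _ * _ = ln n%:R * (h n * ln n%:R * (4 * a ^+ 2 * M n))); last by ring.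
    rewrite ler_wpM2l// ler_wpM2l// ler_wpM2l// ltW// mulr_gt0//.
  rewrite -[leRHS]mulr1 ler_wpM2l//; rewrite /c in hn; lra.
(* The tail bound holds from N on only. Dropping finitely many events leaves the upper limit
   unchanged and makes the whole series summable. *)
pose F k := [set w | (e < D (k + N.+2)%N w)%R].
have mF k : measurable (F k).
  rewrite -[X in measurable X]setTI (_ : F k = D (k + N.+2)%N @^-1` `]e, +oo[%classic).
    exact: mD.
  by apply/seteqP; split => w /=; rewrite /F/= in_itv/= andbT.
have sF : (\sum_(0 <= k <oo) P (F k) < +oo)%E.
  apply: (@le_lt_trans _ _ (2%:E * \sum_(0 <= k <oo) (((k + N.+2)%:R ^+ 2)^-1 : R)%:E)%E).
    rewrite -nneseriesZl//.
    apply: lee_nneseries => k _; first by move=> _; exact: measure_ge0.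
    apply: HN => /=; rewrite (leq_trans _ (leq_addl _ _))// ltnW// ltnW.
  apply: (@le_lt_trans _ _ (2%:E * 1%:E)%E); last by rewrite -EFinM ltry.
  by rewrite lee_wpmul2l// ?sum_invr_sqr.
exists (lim_sup_set F); split.
- apply: bigcap_measurableType => k _; apply: bigcup_measurable => j _; exact: mF.
- exact: lim_sup_set_cvg0.
- move=> w /= Hw k _; have [j /= kj Hj] := Hw (k + N.+2)%N I.
  exists (j - N.+2)%N => /=; first by rewrite leq_subRL ?(leq_trans (leq_addl _ _) kj)// addnC.
  by rewrite /F/= subnK// (leq_trans (leq_addl _ _) kj).
Unshelve. all: by end_near. Qed.

Lemma cvg_as_exp (B : R) :
  (forall e : R, 0 < e -> \forall n \near \oo, h n * ln n%:R <= e) ->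
  (\forall n \near \oo, M n <= B) -> cvg_as P D 0.
Proof.
move=> hln MB.
have Hneg := @negligible_bigcup _ _ _ P
  (fun j => lim_sup_set (fun n => [set w | (j.+1%:R^-1 < D n w)%R]))
  (fun j => limsup_negligible hln MB (harmonic_gt0 j)).
apply: negligibleS Hneg => w /= nw; apply: contrapT => nL; apply: nw.
apply/cvgr0Pnorm_le => e e0.
have [j je] : exists j, j.+1%:R^-1 < e :> R.
  have [j _ Hj] := near_infty_natSinv_lt (PosNum e0).
  by exists j; apply: (Hj j) => /=.
have [k Hk] : exists k, forall n, (k <= n)%N -> D n w <= j.+1%:R^-1.
  apply: contrapT => nk; apply: nL; exists j => // k _.
  apply: contrapT => nkk; apply: nk; exists k => n kn; rewrite leNgt; apply/negP => Hn.
  by apply: nkk; exists n.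
exists k => // n kn /=; rewrite ger0_norm// (le_trans (Hk n kn))// ltW//.
Qed.

End exponential_moments.

(** * Quadratic variation along partitions *)

(** The sum of the squares (n x_i - S)^2 equals n (n sum x_i^2 - S^2); scaling by n avoids dividing
    for the mean. *)
Lemma sqr_sum_le (R : realFieldType) (n : nat) (x : 'I_n -> R) :
  (\sum_i x i) ^+ 2 <= n%:R * \sum_i x i ^+ 2.
Proof.
have [n0|n0] := posnP n.
  by subst n; rewrite !big_ord0 mulr0 expr0n.
have np : 0 < n%:R :> R by rewrite ltr0n.
have : 0 <= \sum_i (n%:R * x i - \sum_j x j) ^+ 2.
  by apply: sumr_ge0 => i _; exact: sqr_ge0.
set S := \sum_j x j; have -> : \sum_i (n%:R * x i - S) ^+ 2 =
    n%:R * (n%:R * (\sum_i x i ^+ 2) - S ^+ 2).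
  transitivity (\sum_i (n%:R ^+ 2 * x i ^+ 2 - 2 * n%:R * S * x i + S ^+ 2)).
    by apply: eq_bigr => i _; ring.
  rewrite big_split big_split/= -mulr_sumr sumrN -mulr_sumr -/S sumr_const card_ord.
  by rewrite -[S ^+ 2 *+ n]mulr_natl; ring.
by rewrite pmulr_rge0// subr_ge0.
Qed.

Section one_partition.
Context {d : measure_display} {Om : measurableType d} {R : realType}.
Variables (P : probability Om R) (T : R) (X : R -> {RV P >-> R}).
Hypothesis hXgauss : gaussian_process `[0, T] X.
Hypothesis hXcentred : centred_process `[0, T] X.
Variables (phi : R -> R) (s : seq R).
Hypothesis hs : itv_partition 0 T s.
Hypothesis hphi : forall k, (k < size s)%N -> 0 < phi (step s k).
Variable b : R.
Hypothesis hb : max_cov_sum X phi s <= b.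

Let coordinates : exists (Z : 'I_(size s) -> Om -> R) (lam : 'I_(size s) -> R), [/\
    gaussian_coordinates P Z lam, qv1 X phi s = sqnorm Z,
    qv1_mean X phi s = \sum_i lam i & (forall i, lam i <= b)].
Proof.
have [Z [lam [hZ E1 E2 H]]] := partition_gaussian_coordinates hXgauss hXcentred hs hphi.
by exists Z, lam; split => // i; exact: le_trans (H i) hb.
Qed.

Lemma max_cov_sum_ge0 : 0 <= max_cov_sum X phi s.
Proof. exact: bigmax_ge_id. Qed.

Let b0 : 0 <= b. Proof. exact: le_trans max_cov_sum_ge0 hb. Qed.

Lemma qv1_mean_ge0 : 0 <= qv1_mean X phi s.
Proof.
have [Z [lam [hZ _ -> _]]] := coordinates.
by apply: sumr_ge0 => i _; exact: gc_variance_ge0 hZ i.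
Qed.

Lemma measurable_qv1 : measurable_fun setT (qv1 X phi s).
Proof. by have [Z [lam [hZ -> _ _]]] := coordinates; exact: gaussian_sqnorm_measurable hZ. Qed.

Lemma qv1_exponential_moment (t : R) : 0 <= t -> t * b <= 1 / 4 ->
  (\int[P]_w (expR (t * `|qv1 X phi s w - qv1_mean X phi s|))%:E
     <= (2 * expR (4 * t ^+ 2 * (b * qv1_mean X phi s)))%:E)%E.
Proof.
have [Z [lam [hZ -> -> lamb]]] := coordinates => t0 tb.
have lam0 i := gc_variance_ge0 hZ i.
have tlam i : t * (1 * lam i) <= 1 / 4 by rewrite mul1r (le_trans _ tb)// ler_wpM2l.
have H := gaussian_quadratic_mgf_norm_le hZ (fun=> ler01) t0 tlam.
have E1 w : `|\sum_i 1 * Z i w ^+ 2 - \sum_i 1 * lam i| = `|sqnorm Z w - \sum_i lam i|.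
  by congr (`|_ - _|); apply: eq_bigr => i _; rewrite mul1r.
under eq_integral do rewrite -E1.
apply: (le_trans H); rewrite lee_fin ler_wpM2l// ler_expR ler_wpM2l//.
  by rewrite mulr_ge0 ?sqr_ge0.
rewrite mulr_sumr; apply: ler_sum => i _; rewrite mul1r expr2.
by rewrite ler_wpM2r.
Qed.

Let normalization : exists (Z : 'I_(size s) -> Om -> R) (lam : 'I_(size s) -> R), [/\
    gaussian_coordinates P Z lam, (forall i, lam i <= b),
    qv1_mean X phi s = \sum_i lam i,
    'V_P[qv1_centred X phi s] = (2 * \sum_i lam i ^+ 2)%:E &
    qv1_normalized X phi s =
      (fun w => (sqnorm Z w - \sum_i lam i) / Num.sqrt (2 * \sum_i lam i ^+ 2))].
Proof.
have [Z [lam [hZ EV EM lamb]]] := coordinates.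
exists Z, lam.
have E1 : qv1_centred X phi s = (fun w => sqnorm Z w - \sum_i lam i).
  apply/funext => w; rewrite /qv1_centred EV unlock.
  by rewrite -/(Rintegral P setT (sqnorm Z)) (gaussian_sqnorm_mean hZ).
have E2 : 'V_P[qv1_centred X phi s] = (2 * \sum_i lam i ^+ 2)%:E.
  have EE : fine 'E_P[qv1_centred X phi s] = 0.
    rewrite E1 unlock -/(Rintegral P setT (fun w => sqnorm Z w - \sum_i lam i)).
    exact: gaussian_sqnorm_dev_mean hZ.
  rewrite /variance covariance.unlock EE -(gaussian_sqnorm_variance hZ) expectation.unlock.
  rewrite Rintegral_EFin; last exact: gaussian_sqnorm_sqdev_integrable hZ.
  by apply: eq_integral => w _; rewrite E1 expr2 -[in RHS](subr0 (sqnorm Z w - _)).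
split => //.
by apply/funext => w; rewrite /qv1_normalized E2 E1.
Qed.

Lemma qv1_variance_neq0 : ('V_P[qv1_centred X phi s] != 0)%E -> 0 < qv1_mean X phi s.
Proof.
have [Z [lam [hZ lamb -> -> _]]] := normalization.
have lam0 i := gc_variance_ge0 hZ i.
move=> V0; rewrite lt_neqAle sumr_ge0// andbT eq_sym; apply: contra V0.
rewrite psumr_eq0// => /allP L0; rewrite big1 ?mulr0// => i _.
have := L0 i; rewrite mem_index_enum => /(_ isT) /= /eqP ->.
by rewrite expr0n.
Qed.

(** Cauchy-Schwarz with n increments; the weaker n + 1, the number of points, matches the
    normalisation of the theorem. *)
Let sd_bound (n : nat) (x : 'I_n -> R) : 0 < \sum_i x i ->
  0 < \sum_i x i ^+ 2 /\
  b / Num.sqrt (2 * \sum_i x i ^+ 2) <= Num.sqrt n.+1%:R * b / \sum_i x i.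
Proof.
move=> x0; set S2 := \sum_i _ ^+ 2; set S1 := \sum_i x i in x0 *.
have CS : S1 ^+ 2 <= n%:R * S2 := sqr_sum_le x.
have S20 : 0 < S2.
  rewrite lt_neqAle sumr_ge0 ?andbT => [|i _]; last exact: sqr_ge0.
  apply/eqP => S0; move: CS; rewrite -S0 mulr0 => /(lt_le_trans (exprn_gt0 2 x0)).
  by rewrite ltxx.
split => //.
have q0 : 0 < Num.sqrt (2 * S2) by rewrite sqrtr_gt0 mulr_gt0.
rewrite ler_pdivrMr// mulrAC ler_pdivlMr// mulrAC mulrC ler_wpM2r//.
rewrite -[S1](ger0_norm (ltW x0)) -sqrtr_sqr -sqrtrM//.
rewrite ler_sqrt; last by rewrite mulr_ge0// mulr_ge0// ltW.
by apply: (le_trans CS); rewrite -natr1; have : 0 <= n%:R :> R by []; nra.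
Qed.

Lemma qv1_kolmogorov_lt (z : R) : 0 < qv1_mean X phi s ->
  (`|P [set w | (qv1_normalized X phi s w < z)%R] - normal_prob 0 1 `]-oo, z[%classic|
    <= (48 / qv1_mean X phi s * Num.sqrt (num_points s)%:R * b)%:E)%E.
Proof.
have [Z [lam [hZ lamb -> _ ->]]] := normalization => /sd_bound[L0 L1].
apply: (le_trans (gaussian_kolmogorov_lt hZ lamb L0 z)); rewrite lee_fin.
rewrite [leRHS](_ : _ = 48 * (Num.sqrt (num_points s)%:R * b / \sum_i lam i)).
  by rewrite ler_wpM2l.
by ring.
Qed.

Lemma qv1_kolmogorov_le (z : R) : 0 < qv1_mean X phi s ->
  (`|P [set w | (qv1_normalized X phi s w <= z)%R] - normal_prob 0 1 `]-oo, z]%classic|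
    <= (48 / qv1_mean X phi s * Num.sqrt (num_points s)%:R * b)%:E)%E.
Proof.
have [Z [lam [hZ lamb -> _ ->]]] := normalization => /sd_bound[L0 L1].
apply: (le_trans (gaussian_kolmogorov_le hZ lamb L0 z)); rewrite lee_fin.
rewrite [leRHS](_ : _ = 48 * (Num.sqrt (num_points s)%:R * b / \sum_i lam i)).
  by rewrite ler_wpM2l.
by ring.
Qed.

End one_partition.

(** * Bounds along a sequence of partitions *)

Section eventual_bounds.
Context {R : realType}.
Implicit Types (u v M : nat -> R) (K : \bar R).

Lemma littleo_le_norm u v (e : R) : u =o_\oo v -> 0 < e ->
  \forall n \near \oo, `|u n| <= e * `|v n|.
Proof. by move=> /eqoP uv; exact: uv. Qed.

Lemma near_ln_ge1 : \forall n \near \oo, 1 <= ln (n%:R : R).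
Proof.
near=> n; have ne : expR 1 <= n%:R :> R by near: n; exact: nbhs_infty_ger.
by rewrite -ler_expR lnK// posrE (lt_le_trans (expR_gt0 1)).
Unshelve. all: by end_near. Qed.

Lemma littleo_invr_ln u : (forall n, 0 <= u n) ->
  u =o_\oo (fun n => (ln n%:R)^-1) ->
  (forall e : R, 0 < e -> \forall n \near \oo, u n * ln n%:R <= e) /\
  u n @[n --> \oo] --> 0.
Proof.
move=> u0 uo; have ul (e : R) : 0 < e -> \forall n \near \oo, u n * ln n%:R <= e.
  move=> e0; have := littleo_le_norm uo e0; have := near_ln_ge1.
  apply: filterS2 => n l1; have l0 := lt_le_trans ltr01 l1.
  by rewrite ger0_norm// ger0_norm ?invr_ge0 ?(ltW l0)// ler_pdivlMr.
split => //; apply/cvgr0Pnorm_le => e e0; have := ul _ e0; have := near_ln_ge1.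
apply: filterS2 => n l1 une; rewrite ger0_norm// (le_trans _ une)//.
by rewrite ler_peMr.
Qed.

Lemma cvge_near_le M K : (K < +oo)%E -> (M n)%:E @[n --> \oo] --> K ->
  exists B : R, \forall n \near \oo, M n <= B.
Proof.
move=> Koo MK; have [B KB] : exists B : R, (K < B%:E)%E.
  case: K Koo {MK} => [r _|//|_]; last by exists 0; rewrite ltNyr.
  by exists (r + 1); rewrite lte_fin ltrDl.
have ltB : \forall n \near \oo, ((M n)%:E < B%:E)%E.
  exact: (MK [set u | (u < B%:E)%E] (open_ereal_lt' KB)).
exists B; apply: filterS ltB => n /=.
by rewrite lte_fin => /ltW.
Qed.

Lemma cvge_near_ge M K : (0 < K)%E -> (M n)%:E @[n --> \oo] --> K ->
  exists2 c : R, 0 < c & \forall n \near \oo, c <= M n.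
Proof.
move=> K0 MK; have [c c0 cK] : exists2 c : R, 0 < c & (c%:E < K)%E.
  case: K K0 {MK} => [r|_|//]; last by exists 1; rewrite ?ltry.
  by rewrite lte_fin => r0; exists (r / 2); rewrite ?divr_gt0// lte_fin ltr_pdivrMr// ltr_pMr// ltr1n.
have ltc : \forall n \near \oo, (c%:E < (M n)%:E)%E.
  exact: (MK [set u | (c%:E < u)%E] (open_ereal_gt' cK)).
exists c => //; apply: filterS ltc => n /=.
by rewrite lte_fin => /ltW.
Qed.

(** The finitely many early terms are absorbed by adding all their inverses. This makes the constant
    of the normal approximation valid for every n, not only for large n. *)
Lemma invr_bounded_where_pos M (c : R) : 0 < c -> (\forall n \near \oo, c <= M n) ->
  exists2 C : R, 0 < C & forall n, 0 < M n -> (M n)^-1 <= C.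
Proof.
move=> c0 [N _ HN]; exists (c^-1 + \sum_(i < N) `|(M i)^-1|).
  by rewrite ltr_pwDl ?invr_gt0// sumr_ge0.
move=> n Mn0; have [nN|Nn] := ltnP n N.
  rewrite (bigD1 (Ordinal nN))//= (le_trans (ler_norm _))//.
  by rewrite addrCA lerDl addr_ge0 ?invr_ge0 ?(ltW c0)// sumr_ge0.
rewrite (@le_trans _ _ c^-1)// ?lerDl ?sumr_ge0// lef_pV2 ?posrE//.
exact: HN.
Qed.

End eventual_bounds.

Lemma cvg_measure_norm_le {d} {Om : measurableType d} {R : realType}
    (P : probability Om R) (A : nat -> set Om) (m : R) (b : nat -> R) :
  (forall n, measurable (A n)) ->
  (\forall n \near \oo, (`|P (A n) - m%:E| <= (b n)%:E)%E) ->
  (forall e : R, 0 < e -> \forall n \near \oo, b n <= e) ->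
  P (A n) @[n --> \oo] --> m%:E.
Proof.
move=> mA Pb be; apply/fine_cvgP; split.
  by apply: nearW => n; exact: fin_num_measure.
apply/cvgrPdist_le => e e0; have := be _ e0; apply: filterS2 Pb => n Pn bn.
rewrite distrC -lee_fin; apply: le_trans (bn : ((b n)%:E <= e%:E)%E).
apply: le_trans Pn.
by rewrite /= -[in leRHS](fineK (fin_num_measure P (A n) (mA n))).
Qed.

Theorem theorem3p1 (R : realType) (d : measure_display) (Om : measurableType d)
  (P : probability Om R) (T : R) (hT : 0 < T)
  (X : R -> {RV P >-> R})
  (hXgauss : gaussian_process `[0, T] X)
  (hXcentred : centred_process `[0, T] X)
  (phi : R -> R) (part : nat -> seq R) (kap : R -> R) (H : R -> R)
  (hpart : forall n, itv_partition 0 T (part n))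
  (hmesh : mesh (part n) @[n --> \oo] --> 0)
  (hkap : forall n, mesh (part n) / min_step (part n) <= kap (mesh (part n)))
  (hphi : forall n k, (k < size (part n))%N -> 0 < phi (step (part n) k))
  (hH : forall n, max_cov_sum X phi (part n) <= H (mesh (part n))) :
  let dev : nat -> Om -> R := fun n w =>
    `|qv1 X phi (part n) w - qv1_mean X phi (part n)| in
  let H_vanishes : Prop := H (mesh (part n)) @[n --> \oo] --> 0 in
  let H_log : Prop :=
    (fun n : nat => H (mesh (part n))) =o_\oo (fun n : nat => (ln n%:R)^-1 : R) in
  (* The first two convergences need the sums of expectations to be bounded,
     which is implied by their convergence to K < +oo: for Brownian motion on
     [0, 1], uniform partitions and phi x = sqrt x, they are unbounded and dev
     does not tend to 0, although one can take H x = sqrt x. *)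
  [/\ has_ubound (range (fun n => qv1_mean X phi (part n))) ->
        (H_vanishes -> cvg_prob P dev 0) /\ (H_log -> cvg_as P dev 0),
      forall K : \bar R, (K < +oo)%E ->
        (qv1_mean X phi (part n))%:E @[n --> \oo] --> K ->
        H_vanishes \/ H_log ->
        forall p : R, 1 <= p -> cvg_Lp P p dev 0 &
      forall K : \bar R, (0 < K)%E ->
        (qv1_mean X phi (part n))%:E @[n --> \oo] --> K ->
        (exists2 C : R, 0 < C &
          forall n, ('V_P[qv1_centred X phi (part n)] != 0)%E ->
            (kolmogorov_dist P (qv1_normalized X phi (part n)) (normal_prob 0 1)
             <= (C * Num.sqrt (num_points (part n))%:R * H (mesh (part n)))%:E)%E) /\
        ((fun n : nat => H (mesh (part n))) =o_\oo
           (fun n : nat => (Num.sqrt (num_points (part n))%:R)^-1 : R) ->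
         cvg_law P (fun n => qv1_normalized X phi (part n)) (normal_prob 0 1))].
Proof.
move=> dev H_vanishes H_log.
pose h n := H (mesh (part n)); pose M n := qv1_mean X phi (part n).
have h0 n : 0 <= h n := le_trans (max_cov_sum_ge0 X phi (part n)) (hH n).
have mqv n : measurable_fun setT (qv1 X phi (part n)).
  exact: (measurable_qv1 hXgauss hXcentred (hpart n) (hphi n) (hH n)).
have M0 n : 0 <= M n.
  exact: (qv1_mean_ge0 hXgauss hXcentred (hpart n) (hphi n) (hH n)).
have mdev n : measurable_fun setT (dev n).
  by apply: measurableT_comp => //; exact: measurable_funB.
have dev0 n w : 0 <= dev n w by exact: normr_ge0.
have expdev n (t : R) : 0 <= t -> t * h n <= 1 / 4 ->
    (\int[P]_w (expR (t * dev n w))%:E <= (2 * expR (4 * t ^+ 2 * (h n * M n)))%:E)%E.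
  exact: (qv1_exponential_moment hXgauss hXcentred (hpart n) (hphi n) (hH n)).
have loglim (l : H_log) := littleo_invr_ln h0 l.
split.
- move=> [B /ubP MB].
  have nMB : \forall n \near \oo, M n <= B by apply: nearW => n; apply: MB; exists n.
  split => [hto0|/loglim[hl _]].
    exact: (cvg_prob_exp mdev dev0 h0 M0 expdev hto0 nMB).
  exact: (cvg_as_exp mdev dev0 h0 M0 expdev hl nMB).
- move=> K Koo MK Hlim p p1.
  have hto0 : h n @[n --> \oo] --> 0 by case: Hlim => // /loglim[].
  have [B MB] := cvge_near_le Koo MK.
  exact: (cvg_Lp_exp mdev dev0 h0 M0 expdev hto0 MB p1).
- move=> K K0 MK; have [c c0 Mc] := cvge_near_ge K0 MK.
  have [C C0 HC] := invr_bounded_where_pos c0 Mc.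
  have bound n : 0 < M n ->
      48 / M n * Num.sqrt (num_points (part n))%:R * h n <=
      48 * C * Num.sqrt (num_points (part n))%:R * h n.
    by move=> Mn; rewrite ler_wpM2r// ler_wpM2r ?sqrtr_ge0// ler_wpM2l// HC.
  split.
    exists (48 * C); first by rewrite mulr_gt0.
    (* A vanishing mean would make every lam, hence the variance, zero; so the bound on 1 / M n is
       available at this n even if M n is below c. *)
    move=> n V0; have Mn : 0 < M n.
      exact: (qv1_variance_neq0 hXgauss hXcentred (hpart n) (hphi n) (hH n) V0).
    apply: ge_ereal_sup => _ [x _ <-].
    apply: le_trans (qv1_kolmogorov_lt hXgauss hXcentred (hpart n) (hphi n) (hH n) x Mn) _.
    by rewrite lee_fin bound.
  move=> ho x _.
  rewrite -[normal_prob _ _ _](fineK (fin_num_measure _ _ _))//.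
  apply: (@cvg_measure_norm_le _ _ _ P _ _
    (fun n => 48 * C * Num.sqrt (num_points (part n))%:R * h n)).
  + move=> n; rewrite -[X in measurable X]setTI.
    have mN : measurable_fun setT (qv1_normalized X phi (part n)).
      by apply: measurable_funM => //; exact: measurable_funB.
    rewrite (_ : [set w | _] = qv1_normalized X phi (part n) @^-1` `]-oo, x]%classic).
      exact: mN.
    by apply/seteqP; split => w /=; rewrite in_itv.
  + apply: filterS Mc => n cM; have Mn : 0 < M n := lt_le_trans c0 cM.
    rewrite fineK ?fin_num_measure//.
    apply: le_trans (qv1_kolmogorov_le hXgauss hXcentred (hpart n) (hphi n) (hH n) x Mn) _.
    by rewrite lee_fin bound.
  + move=> e e0; have e48 : 0 < e / (48 * C) by rewrite divr_gt0// mulr_gt0.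
    have := littleo_le_norm ho e48; apply: filterS => n.
    have q0 : 0 < Num.sqrt (num_points (part n))%:R :> R by rewrite sqrtr_gt0.
    rewrite ger0_norm; last exact: h0.
    rewrite gtr0_norm ?invr_gt0// ler_pdivlMr// ler_pdivlMr ?mulr_gt0// => he.
    by rewrite -mulrA mulrC [_ * h n]mulrC.
Qed.
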